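(* Let $N\ge2$ and let $\mu$ and $\mu'$ be two quasi-stationary Markov measures on $\mathcal K_N$ associated to $(\lambda,T)$ and $(\lambda',T')$ respectively. Let $\pi(\mathcal O_N)=(S_i)_{i\in\mathbb Z_N}$ and $\pi'(\mathcal O_N)=(S_i')_{i\in\mathbb Z_N}$ be the two associated representations of the Cuntz algebra $\mathcal O_N$. Define $Z_\infty$ on $\mathcal K_N$ (with values in $[0,\infty]$) by $$Z_\infty(x_1x_2\dots)=\frac{\lambda'_{x_1}}{\lambda_{x_1}}\limsup_{n}\prod_{k=1}^{n-1}\frac{T'^{(k)}_{x_k,x_{k+1}}}{T^{(k)}_{x_k,x_{k+1}}}.$$ The following statements are equivalent: (i) The representations $\pi(\mathcal O_N)$ and $\pi'(\mathcal O_N)$ are equivalent. (ii) The measures $\mu$ and $\mu'$ are equivalent. (iii) $\mu'(Z_\infty<\infty)=\mu(Z_\infty>0)=1$. (iv) For $\mu$-almost every and for $\mu'$-almost every $i_1i_2\dots\in\mathcal K_N$, $$\sum_{n=1}^\infty\left(1-\sum_{x_{n+1}\in\mathbb Z_N}\sqrt{T'^{(n)}_{i_n,x_{n+1}}}\sqrt{T^{(n)}_{i_n,x_{n+1}}}\right)<\infty.$$ Also, the following statements are equivalent: (a) The representations $\pi(\mathcal O_N)$ and $\pi'(\mathcal O_N)$ are disjoint. (b) The measures $\mu$ and $\mu'$ are mutually singular. (c) $\mu'(Z_\infty=\infty)=1$ or $\mu(Z_\infty=0)=1$. (d) For $\mu'$-a.e. $i_1i_2\dots\in\mathcal K_N$,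 $$\sum_{n=1}^\infty\left(1-\sum_{x_{n+1}\in\mathbb Z_N}\sqrt{T'^{(n)}_{i_n,x_{n+1}}}\sqrt{T^{(n)}_{i_n,x_{n+1}}}\right)=\infty.$$
   Context: $\mathbb N=\{1,2,\dots\}$, $\mathbb Z_N=\{0,1,\dots,N-1\}$, and $\mathcal K_N=\mathbb Z_N^{\mathbb N}$ is the set of infinite words $x_1x_2\dots$ over $\mathbb Z_N$, with the product topology and Borel sigma-algebra. The shift is $\sigma(x_1x_2\dots)=x_2x_3\dots$. For a finite word $I=i_1\dots i_n$, the cylinder set is $\mathcal C(I)=\{x\in\mathcal K_N:x_1=i_1,\dots,x_n=i_n\}$. Markov measures: a matrix is stochastic if each row sums to $1$. Let $\lambda=(\lambda_0,\dots,\lambda_{N-1})$ be a row vector with $\lambda_i>0$ and $\sum_i\lambda_i=1$, and let $T=\{T^{(n)}\}_{n\in\mathbb N}$ be a sequence of stochastic $N\times N$ matrices with $T^{(n)}_{i,j}>0$ for all $i,j\in\mathbb Z_N$, $n\in\mathbb N$, and such that $\lambda T^{(1)}=\lambda$. The Markov measure associated to $(\lambda,T)$ is the unique Borel probability measure $\mu$ on $\mathcal K_N$ with $$\mu(\mathcal C(i_1\dots i_n))=\lambda_{i_1}T^{(1)}_{i_1,i_2}T^{(2)}_{i_2,i_3}\cdots T^{(n-1)}_{i_{n-1},i_n}$$ for all finite words. It is quasi-stationary if $$\sum_{n=1}^\infty\left|\frac{T^{(n)}_{x_n,x_{n+1}}}{T^{(n+1)}_{x_n,x_{n+1}}}-1\right|<\infty\quad\text{for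 all }x_1x_2\dots\in\mathcal K_N.$$ Associated representation: a representation of the Cuntz algebra $\mathcal O_N$ on a Hilbert space is given by operators $(S_i)_{i\in\mathbb Z_N}$ with $S_i^*S_j=\delta_{ij}I$ and $\sum_{i}S_iS_i^*=I$. The representation associated to the quasi-stationary Markov measure $\mu$ with data $(\lambda,T)$ is the one on $L^2(\mu)$ given by $S_jf=f_j\,(f\circ\sigma)$, where $$f_j(x_1x_2\dots)=\delta_{j,x_1}\sqrt{\frac{\lambda_{x_2}}{\lambda_{x_1}T^{(1)}_{x_1,x_2}}F(x_2x_3\dots)},\qquad F(x_1x_2\dots)=\prod_{n=1}^\infty\frac{T^{(n)}_{x_n,x_{n+1}}}{T^{(n+1)}_{x_n,x_{n+1}}}$$ (the product converges to a number in $(0,\infty)$, and the $S_j$ do form a representation of $\mathcal O_N$). Two measures are equivalent if they are mutually absolutely continuous. Two representations $(S_i)$ on $\mathcal H$ and $(S_i')$ on $\mathcal H'$ are equivalent if there is a unitary $W:\mathcal H\to\mathcal H'$ with $WS_i=S_i'W$ for all $i$; they are disjoint if the only bounded operator $W:\mathcal H\to\mathcal H'$ with $WS_i=S_i'W$ and $WS_i^*=S_i'^*W$ for all $i$ is $W=0$. *)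

(* Defs.v *)
From HB Require Import structures.
From mathcomp Require Import all_boot all_order all_algebra.
From mathcomp Require Import generic_quotient ring_quotient sesquilinear.
From mathcomp Require Import all_classical all_reals all_analysis.
From mathcomp Require Import complex.
From mathcomp.algebra_tactics Require Import ring.

Set Implicit Arguments.
Unset Strict Implicit.
Unset Printing Implicit Defensive.

Import Order.TTheory GRing.Theory Num.Theory.
Import numFieldNormedType.Exports.

Local Open Scope classical_set_scope.
Local Open Scope ring_scope.

Section Operators.
Context {R : realType}.
Local Notation C := R[i].

Definition hnorm {H : lmodType C} (dot : {dot H for Num.conj}) (u : H) : C :=
  sqrtC (dot u u).

(* The operator B with <A u, v> = <u, B v>, which is unique; the default value 0
   is used only when there is none. *)
Definition adjoint {H : lmodType C} (dot : {dot H for Num.conj}) (A : H -> H) :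
    H -> H :=
  xget (fun=> 0) [set B : H -> H | forall u v, dot (A u) v = dot u (B v)].

Context {I : Type} {H H' : lmodType C}.
Context (dot : {dot H for Num.conj}) (dot' : {dot H' for Num.conj}).

Definition bounded_operator (W : {linear H -> H'}) : Prop :=
  exists M : C, forall u, hnorm dot' (W u) <= M * hnorm dot u.

Definition unitary_operator (W : {linear H -> H'}) : Prop :=
  (forall u v, dot' (W u) (W v) = dot u v) /\ (forall v, exists u, W u = v).

Definition equivalent_representations (S : I -> H -> H) (S' : I -> H' -> H') :
    Prop :=
  exists W : {linear H -> H'},
    unitary_operator W /\ forall i, W \o S i = S' i \o W.

Definition disjoint_representations (S : I -> H -> H) (S' : I -> H' -> H') :
    Prop :=
  forall W : {linear H -> H'}, bounded_operator W ->
    (forall i, W \o S i = S' i \o W) ->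
    (forall i, W \o adjoint dot (S i) = adjoint dot' (S' i) \o W) ->
    forall u, W u = 0.

End Operators.

Section SquareIntegrable.
Context d (T : measurableType d) (R : realType) (mu : {measure set T -> \bar R}).

Local Notation Re := (@complex.Re R).
Local Notation Im := (@complex.Im R).

Let one_le2 : (1 <= 2%:E :> \bar R)%E.
Proof. by rewrite lee_fin ler1n. Qed.

(* f is square integrable iff its real and imaginary parts are. *)
Definition sqint : {pred (T -> R[i])} :=
  [pred f | (Re \o f \in Lfun mu 2%:E) &&
            (Im \o f \in Lfun mu 2%:E)].

Let Lfun_lin (a b : R) (f g : T -> R) : f \in Lfun mu 2%:E ->
  g \in Lfun mu 2%:E -> (fun x => a * f x + b * g x) \in Lfun mu 2%:E.
Proof.
move=> fL gL; have [_ H] := Lfun_submod_closed mu one_le2.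
have h0 : (fun=> 0) \in Lfun mu 2%:E by have [] := Lfun_submod_closed mu one_le2.
have -> : (fun x => a * f x + b * g x) = a *: f + (b *: g + fun=> 0).
  by apply/funext => x; rewrite !fctE /= addr0.
exact: H fL (H b g _ gL h0).
Qed.

Lemma sqint_submod_closed : submod_closed sqint.
Proof.
split.
  have h0 : (fun=> 0) \in Lfun mu 2%:E by have [] := Lfun_submod_closed mu one_le2.
  by rewrite inE; apply/andP; split.
move=> a f g; rewrite !inE => /andP[rf jf] /andP[rg jg]; apply/andP; split.
- have -> : Re \o (a *: f + g) =
      (fun x => 1 * (Re a * Re (f x) + - Im a * Im (f x)) + 1 * Re (g x)).
    apply/funext => x /=; rewrite !fctE.
    by case: (f x) (g x) (a) => ? ? [? ?] [? ?] /=; ring.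
  exact: Lfun_lin (Lfun_lin _ _ rf jf) rg.
- have -> : Im \o (a *: f + g) =
      (fun x => 1 * (Im a * Re (f x) + Re a * Im (f x)) + 1 * Im (g x)).
    apply/funext => x /=; rewrite !fctE.
    by case: (f x) (g x) (a) => ? ? [? ?] [? ?] /=; ring.
  exact: Lfun_lin (Lfun_lin _ _ rf jf) jg.
Qed.

HB.instance Definition _ := GRing.isSubmodClosed.Build R[i] (T -> R[i]) sqint
  sqint_submod_closed.

Record sqfun := SqFun { sqfun_val :> T -> R[i]; _ : sqfun_val \in sqint }.

HB.instance Definition _ := [isSub for sqfun_val].
HB.instance Definition _ := [Choice of sqfun by <:].
HB.instance Definition _ := [SubChoice_isSubLmodule of sqfun by <:].

(* [L2] is the quotient of [sqfun] by the functions that vanish a.e. *)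
Definition sqnull : {pred sqfun} :=
  [pred f : sqfun | `[< {ae mu, forall x, (f : T -> R[i]) x = 0} >]].

Lemma sqnull_submod_closed : submod_closed sqnull.
Proof.
split; first by apply: asboolT; exact: nearW.
move=> a f g /asboolP f0 /asboolP g0; apply: asboolT.
apply: filterS2 f0 g0 => x fx gx /=.
by rewrite !fctE fx gx scaler0 addr0.
Qed.

HB.instance Definition _ := GRing.isSubmodClosed.Build R[i] sqfun sqnull
  sqnull_submod_closed.

Definition L2 : Type := Quotient.quot sqnull.

HB.instance Definition _ := EqQuotient.on L2.
HB.instance Definition _ := GRing.Zmodule.on L2.

Local Open Scope quotient_scope.

Definition L2scale (a : R[i]) (u : L2) : L2 := \pi_L2 (a *: repr u).

Lemma L2_pi_eq (f g : sqfun) : (\pi_L2 f == \pi_L2 g) = (f - g \in sqnull).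
Proof. exact: (esym (Quotient.idealrBE sqnull f g)). Qed.

Lemma L2scale_pi a (f : sqfun) : L2scale a (\pi_L2 f) = \pi_L2 (a *: f).
Proof.
apply/eqP; rewrite /L2scale L2_pi_eq -scalerBr rpredZ// -L2_pi_eq.
by rewrite reprK.
Qed.

Lemma L2_piD (f g : sqfun) : \pi_L2 (f + g) = \pi_L2 f + \pi_L2 g.
Proof. exact: Quotient.pi_add. Qed.

Lemma L2scaleA a b u : L2scale a (L2scale b u) = L2scale (a * b) u.
Proof. by rewrite -[u]reprK (L2scale_pi b) !L2scale_pi scalerA. Qed.

Lemma L2scale1 : left_id 1 L2scale.
Proof. by move=> u; rewrite -[u]reprK !L2scale_pi scale1r. Qed.

Lemma L2scaleDr : right_distributive L2scale +%R.
Proof.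
by move=> a u v; rewrite -[u]reprK -[v]reprK -L2_piD !L2scale_pi -L2_piD scalerDr.
Qed.

Lemma L2scaleDl u : {morph L2scale^~ u : a b / a + b}.
Proof. by move=> a b; rewrite -[u]reprK !L2scale_pi -L2_piD scalerDl. Qed.

HB.instance Definition _ := GRing.Zmodule_isLmodule.Build R[i] L2
  L2scaleA L2scale1 L2scaleDr L2scaleDl.

(* A representative of the class u. *)
Definition L2_fun (u : L2) : T -> R[i] := repr u.

(* The class of f, or 0 if f is not square integrable. *)
Definition L2_class (f : T -> R[i]) : L2 := \pi_L2 (insubd (0 : sqfun) f).

Definition Cintegral (f : T -> R[i]) : R[i] :=
  Complex (\int[mu]_x Re (f x))%R (\int[mu]_x Im (f x))%R.

(* Linear in the first argument. *)
Definition L2_dot (u v : L2) : R[i] :=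
  Cintegral (fun x => L2_fun u x * (L2_fun v x)^*).

Definition Cintegrable (f : T -> R[i]) : Prop :=
  mu.-integrable setT (EFin \o (Re \o f)) /\
  mu.-integrable setT (EFin \o (Im \o f)).

Lemma Cintegrable_mul (f g : sqfun) : Cintegrable (fun x => f x * (g x)^*).
Proof.
have /andP[rf jf] := valP f; have /andP[rg jg] := valP g.
have I (h k : T -> R) : h \in Lfun mu 2%:E -> k \in Lfun mu 2%:E ->
    mu.-integrable setT (EFin \o (h \* k)).
  by move=> hL kL; apply/Lfun1_integrable/Lfun2_mul_Lfun1.
split.
- have := integrableD measurableT (I _ _ rf rg) (I _ _ jf jg).
  apply: eq_integrable => // x _ /=; rewrite -EFinD; congr _%:E.
  by case: (f x) (g x) => ? ? [? ?] /=; ring.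
- have := integrableB measurableT (I _ _ jf rg) (I _ _ rf jg).
  apply: eq_integrable => // x _ /=; rewrite -EFinB; congr _%:E.
  by case: (f x) (g x) => ? ? [? ?] /=; ring.
Qed.

Lemma Cintegral_lin a f g : Cintegrable f -> Cintegrable g ->
  Cintegral (fun x => a * f x + g x) = a * Cintegral f + Cintegral g.
Proof.
move=> [rf jf] [rg jg].
have Z c (h : T -> R) : mu.-integrable setT (EFin \o h) ->
  mu.-integrable setT (EFin \o (fun x => c * h x)).
  by move=> hi; have := integrableZl measurableT c hi; apply: eq_integrable.
have D (h k : T -> R) : mu.-integrable setT (EFin \o h) ->
  mu.-integrable setT (EFin \o k) ->
  mu.-integrable setT (EFin \o (fun x => h x + k x)).
  by move=> hi ki; have := integrableD measurableT hi ki; apply: eq_integrable.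
rewrite /Cintegral.
under [X in Complex X _]eq_Rintegral => x _.
  rewrite (_ : Re _ = (Re a * Re (f x) + - Im a * Im (f x)) + Re (g x));
    last by case: (f x) (g x) (a) => ? ? [? ?] [? ?] /=; ring.
  over.
under [X in Complex _ X]eq_Rintegral => x _.
  rewrite (_ : Im _ = (Im a * Re (f x) + Re a * Im (f x)) + Im (g x));
    last by case: (f x) (g x) (a) => ? ? [? ?] [? ?] /=; ring.
  over.
rewrite !RintegralD// ?RintegralZl//; do ?[exact: D|exact: Z|apply: D].
case: (a) => b c; apply/eqP; rewrite eq_complex /=; apply/andP; split; apply/eqP.
  by rewrite mulNr.
by rewrite [c * _ + _]addrC.
Qed.

Lemma ae_Cintegral (f g : T -> R[i]) : Cintegrable f -> Cintegrable g ->
  {ae mu, forall x, f x = g x} -> Cintegral f = Cintegral g.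
Proof.
move=> [rf jf] [rg jg] fg; rewrite /Cintegral /Rintegral.
congr (Complex (fine _) (fine _)); apply: ae_eq_integral => //.
- exact: measurable_int rf.
- exact: measurable_int rg.
- by apply: filterS fg => x /= ->.
- exact: measurable_int jf.
- exact: measurable_int jg.
- by apply: filterS fg => x /= ->.
Qed.

Lemma L2_fun_pi (f : sqfun) : {ae mu, forall x, L2_fun (\pi_L2 f) x = f x}.
Proof.
have : repr (\pi_L2 f) - f \in sqnull by rewrite -L2_pi_eq reprK.
move=> /asboolP; apply: filterS => x /= /eqP.
by rewrite !fctE subr_eq0 => /eqP.
Qed.

Lemma L2_classK (f : T -> R[i]) : f \in sqint ->
  {ae mu, forall x, L2_fun (L2_class f) x = f x}.
Proof.
move=> fS; have := L2_fun_pi (insubd (0 : sqfun) f); apply: filterS => x.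
by rewrite insubdK.
Qed.

Lemma L2_eqP (u v : L2) :
  u = v <-> {ae mu, forall x, L2_fun u x = L2_fun v x}.
Proof.
split=> [->|uv]; first exact: nearW.
apply/eqP; rewrite -[u]reprK -[v]reprK L2_pi_eq; apply: asboolT.
apply: filterS uv => x; rewrite /L2_fun => uv.
by rewrite -[LHS]/((repr u : T -> R[i]) x - (repr v : T -> R[i]) x) uv subrr.
Qed.

Lemma L2_dot_pi (f g : sqfun) :
  L2_dot (\pi_L2 f) (\pi_L2 g) = Cintegral (fun x => f x * (g x)^*).
Proof.
apply: ae_Cintegral; [exact: Cintegrable_mul|exact: Cintegrable_mul|].
by apply: filterS2 (L2_fun_pi f) (L2_fun_pi g) => x /= -> ->.
Qed.

Lemma L2scaleE a (f : sqfun) : a *: (\pi_L2 f : L2) = \pi_L2 (a *: f).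
Proof. exact: L2scale_pi. Qed.

Lemma L2_dotC u v : L2_dot u v = (L2_dot v u)^*.
Proof.
rewrite /L2_dot /Cintegral.
rewrite [RHS](_ : _ = Complex (\int[mu]_x Re (L2_fun v x * (L2_fun u x)^*))
  (- \int[mu]_x Im (L2_fun v x * (L2_fun u x)^*)))//.
have [_ J] := Cintegrable_mul (repr v) (repr u).
rewrite -mulN1r -RintegralZl//; congr Complex; apply: eq_Rintegral => x _.
  by case: (L2_fun u x) (L2_fun v x) => ? ? [? ?] /=; ring.
by case: (L2_fun u x) (L2_fun v x) => ? ? [? ?] /=; ring.
Qed.

Lemma L2_dotl v : linear_for *%R (L2_dot ^~ v).
Proof.
move=> a u w; rewrite -[u]reprK -[w]reprK -[v]reprK L2scaleE -L2_piD !L2_dot_pi.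
rewrite -Cintegral_lin; do ?exact: Cintegrable_mul.
congr Cintegral; apply/funext => x.
by rewrite -[LHS]/((a * repr u x + repr w x) * _) mulrDl mulrA.
Qed.

Lemma L2_dot_bilinear : bilinear_for *%R (Num.conj \; *%R) L2_dot.
Proof.
split=> [v|u a v w] /=; first exact: L2_dotl.
rewrite L2_dotC [X in X^*]L2_dotl.
rewrite rmorphD rmorphM (L2_dotC u v) (L2_dotC u w).
by [].
Qed.

HB.instance Definition _ :=
  @bilinear_isBilinear.Build R[i] L2 L2 R[i] _ _ L2_dot L2_dot_bilinear.

Lemma L2_dot_hermitian (u v : L2) : L2_dot u v = (-1) ^+ false * (L2_dot v u)^*.
Proof. by rewrite mul1r -L2_dotC. Qed.

HB.instance Definition _ :=
  isHermitianSesquilinear.Build R[i] L2 false Num.conj L2_dot L2_dot_hermitian.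

Lemma L2_dot_gt0 (u : L2) : u != 0 -> 0 < L2_dot u u.
Proof.
move=> u0; pose f := repr u; pose q x := Re (f x) ^+ 2 + Im (f x) ^+ 2.
have [qi _] : Cintegrable (fun x => f x * (f x)^*) by exact: Cintegrable_mul.
have qE x : Re (f x * (f x)^*) = q x by rewrite /q; case: (f x) => ? ? /=; ring.
have {}qi : mu.-integrable setT (EFin \o q).
  by apply: eq_integrable qi => // x _ /=; rewrite qE.
have q0 x : 0 <= q x by rewrite addr_ge0// sqr_ge0.
have -> : L2_dot u u = (\int[mu]_x q x)%:C%C.
  rewrite /L2_dot /Cintegral; congr Complex.
    by apply: eq_Rintegral => x _; rewrite qE.
  rewrite (@eq_Rintegral _ _ _ mu setT (cst 0)) ?Rintegral_cst ?mul0r// => x _.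
  by case: (L2_fun u x) => ? ? /=; ring.
rewrite ltcR lt_def Rintegral_ge0// andbT; apply: contra u0 => /eqP I0.
have fi : (\int[mu]_x (EFin \o q) x = 0)%E.
  rewrite -[LHS]fineK; first by congr _%:E.
  exact: integrable_fin_num.
have /(ae_eq_integral_abs mu measurableT) H := measurable_int mu qi.
have /H fae : (\int[mu]_x `|(EFin \o q) x| = 0)%E.
  by rewrite -fi; apply: eq_integral => x _ /=; rewrite ger0_norm.
suff fN : f \in sqnull.
  rewrite -[u]reprK; have := L2_pi_eq f 0; rewrite subr0 fN.
  by rewrite (_ : \pi_L2 0 = 0 :> L2)//; apply: (addrI (\pi_L2 0)); rewrite -L2_piD !addr0.
apply: asboolT; apply: filterS fae => x /(_ I) /= [/eqP].
rewrite /q paddr_eq0 ?sqr_ge0// !sqrf_eq0 => /andP[/eqP a /eqP b].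
by case: (f x) a b => ? ? /= -> ->.
Qed.

HB.instance Definition _ := isDotProduct.Build R[i] L2 L2_dot L2_dot_gt0.

End SquareIntegrable.

Definition L2_inner d (T : measurableType d) (R : realType)
    (mu : {measure set T -> \bar R}) : {dot L2 mu for Num.conj} := @L2_dot d T R mu.

(* The sigma-algebra structures of the library require a pointed carrier, which
   is why the type of words depends on the proof that the alphabet is not
   empty.  Words are indexed from 0: [x k] is the letter x_(k+1). *)
Definition word_space (N : nat) (hN : (2 <= N)%N) : Type :=
  prod_topology (fun _ : nat => discrete_topology 'I_N).

HB.instance Definition _ N (hN : (2 <= N)%N) := Topological.on (word_space hN).
HB.instance Definition _ N (hN : (2 <= N)%N) :=
  isPointed.Build (word_space hN) (fun=> Ordinal (ltnW hN)).

Definition words (N : nat) (hN : (2 <= N)%N) : Type :=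
  g_sigma_algebraType (@open (word_space hN)).

HB.instance Definition _ N (hN : (2 <= N)%N) := Measurable.on (words hN).

Section Markov.
Context (R : realType) (N : nat) (hN : (2 <= N)%N).
Implicit Types (x : words hN) (lambda : 'rV[R]_N) (T : nat -> 'M[R]_N).

Definition shift x : words hN := fun k => x k.+1.

Definition cylinder (I : seq 'I_N) : set (words hN) :=
  [set x : words hN | mkseq x (size I) = I].

Definition stochastic (A : 'M[R]_N) : Prop := forall i, \sum_j A i j = 1.

(* [T k] is the matrix T^(k+1). *)
Definition markov_data lambda T : Prop :=
  [/\ forall i, 0 < lambda 0 i,
      \sum_i lambda 0 i = 1,
      forall k, stochastic (T k),
      forall k i j, 0 < T k i j
    & lambda *m T 0%N = lambda].

Definition markov_measure (mu : probability (words hN) R) lambda T : Prop :=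
  markov_data lambda T /\
  forall (i : 'I_N) (I : seq 'I_N),
    mu (cylinder (i :: I)) =
      (lambda 0 i *
       \prod_(k < size I) T k (nth i (i :: I) k) (nth i (i :: I) k.+1))%:E.

Definition matrix_ratio T (k : nat) x : R :=
  T k (x k) (x k.+1) / T k.+1 (x k) (x k.+1).

Definition quasi_stationary T : Prop :=
  forall x, (\sum_(0 <= k <oo) `|matrix_ratio T k x - 1|%:E < +oo)%E.

Definition ratio_product T x : R :=
  limn (fun m => \prod_(0 <= k < m) matrix_ratio T k x).

Definition rep_weight lambda T (j : 'I_N) x : R :=
  (x 0%N == j)%:R *
  Num.sqrt (lambda 0 (x 1%N) / (lambda 0 (x 0%N) * T 0%N (x 0%N) (x 1%N)) *
            ratio_product T (shift x)).

(* For quasi-stationary data the function below is square integrable and its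
   class does not depend on the representative [L2_fun f], because
   |f_j|^2 d(mu) is mapped to mu by the shift. *)
Definition markov_rep (mu : probability (words hN) R) lambda T (j : 'I_N)
    (f : L2 mu) : L2 mu :=
  L2_class mu (fun x => (rep_weight lambda T j x)%:C%C * L2_fun f (shift x)).

Definition Z_infty lambda T lambda' T' x : \bar R :=
  ((lambda' 0 (x 0%N) / lambda 0 (x 0%N))%:E *
   limn_esup (fun m => (\prod_(0 <= k < m)
     (T' k (x k) (x k.+1) / T k (x k) (x k.+1)))%:E))%E.

Definition hellinger_sum T T' x : \bar R :=
  (\sum_(0 <= k <oo)
     (1 - \sum_(j < N) Num.sqrt (T' k (x k) j) * Num.sqrt (T k (x k) j))%:E)%E.

End Markov.

Definition mutually_singular d (X : measurableType d) (R : realType)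
    (mu nu : {measure set X -> \bar R}) : Prop :=
  exists A : set X, [/\ measurable A, mu A = 0 & nu (~` A) = 0].

Definition measure_equivalent d (X : measurableType d) (R : realType)
    (mu nu : {measure set X -> \bar R}) : Prop :=
  mu `<< nu /\ nu `<< mu.

(* Main.v *)
(* The subalgebra generated by the S_I S_I^* acts on L^2(mu) by multiplication by
   indicators of cylinders, so an intertwiner commutes with multiplication by the
   indicator of every Borel set.  This makes equivalent representations have
   equivalent measures, and makes every intertwiner vanish when the measures are
   singular.  Conversely, let h and h' be the densities of mu and mu' with respect
   to mu + mu'.  The weight f_j^2 is the derivative of mu o sigma on the cylinder
   of j, so multiplication by sqrt (h / h') on {h > 0, h' > 0} intertwines the two
   representations; it is unitary if the measures are equivalent, and nonzero
   unless they are singular.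

   Let Z_n be the density of mu' with respect to mu on words of length n + 1.  For
   a Borel set A on which Z_n <= a for infinitely many n, stopping at the first
   such n inside a cylinder set close to A gives mu' A <= a mu A; with the same
   statement for 1 / Z_n this yields the criteria in terms of limsup Z_n, without
   martingale convergence.  Let rho_n be the conditional Hellinger affinities.
   Where sum (1 - rho_n) diverges, sqrt Z_n divided by the product of the rho_k is
   a positive mu-martingale while this product tends to 0, hence liminf Z_n = 0
   mu-almost everywhere.  Where the sum converges, an L^2 estimate for the stopped
   products of sqrt (T / T') shows that Z_n does not tend to infinity
   mu'-almost everywhere. *)
From Pilot Require Import Defs.
From HB Require Import structures.
From mathcomp Require Import all_boot all_order all_algebra.
From mathcomp Require Import all_classical all_reals all_analysis.
From mathcomp Require Import measurable_realfun complex.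
From mathcomp.algebra_tactics Require Import ring lra.

Set Implicit Arguments.
Unset Strict Implicit.
Unset Printing Implicit Defensive.

Import Order.TTheory GRing.Theory Num.Theory.
Import numFieldNormedType.Exports.

Local Open Scope classical_set_scope.
Local Open Scope ring_scope.

(** * Words and cylinder sets *)

(** Both lists of conditions rest on three facts. A mu-null Borel set carries mu'-mass only where
    Z_n tends to infinity; mu' gives no mass to the points with liminf Z_n = 0; exchanging the
    measures turns Z_n into 1 / Z_n and keeps the Hellinger sum. The obstacle is that a Borel set is
    not decided by finitely many letters, so a stopping time cannot be confined to it. It is
    replaced by a set of finitely many letters that is close to it for two measures at once. Square
    roots enter because sqrt (T' / T) has conditional mean rho_k under mu, while sqrt (T / T') has
    conditional mean rho_k and conditional second moment exactly 1 under mu'; with second moment 1,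
    a mean near 1 forces closeness to 1 in L^2. The multiplier sqrt (h / h') intertwines because the
    shift changes h and h' by one common factor: f_j^2 h = (h o sigma) G and f'_j^2 h' = (h' o
    sigma) G, where G is the derivative of (mu + mu') o sigma on the cylinder of j. An operator that
    intertwines the S_i intertwines their adjoints as well, by the Cuntz relations. *)

Section Words.
Context (N : nat) (hN : (2 <= N)%N).
Implicit Types x y z : words hN.

Definition agree n x y := forall k, (k < n)%N -> x k = y k.

Lemma agree_leq m n x y : (m <= n)%N -> agree n x y -> agree m x y.
Proof. by move=> mn xy k km; exact/xy/(leq_trans km). Qed.

Lemma agree_sym n x y : agree n x y -> agree n y x.
Proof. by move=> xy k kn; rewrite xy. Qed.

(** Cylinders form a base of the product topology. If no cylinder around x lay in U, words y n
    outside U agreeing with x on n letters would converge to x. Conversely a cylinder is a finite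
    intersection of coordinate neighbourhoods. *)
Lemma open_agree (U : set (word_space hN)) :
  open U <-> forall x, U x -> exists n, forall y, agree n x y -> U y.
Proof.
split=> [oU x Ux|H].
  apply/not_existsP => H.
  have /choice[y yP] n : exists y, agree n x y /\ ~ U y.
    by have /existsNP[y /not_implyP ?] := H n; exists y.
  have yx : (y : nat -> word_space hN) @ \oo --> (x : word_space hN).
    apply/cvg_sup => i.
    have surj : [set f i | f in [set: word_space hN]] = [set: discrete_topology 'I_N].
      by rewrite eqEsubset; split => z // _; exists (fun=> z).
    apply/(@cvg_image _ (discrete_topology 'I_N)) => //.
    move=> A /nbhs_singleton Ai.
    exists ((fun f : word_space hN => f i) @^-1` A).
      by exists i.+1 => // n /= ni; have [/(_ i ni) <-] := yP n.
    by rewrite image_preimage.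
  have : nbhs (x : word_space hN) U by apply: open_nbhs_nbhs.
  move=> /yx[n _ /(_ n (leqnn n)) /=].
  by have [] := yP n.
rewrite openE => x /H[n Un].
rewrite /interior.
suff : nbhs (x : word_space hN) [set y : words hN | agree n x y].
  by apply: filterS => y /Un.
elim: n {Un} => [|n IH]; first by apply: filterS filterT => y _ k.
have /(_ [set x n]) : (fun f : word_space hN => (f n : discrete_topology 'I_N)) @ x -->
    (x n : discrete_topology 'I_N).
  exact: (@proj_continuous nat (fun=> discrete_topology 'I_N) n).
move/(_ (discrete_set1 _)); apply: filterS2 IH => y xy /= yn k.
by rewrite ltnS leq_eqVlt => /predU1P[->|/xy].
Qed.

Lemma open_measurable_words (U : set (words hN)) : open (U : set (word_space hN)) ->
  measurable U.
Proof. by move=> oU; apply: sub_sigma_algebra. Qed.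

(** Measurability with respect to the first n letters. With [X] equal to [Prop] it applies to sets,
    so sets and functions share one notion. *)
Definition local {X : Type} n (f : words hN -> X) :=
  forall x y, agree n x y -> f x = f y.

Lemma local_leq X m n (f : words hN -> X) : (m <= n)%N -> local m f -> local n f.
Proof. by move=> mn lf x y xy; exact/lf/(agree_leq mn). Qed.

Lemma local_open n (U : set (words hN)) : local n U -> open (U : set (word_space hN)).
Proof. by move=> lU; apply/open_agree => x Ux; exists n => y /lU <-. Qed.

Lemma local_measurable n (U : set (words hN)) : local n U -> measurable U.
Proof. by move=> /local_open/open_measurable_words. Qed.

Lemma local_measurable_fun d (Y : measurableType d) n (f : words hN -> Y) :
  local n f -> measurable_fun setT f.
Proof.
move=> lf _ B _; rewrite setTI; apply: (@local_measurable n) => x y /lf xy.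
by rewrite /preimage /= xy.
Qed.

(** [c] is a modulus of continuity for [s], so preimages of open sets are open, and open sets
    generate the sigma-algebra. *)
Lemma measurable_words_fun (s : words hN -> words hN) (c : nat -> nat) :
  (forall n x y, agree (c n) x y -> agree n (s x) (s y)) ->
  measurable_fun setT s.
Proof.
move=> sc; apply: (@measurability _ _ _ (words hN) setT s (@open (word_space hN))) => //.
move=> _ [U oU <-]; rewrite setTI; apply: open_measurable_words.
apply/open_agree => x /(proj1 (open_agree _) oU)[n Un].
by exists (c n) => y /sc /Un.
Qed.

Lemma measurable_shift : measurable_fun setT (@Defs.shift N hN).
Proof.
by apply: (@measurable_words_fun _ S) => n x y xy k kn; apply: xy.
Qed.

Definition word_cons (j : 'I_N) x : words hN :=
  fun k => if k is l.+1 then x l else j.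

Lemma measurable_word_cons j : measurable_fun setT (word_cons j).
Proof.
apply: (@measurable_words_fun _ id) => n x y xy [|k] //= kn.
by apply: xy; apply: ltnW.
Qed.

Lemma cons_shift x : word_cons (x 0%N) (Defs.shift x) = x.
Proof. by apply/funext => -[]. Qed.

Definition word_of (w : seq 'I_N) : words hN := nth (Ordinal (ltnW hN)) w.

Lemma cylinderP (w : seq 'I_N) x : cylinder w x <-> agree (size w) x (word_of w).
Proof.
split=> [<- k|xw].
  by rewrite size_mkseq => kn; rewrite /word_of nth_mkseq.
apply: (@eq_from_nth _ (Ordinal (ltnW hN))); rewrite size_mkseq // => k kn.
by rewrite nth_mkseq// xw.
Qed.

Lemma local_cylinder (w : seq 'I_N) : local (size w) (cylinder (hN := hN) w).
Proof.
move=> x y xy; apply/propext; rewrite !cylinderP; split=> H k kn.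
  by rewrite -xy// H.
by rewrite xy// H.
Qed.

Lemma measurable_cylinder (w : seq 'I_N) : measurable (cylinder (hN := hN) w).
Proof. exact: local_measurable (@local_cylinder w). Qed.

End Words.

(** * Densities and approximation by cylinder sets *)

Section SumOfFiniteMeasures.
Context d (X : measurableType d) (R : realType).
Context (m1 m2 : {finite_measure set X -> \bar R}).

Let measure_add_fin : fin_num_fun (measure_add m1 m2).
Proof. by move=> A mA; rewrite measure_addE fin_numD !fin_num_measure. Qed.

HB.instance Definition _ := Measure.on (measure_add m1 m2).
HB.instance Definition _ :=
  Measure_isFinite.Build _ _ _ (measure_add m1 m2) measure_add_fin.

End SumOfFiniteMeasures.
Section Density.
Context d (X : measurableType d) (R : realType) (mu : {finite_measure set X -> \bar R}).
Context (f : X -> R) (f0 : forall x, 0 <= f x) (mf : measurable_fun setT f)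
  (fi : (\int[mu]_x (f x)%:E < +oo)%E).

(* The hypotheses are arguments so that the instances below can be inferred. *)
Definition density of (forall x, 0 <= f x) & measurable_fun setT f &
    (\int[mu]_x (f x)%:E < +oo)%E : set X -> \bar R :=
  fun A => (\int[mu]_(x in A) (f x)%:E)%E.

Local Notation nu := (density f0 mf fi).

Let nu0 : nu set0 = 0%E. Proof. exact: integral_set0. Qed.

Let nu_ge0 A : (0 <= nu A)%E.
Proof. by apply: integral_ge0 => x _; rewrite lee_fin. Qed.

Let mfE : measurable_fun setT (fun x => (f x)%:E).
Proof. exact/measurable_EFinP. Qed.

Let nu_sigma_additive : semi_sigma_additive nu.
Proof.
move=> F mF tF mUF; rewrite /density ge0_integral_bigcup//; last 2 first.
  by apply: measurable_funTS.
  by move=> x _; rewrite lee_fin.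
apply: is_cvg_ereal_nneg_natsum => n _.
by apply: integral_ge0 => x _; rewrite lee_fin.
Qed.

HB.instance Definition _ := isMeasure.Build _ _ _ nu nu0 nu_ge0 nu_sigma_additive.

Let nu_fin : fin_num_fun nu.
Proof.
apply: lty_fin_num_fun; rewrite /density.
exact: fi.
Qed.

HB.instance Definition _ := Measure_isFinite.Build _ _ _ nu nu_fin.

Lemma density_dominates : nu `<< mu.
Proof.
apply/null_content_dominatesP => A mA mA0.
by apply: null_set_integral => //; exact: measurable_funTS.
Qed.

(** Change of variables holds for the Radon-Nikodym derivative [RN], and f equals [RN] almost
    everywhere because both have the same integral over every measurable set. *)
Lemma ge0_integral_density (g : X -> \bar R) : (forall x, 0 <= g x)%E ->
  measurable_fun setT g -> (\int[nu]_x g x = \int[mu]_x (g x * (f x)%:E))%E.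
Proof.
move=> g0 mg; set RN := Radon_Nikodym_SigmaFinite.f nu mu.
have RNi : mu.-integrable setT RN.
  by apply: Radon_Nikodym_SigmaFinite.f_integrable; exact: density_dominates.
have mRN : measurable_fun setT RN by exact: measurable_int RNi.
rewrite -(Radon_Nikodym_SigmaFinite.change_of_variables density_dominates)//.
apply: ae_eq_integral => //; do ?exact: emeasurable_funM.
apply: ae_eqe_mul2l; apply: integral_ae_eq => //.
move=> A _ mA; rewrite -Radon_Nikodym_SigmaFinite.f_integral//.
exact: density_dominates.
Qed.

End Density.

(** * Approximation of Borel sets by sets depending on finitely many letters *)

Section Approximation.
Context (R : realType) (N : nat) (hN : (2 <= N)%N).
Context (mu : {finite_measure set (words hN) -> \bar R}).

Definition symdiff {X : Type} (A B : set X) := (A `\` B) `|` (B `\` A).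

Definition approximable (A : set (words hN)) := measurable A /\
  forall e : R, 0 < e -> exists n (B : set (words hN)),
    local n B /\ (mu (symdiff A B) < e%:E)%E.

Lemma measurable_symdiff (A B : set (words hN)) :
  measurable A -> measurable B -> measurable (symdiff A B).
Proof. by move=> mA mB; apply: measurableU; apply: measurableD. Qed.

(** Continuity from above, for a finite measure, makes the part of the union outside some [F n]
    smaller than e / 2; the other half of e goes to approximating that [F n]. *)
Lemma approximable_bigcup (F : (set (words hN))^nat) :
  nondecreasing_seq F -> (forall n, approximable (F n)) ->
  approximable (\bigcup_n F n).
Proof.
move=> ndF aF.
have mF n : measurable (F n) by have [] := aF n.
have mU : measurable (\bigcup_n F n) by apply: bigcupT_measurable.
split => // e e0.
have e20 : 0 < e / 2 by rewrite divr_gt0.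
have [n nE] : exists n, (mu (\bigcup_n F n `\` F n) < (e / 2)%:E)%E.
  have : (mu \o (fun n => \bigcup_n F n `\` F n)) @ \oo --> mu (\bigcap_n (\bigcup_n F n `\` F n)).
    apply: nonincreasing_cvg_mu => [|n||m n mn].
    - by rewrite ltey_eq fin_num_measure//; exact: measurableD.
    - exact: measurableD.
    - by apply: bigcapT_measurable => n; exact: measurableD.
    - by apply/subsetPset; apply: setDS; apply/subsetPset; exact: ndF.
  rewrite (_ : \bigcap_n _ = set0) ?measure0; last first.
    by apply/seteqP; split => // x H; have [[k _ Fx] _] := H 0%N I; have [] := H k I.
  move=> /fine_cvgP[_ /cvgr_lt/(_ _ e20)[n _ /(_ n (leqnn n)) /=]] nE.
  exists n; rewrite -lte_fin fineK// in nE.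
  by rewrite fin_num_measure//; exact: measurableD.
have [_ /(_ _ e20)[k [B [lB BE]]]] := aF n.
exists k, B; split => //.
have mB := local_measurable lB.
have sub : symdiff (\bigcup_n F n) B `<=` (\bigcup_n F n `\` F n) `|` symdiff (F n) B.
  move=> x [[Ux nBx]|[Bx nUx]].
    have [Fx|nFx] := pselect (F n x); first by right; left.
    by left.
  by right; right; split => // Fx; apply: nUx; exists n.
apply: (@le_lt_trans _ _ (mu ((\bigcup_n F n `\` F n) `|` symdiff (F n) B))).
  apply: le_measure => //; rewrite ?inE; first exact: measurable_symdiff.
  by apply: measurableU; [exact: measurableD|exact: measurable_symdiff].
apply: le_lt_trans; first by apply: measureU2; [exact: measurableD|exact: measurable_symdiff].
by rewrite [e]splitr EFinD lteD.
Qed.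

Lemma approximable_setU A B : approximable A -> approximable B ->
  approximable (A `|` B).
Proof.
move=> [mA aA] [mB aB]; split; first exact: measurableU.
move=> e e0; have e20 : 0 < e / 2 by rewrite divr_gt0.
have [n [A' [lA' A'E]]] := aA _ e20; have [m [B' [lB' B'E]]] := aB _ e20.
have mA' := local_measurable lA'; have mB' := local_measurable lB'.
exists (maxn n m), (A' `|` B'); split.
  move=> x y xy; rewrite /setU /=.
  rewrite (lA' x y (agree_leq (leq_maxl _ _) xy)).
  by rewrite (lB' x y (agree_leq (leq_maxr _ _) xy)).
apply: (@le_lt_trans _ _ (mu (symdiff A A' `|` symdiff B B'))).
  apply: le_measure; rewrite ?inE.
  - by apply: measurable_symdiff; exact: measurableU.
  - by apply: measurableU; exact: measurable_symdiff.
  - move=> x [[[Ax|Bx] /not_orP[nA nB]]|[[Ax|Bx] /not_orP[nA nB]]];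
    by [left; left|right; left|left; right|right; right].
apply: le_lt_trans; first by apply: measureU2; exact: measurable_symdiff.
by rewrite [e]splitr EFinD lteD.
Qed.

(** The approximable sets form a sigma-algebra. It contains every open U, the increasing union over
    n of the sets of words whose cylinder of length n lies in U. *)
Lemma measurable_approximable (A : set (words hN)) : measurable A -> approximable A.
Proof.
apply: smallest_sub => [|U oU].
  split.
  - split => // e e0; exists 0%N, set0; split; first by [].
    by rewrite /symdiff setDv setU0 measure0 lte_fin.
  - move=> B [mB aB]; split; first exact: measurableD.
    move=> e /aB[n [C [lC CE]]]; exists n, (~` C); split.
      by move=> x y xy; rewrite /setC /= (lC _ _ xy).
    suff -> : symdiff ([set: words hN] `\` B) (~` C) = symdiff B C by [].
    rewrite /symdiff setTD; apply/seteqP; split => x /=.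
      by move=> [[? /contrapT]|[? /contrapT]]; [right|left].
    by move=> [[? ?]|[? ?]]; [right|left]; split => //; apply.
  - move=> F aF.
    rewrite -bigcup_bigsetU_bigcup.
    apply: approximable_bigcup.
      by move=> m n mn; apply/subsetPset; exact: subset_bigsetU.
    elim=> [|n IH].
      rewrite big_ord1; exact: aF.
    rewrite big_ord_recr; apply: approximable_setU => //; exact: aF.
rewrite (_ : U = \bigcup_n [set x | forall y, agree n x y -> U y]).
  apply: approximable_bigcup => [m n mn|n].
    apply/subsetPset => x Ux y xy; apply: Ux; exact: agree_leq mn xy.
  have lU : local n [set x : words hN | forall y, agree n x y -> U y].
    move=> x y xy; apply/propext; split => H z; [move=> yz|move=> xz]; apply: H => k kn.
      by rewrite xy// yz.
    by rewrite -xy// xz.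
  split; first exact: local_measurable lU.
  move=> e e0; exists n; eexists; split; first exact: lU.
  by rewrite /symdiff setDv setU0 measure0 lte_fin.
apply/seteqP; split => x.
  by move=> /(proj1 (open_agree _) oU)[n Un]; exists n.
by move=> [n _]; apply.
Qed.

End Approximation.

(** * Integrals against Markov measures *)

Section TupleSums.
Context (V : nmodType) (I : finType).

Lemma sum_tuple_rcons n (F : seq I -> V) :
  \sum_(t : n.+1.-tuple I) F t = \sum_(t : n.-tuple I) \sum_j F (rcons t j).
Proof.
pose h (p : n.-tuple I * I) : n.+1.-tuple I := [tuple of rcons p.1 p.2].
have h_bij : bijective h.
  apply: inj_card_bij.
    by move=> [t i] [u j] /(congr1 val) /= /rcons_inj[/val_inj -> ->].
  by rewrite card_prod !card_tuple expnSr.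
rewrite (reindex h) /=; last exact: onW_bij.
by rewrite pair_bigA.
Qed.

Lemma sum_tuple_cons n (F : seq I -> V) :
  \sum_(t : n.+1.-tuple I) F t = \sum_j \sum_(t : n.-tuple I) F (j :: t).
Proof.
pose h (p : I * n.-tuple I) : n.+1.-tuple I := [tuple of p.1 :: p.2].
have h_bij : bijective h.
  apply: inj_card_bij.
    by move=> [i t] [j u] /(congr1 val) /= [-> /val_inj ->].
  by rewrite card_prod !card_tuple expnS.
rewrite (reindex h) /=; last exact: onW_bij.
by rewrite pair_bigA.
Qed.

End TupleSums.

Section MarkovIntegral.
Context (R : realType) (N : nat) (hN : (2 <= N)%N).
Context (lambda : 'rV[R]_N) (T : nat -> 'M[R]_N) (mu : probability (words hN) R).
Hypothesis hmu : markov_measure mu lambda T.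
Implicit Types (x y : words hN) (f : words hN -> R).

(** The measure of the cylinder of the first n + 1 letters of x; n counts transitions, which is why
    locality comes with [n.+1] below. *)
Definition path_weight n x : R :=
  lambda 0 (x 0%N) * \prod_(0 <= k < n) T k (x k) (x k.+1).

Lemma local_prod n m (F : nat -> words hN -> R) :
  (forall k, (k < m)%N -> local n (F k)) ->
  forall l, local n (fun x => \prod_(l <= k < m) F k x).
Proof.
move=> lF l x y xy; apply: eq_big_nat => k /andP[_ km]; exact: lF.
Qed.

Lemma local_letter n k (F : 'I_N -> 'I_N -> R) : (k.+1 < n)%N ->
  local n (fun x : words hN => F (x k) (x k.+1)).
Proof. by move=> kn x y xy; rewrite !xy// ltnW. Qed.

Lemma local_path_weight n : local n.+1 (path_weight n).
Proof.
move=> x y xy; rewrite /path_weight xy//; congr (_ * _).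
apply: (@local_prod n.+1 n (fun k x => T k (x k) (x k.+1))) => // k kn.
exact: (@local_letter _ _ (T k)).
Qed.

Lemma path_weight_gt0 n x : 0 < path_weight n x.
Proof.
have [[l0 _ _ T0 _] _] := hmu.
by rewrite mulr_gt0// prodr_gt0.
Qed.

Lemma markov_cylinder n (w : n.+1.-tuple 'I_N) :
  mu (cylinder w) = (path_weight n (word_of hN w))%:E.
Proof.
case: w => -[//|i I] /= /eqP[<-].
rewrite (proj2 hmu) /path_weight big_mkord; congr (_ * _)%:E.
apply: eq_bigr => k _; rewrite /word_of !(set_nth_default (Ordinal (ltnW hN)))//=.
  exact: ltn_ord.
exact: leqW (ltn_ord k).
Qed.

(** f is a simple function, constant on each cylinder of length n + 1; the padded word
    [word_of hN w] serves as sample point. *)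
Lemma integral_local n f : local n.+1 f -> (forall x, 0 <= f x) ->
  (\int[mu]_x (f x)%:E =
   (\sum_(w : n.+1.-tuple 'I_N)
      path_weight n (word_of hN w) * f (word_of hN w))%:E)%E.
Proof.
move=> lf f0.
transitivity (\int[mu]_x \sum_(w : n.+1.-tuple 'I_N)
    (f (word_of hN w) * \1_(cylinder (hN := hN) w) x)%:E)%E.
  apply: eq_integral => x _; rewrite sumEFin; congr _%:E.
  pose w := [tuple of mkseq x n.+1].
  have wx : cylinder w x by rewrite /cylinder/mkset size_tuple.
  rewrite (bigD1 w)//= indicE mem_set// mulr1 big1 ?addr0.
    by apply/lf; have := proj1 (cylinderP _ _) wx; rewrite size_tuple.
  move=> v vw.
  rewrite indicE memNset ?mulr0// /cylinder/mkset size_tuple => xv.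
  by move/eqP: vw; apply; apply: val_inj; rewrite /= -xv.
rewrite ge0_integral_sum//; last 2 first.
- move=> w; apply/measurable_EFinP; apply: measurable_funM => //.
  by apply: measurable_indic; exact: measurable_cylinder.
- by move=> w x _; rewrite lee_fin mulr_ge0.
rewrite -sumEFin; apply: eq_bigr => w _.
under eq_integral do rewrite EFinM.
rewrite ge0_integralZl_EFin//; last first.
  by apply/measurable_EFinP; apply: measurable_indic; exact: measurable_cylinder.
transitivity ((f (word_of hN w))%:E * mu (cylinder w))%E.
  by rewrite integral_indic ?setIT//; exact: measurable_cylinder.
by rewrite markov_cylinder -EFinM mulrC.
Qed.

Definition set_letter n x (j : 'I_N) : words hN :=
  fun k => if k == n then j else x k.

(** The Markov property: the sum on the right is the conditional expectation of f given the first n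
    + 1 letters. *)
Lemma integral_markov n f : local n.+2 f -> (forall x, 0 <= f x) ->
  (\int[mu]_x (f x)%:E =
   \int[mu]_x (\sum_j T n (x n) j * f (set_letter n.+1 x j))%:E)%E.
Proof.
move=> lf f0.
have [[l0 _ _ T0 _] _] := hmu.
rewrite (integral_local lf)// (@integral_local n); last 2 first.
- move=> x y xy; apply: eq_bigr => j _; rewrite xy//; congr (_ * _).
  apply: lf => k; rewrite /set_letter; case: eqP => // kn.
  by rewrite ltnS leq_eqVlt => /predU1P[//|]; exact: xy.
- by move=> x; apply: sumr_ge0 => j _; rewrite mulr_ge0// ltW.
congr _%:E.
rewrite (sum_tuple_rcons _ (fun w => path_weight n.+1 (word_of hN w) * f (word_of hN w))).
apply: eq_bigr => w _; rewrite mulr_sumr; apply: eq_bigr => j _.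
have agr : agree n.+1 (word_of hN (rcons w j)) (word_of hN w).
  by move=> k kn; rewrite /word_of nth_rcons size_tuple kn.
have last_j : word_of hN (rcons w j) n.+1 = j.
  by rewrite /word_of nth_rcons size_tuple ltnn eqxx.
rewrite mulrA; congr (_ * _).
  rewrite -(local_path_weight agr) /path_weight big_nat_recr// mulrA.
  by congr (_ * _); rewrite last_j agr.
apply: lf => k; rewrite ltnS leq_eqVlt /set_letter => /predU1P[->|kn].
  by rewrite eqxx.
by rewrite ltn_eqF// agr.
Qed.

End MarkovIntegral.

(** * Likelihood ratios *)

Section Comparison.
Context (R : realType) (N : nat) (hN : (2 <= N)%N).
Context (lambda lambda' : 'rV[R]_N) (T T' : nat -> 'M[R]_N).
Context (mu mu' : probability (words hN) R).
Hypotheses (hmu : markov_measure mu lambda T) (hmu' : markov_measure mu' lambda' T').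
Implicit Types (x y : words hN) (f : words hN -> R) (A B : set (words hN)).

Definition step_ratio k x : R := T' k (x k) (x k.+1) / T k (x k) (x k.+1).

(** The Z_n of the overview. *)
Definition likelihood n x : R :=
  lambda' 0 (x 0%N) / lambda 0 (x 0%N) * \prod_(0 <= k < n) step_ratio k x.

Lemma step_ratio_gt0 k x : 0 < step_ratio k x.
Proof.
by have [[_ _ _ T0 _] _] := hmu; have [[_ _ _ T0' _] _] := hmu'; rewrite divr_gt0.
Qed.

Lemma likelihood_gt0 n x : 0 < likelihood n x.
Proof.
have [[l0 _ _ _ _] _] := hmu; have [[l0' _ _ _ _] _] := hmu'.
rewrite mulr_gt0 ?divr_gt0// prodr_gt0// => k _; exact: step_ratio_gt0.
Qed.

Lemma local_step_ratio n k : (k.+1 < n)%N -> local n (step_ratio k).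
Proof. move=> kn; exact: (@local_letter _ _ _ _ _ (fun i j => T' k i j / T k i j)). Qed.

Lemma local_likelihood n : local n.+1 (likelihood n).
Proof.
move=> x y xy; rewrite /likelihood xy//; congr (_ * _).
by apply: (@local_prod _ _ _ n.+1 n step_ratio) => // k kn; exact: local_step_ratio.
Qed.

Lemma likelihood_path_weight n x :
  likelihood n x * path_weight lambda T n x = path_weight lambda' T' n x.
Proof.
have [[l0 _ _ T0 _] _] := hmu.
rewrite /likelihood /path_weight mulrACA divfK ?gt_eqF//; congr (_ * _).
rewrite -big_split /=; apply: eq_bigr => k _.
by rewrite divfK ?gt_eqF.
Qed.

Lemma integral_likelihood n f : local n.+1 f -> (forall x, 0 <= f x) ->
  (\int[mu']_x (f x)%:E = \int[mu]_x (likelihood n x * f x)%:E)%E.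
Proof.
move=> lf f0; rewrite (integral_local hmu' lf)//.
rewrite (@integral_local _ _ _ _ _ _ hmu n (fun x => likelihood n x * f x)).
- congr _%:E; apply: eq_bigr => w _.
  by rewrite mulrCA mulrA likelihood_path_weight.
- by move=> x y xy; rewrite (lf _ _ xy) (local_likelihood xy).
- by move=> x; rewrite mulr_ge0// ltW// likelihood_gt0.
Qed.

Lemma le_likelihood_local n B (a : R) : local n.+1 B ->
  (forall x, B x -> likelihood n x <= a) -> (mu' B <= a%:E * mu B)%E.
Proof.
move=> lB Ba.
have mB := local_measurable lB.
have m1B : measurable_fun setT (fun x => (\1_B x)%:E : \bar R).
  by apply/measurable_EFinP; exact: measurable_indic.
(* A point of B forces [a] to be nonnegative, since the likelihood ratio is positive; hence the
   separate case of the empty set. *)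
have [->|/set0P[x0 /Ba ax0]] := eqVneq B set0; first by rewrite !measure0 mule0.
have a0 : 0 <= a by apply: le_trans ax0; apply/ltW/likelihood_gt0.
have l1B : local n.+1 (\1_B : _ -> R).
  move=> x y /lB xy; rewrite !indicE.
  by have -> : (x \in B) = (y \in B) by exact: (congr1 asbool xy).
have := integral_likelihood l1B (fun x => ler0n _ (x \in B)).
have -> : (\int[mu']_x (\1_B x)%:E = mu' B)%E by rewrite integral_indic// setIT.
move=> ->.
have -> : (a%:E * mu B = \int[mu]_x (a * \1_B x)%:E)%E.
  under eq_integral do rewrite EFinM.
  by rewrite ge0_integralZl_EFin// integral_indic// setIT.
apply: ge0_le_integral => //.
- by move=> x _; rewrite lee_fin mulr_ge0// ltW// likelihood_gt0.
- apply/measurable_EFinP; apply: (@local_measurable_fun _ _ _ _ n.+1) => x y xy.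
  by rewrite (l1B _ _ xy) (local_likelihood xy).
- apply/measurable_EFinP; apply: (@local_measurable_fun _ _ _ _ n.+1) => x y xy.
  by rewrite (l1B _ _ xy).
- move=> x _; rewrite lee_fin indicE; case: (boolP (x \in B)) => [|_].
    by rewrite inE !mulr1 => /Ba.
  by rewrite !mulr0.
Qed.

(* A measurable set is replaced by a set [B] depending on finitely many letters;
   inside [B] one stops at the first time the likelihood ratio is at most [a]. *)
Lemma le_likelihood_io A (a : R) : measurable A -> 0 <= a ->
  (forall x, A x -> forall m, exists2 n, (m <= n)%N & likelihood n x <= a) ->
  (mu' A <= a%:E * mu A)%E.
Proof.
move=> mA a0 Aa; apply/lee_addgt0Pr => e e0.
have a10 : 0 < 1 + a by rewrite ltr_pwDl.
(* Approximation for the sum gives one B close to A for both measures. The error enters once through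
   mu' and [a] times through mu, hence the tolerance e / (1 + a). *)
pose kappa : {finite_measure set (words hN) -> \bar R} := measure_add mu mu'.
have [_ /(_ (e / (1 + a)))] := measurable_approximable kappa mA.
rewrite divr_gt0// => /(_ isT)[m [B [lB]]].
have mB := local_measurable lB.
rewrite [kappa _]measure_addE.
set e' := e / (1 + a) => muE.
(* n is the first time from m on with likelihood ratio at most [a]. Since B depends on m letters,
   waiting until m makes [G n] depend on n + 1 letters only. *)
pose G n := [set x | [/\ B x, (m <= n)%N, likelihood n x <= a
  & forall k, (m <= k < n)%N -> a < likelihood k x]].
have lG n : local n.+1 (G n).
  have [mn|mn] := leqP m n; last first.
    by move=> x y _; apply/propext; split=> -[_]; rewrite leqNgt mn.
  have H x y : agree n.+1 x y -> G n x -> G n y.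
    move=> xy [Bx _ lx kx]; split => //.
    - by rewrite -(lB x)//; apply: agree_leq xy; apply: leqW.
    - by rewrite -(local_likelihood xy).
    - move=> k /andP[mk kn]; rewrite -(@local_likelihood k x y) ?kx ?mk//.
      by apply: agree_leq xy; apply: ltnW.
  by move=> x y xy; apply/propext; split; apply: H => //; exact: agree_sym.
have mG n : measurable (G n) by exact: local_measurable (lG n).
have tG : trivIset setT G.
  apply/trivIsetP => i j _ _ ij; apply/seteqP; split => // x [[_ mi li ki] [_ mj lj kj]].
  have [ltij|ltji|/eqP] := ltngtP i j; last by rewrite (negbTE ij).
    by have := kj i; rewrite mi ltij ltNge li => /(_ isT).
  by have := ki j; rewrite mj ltji ltNge lj => /(_ isT).
have ABG : A `&` B `<=` \bigcup_n G n.
  move=> x [Ax Bx].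
  have ex : exists n, (m <= n)%N && (likelihood n x <= a).
    by have [n mn ln] := Aa x Ax m; exists n; rewrite mn.
  case: (ex_minnP ex) => n /andP[mn ln] nmin; exists n => //; split => //.
  move=> k /andP[mk kn]; rewrite ltNge; apply/negP => lk.
  by have := nmin k; rewrite mk lk leqNgt kn => /(_ isT).
have GB : \bigcup_n G n `<=` B by move=> x [n _ []].
have mUG : measurable (\bigcup_n G n) by exact: bigcupT_measurable.
have UG : (mu' (\bigcup_n G n) <= a%:E * mu (\bigcup_n G n))%E.
  rewrite !measure_semi_bigcup// -nneseriesZl//.
  by apply: lee_nneseries => // n _; apply: le_likelihood_local => // x [].
have mS := measurable_symdiff mA mB.
have muS : (mu (symdiff A B) < e'%:E)%E by apply: le_lt_trans muE; exact: leeDl.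
have muS' : (mu' (symdiff A B) < e'%:E)%E by apply: le_lt_trans muE; exact: leeDr.
have A1 : (mu' A <= mu' (\bigcup_n G n) + e'%:E)%E.
  apply: (@le_trans _ _ (mu' (\bigcup_n G n `|` symdiff A B))).
    apply: le_measure; rewrite ?inE//; first exact: measurableU.
    move=> x Ax; have [Bx|nBx] := pselect (B x); [left|by right; left].
    exact: ABG.
  by apply: le_trans; first (apply: measureU2 => //); exact/leeD2l/ltW.
have B1 : (mu (\bigcup_n G n) <= mu A + e'%:E)%E.
  apply: (@le_trans _ _ (mu (A `|` symdiff A B))).
    apply: le_measure; rewrite ?inE//; first exact: measurableU.
    move=> x /GB Bx; have [Ax|nAx] := pselect (A x); [by left|by right; right].
  by apply: le_trans; first (apply: measureU2 => //); exact/leeD2l/ltW.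
apply: (le_trans A1); apply: (@le_trans _ _ (a%:E * (mu A + e'%:E) + e'%:E)%E).
  by rewrite leeD2r//; apply: (le_trans UG); rewrite lee_wpmul2l ?lee_fin.
rewrite muleDr//; last by rewrite fin_num_adde_defl.
rewrite -addeA leeD2l// -EFinM -EFinD lee_fin /e'.
by rewrite -{2}[e / _]mul1r -mulrDl [a + 1]addrC mulrC divfK// gt_eqF.
Qed.

(** A is cut into countably many pieces on which an integer j works as the bound; on each, mu' is at
    most j times mu, which is 0. *)
Lemma null_likelihood_bounded A : measurable A -> mu A = 0%E ->
  (forall x, A x -> exists a : R, forall m, exists2 n, (m <= n)%N & likelihood n x <= a) ->
  mu' A = 0%E.
Proof.
move=> mA A0 H.
pose F j := A `&` [set x | forall m, exists2 n, (m <= n)%N & likelihood n x <= j%:R].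
have mF j : measurable (F j).
  apply: measurableI => //.
  rewrite (_ : [set _ | _] = \bigcap_m \bigcup_(n in [set n | (m <= n)%N])
      [set x | likelihood n x <= j%:R]).
    apply: bigcapT_measurable => m; apply: bigcup_measurable => n _.
    apply: (@local_measurable _ _ n.+1) => x y xy.
    by apply/propext; rewrite /= (local_likelihood xy).
  apply/seteqP; split => x Hx m; first by move=> _; have [n mn ln] := Hx m; exists n.
  by have [n mn ln] := Hx m I; exists n.
apply: measure_negligible => //.
suff : mu'.-negligible (\bigcup_j F j).
  apply: negligibleS.
  move=> x Ax; have [a ax] := H x Ax.
  exists (Num.bound `|a|) => //; split => // m; have [n mn na] := ax m.
  exists n => //; apply: (le_trans na).
  by apply/ltW/(le_lt_trans (ler_norm _)); exact: archi_boundP.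
apply: negligible_bigcup => j; exists (F j); split => //.
apply/eqP; rewrite -measure_le0.
apply: (@le_trans _ _ (j%:R%:E * mu (F j))%E).
  by apply: le_likelihood_io => // x [].
suff -> : mu (F j) = 0%E by rewrite mule0.
apply/eqP; rewrite -measure_le0 -A0; apply: le_measure; rewrite ?inE//.
exact: subIsetl.
Qed.

(** [le_likelihood_io] with an arbitrary e > 0 gives mu' A at most e times mu A, and mu A is at most
    1. *)
Lemma null_likelihood_cvg0 A : measurable A ->
  (forall x, A x -> forall a : R, 0 < a ->
    forall m, exists2 n, (m <= n)%N & likelihood n x <= a) ->
  mu' A = 0%E.
Proof.
move=> mA H; apply/eqP; rewrite -measure_le0; apply/lee_addgt0Pr => e e0.
rewrite add0e; apply: (@le_trans _ _ (e%:E * mu A)%E).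
  by apply: le_likelihood_io => //; [exact: ltW|move=> x Ax; exact: H].
rewrite -[leRHS]mule1; apply: lee_wpmul2l; first by rewrite lee_fin ltW.
exact: probability_le1.
Qed.

End Comparison.

(** * Hellinger sums *)

Section NullSets.
Context d (X : measurableType d) (R : realType) (mu : {finite_measure set X -> \bar R}).
Implicit Types (A : set X) (E : (set X)^nat).

Definition eventually_in E := \bigcup_m \bigcap_(n in [set n | (m <= n)%N]) E n.

Lemma measurable_eventually_in E : (forall n, measurable (E n)) ->
  measurable (eventually_in E).
Proof.
move=> mE; apply: bigcupT_measurable => m.
by apply: bigcap_measurable => //; exists m => /=.
Qed.

(** Fatou's lemma for sets: the tail intersections increase to the lower limit, and each is
    contained in one of the [E n]. *)
Lemma eventually_in_le E c : (forall n, measurable (E n)) ->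
  (forall n, (mu (E n) <= c)%E) -> (mu (eventually_in E) <= c)%E.
Proof.
move=> mE Ec.
pose F m := \bigcap_(n in [set n | (m <= n)%N]) E n.
have mF m : measurable (F m) by apply: bigcap_measurable => //; exists m => /=.
have ndF : nondecreasing_seq F.
  by move=> m n mn; apply/subsetPset => x Fx k /= nk; apply: Fx; apply: leq_trans nk.
have cv : (mu \o F) @ \oo --> mu (eventually_in E).
  exact: nondecreasing_cvg_mu mF (measurable_eventually_in mE) ndF.
apply: (cvge_to_le cv); apply: nearW => m /=; apply: le_trans (Ec m).
by apply: le_measure; rewrite ?inE// => x /(_ m); apply => /=.
Qed.

Lemma negligible_small A :
  (forall e : R, 0 < e -> exists B, [/\ measurable B, A `<=` B & (mu B <= e%:E)%E]) ->
  mu.-negligible A.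
Proof.
move=> H.
have /choice[B HB] n : exists B, [/\ measurable B, A `<=` B & (mu B <= n.+1%:R^-1%:E)%E].
  by apply: H; rewrite invr_gt0.
exists (\bigcap_n B n); split.
- by apply: bigcapT_measurable => n; have [] := HB n.
- apply/eqP; rewrite -measure_le0; apply/lee_addgt0Pr => e e0; rewrite add0e.
  pose n := Num.truncn e^-1.
  have [mB _ Bn] := HB n.
  apply: (@le_trans _ _ (mu (B n))).
    apply: le_measure; rewrite ?inE//; last by move=> x; apply.
    by apply: bigcapT_measurable => k; have [] := HB k.
  apply: (le_trans Bn); rewrite lee_fin invf_ple ?posrE//.
  by apply/ltW/truncnS_gt.
- by move=> x Ax n _; have [_ AB _] := HB n; apply: AB.
Qed.

(** Markov's inequality. *)
Lemma le_measure_level (f : X -> R) (K c : R) : measurable_fun setT f ->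
  (forall x, 0 <= f x) -> 0 < K -> (\int[mu]_x (f x)%:E <= c%:E)%E ->
  (mu [set x | K <= f x]%R <= (c / K)%:E)%E.
Proof.
move=> mf f0 K0 fc.
rewrite EFinM muleC -lee_pdivrMl// ?invr_gt0// invrK.
apply: le_trans fc.
have := @le_integral_comp_abse _ _ _ mu setT measurableT (EFin \o f) K id.
rewrite setTI /= => H; apply: le_trans (le_trans (H _ _ _ _ _) _) => //.
- rewrite (_ : [set x | _] = [set x | (K%:E <= `|(f x)%:E|)%E])//.
  by apply/seteqP; split => x /=; rewrite lee_fin ger0_norm.
- exact/measurable_EFinP.
- by under eq_integral do rewrite ger0_norm//.
Qed.

End NullSets.

(** * Products of numbers in [0, 1] compared with the sums of their defects *)

Section RealProducts.
Context (R : realType).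
Implicit Types (r : nat -> R).

Lemma prod_ge_1Bsum r m n : (forall k, 0 <= r k <= 1) ->
  1 - \sum_(m <= k < n) (1 - r k) <= \prod_(m <= k < n) r k.
Proof.
move=> r01; elim: n => [|n IH]; first by rewrite !big_geq// subr0.
have [mn|nm] := leqP m n; last by rewrite !big_geq// subr0.
rewrite !big_nat_recr//=.
have /andP[rn0 rn1] := r01 n.
have P1 : \prod_(m <= k < n) r k <= 1 by rewrite prodr_ile1.
have P0 : 0 <= \prod_(m <= k < n) r k.
  by rewrite prodr_ge0// => k _; case/andP: (r01 k).
nra.
Qed.

(** Forces the product to 0 when the sum of the defects diverges. With s the previous sum, the
    induction step is r (1 + s + 1 - r) = r (2 - r) + r s, which is at most 1 + s. *)
Lemma prod_le_invD1sum r n : (forall k, 0 <= r k <= 1) ->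
  \prod_(0 <= k < n) r k <= (1 + \sum_(0 <= k < n) (1 - r k))^-1.
Proof.
move=> r01.
have s0 m : 0 <= \sum_(0 <= k < m) (1 - r k).
  by apply: sumr_ge0 => k _; rewrite subr_ge0; case/andP: (r01 k).
have P0 m : 0 <= \prod_(0 <= k < m) r k.
  by rewrite prodr_ge0// => k _; case/andP: (r01 k).
rewrite -div1r ler_pdivlMr ?ltr_pwDl//.
elim: n => [|n IH]; first by rewrite !big_geq// mul1r addr0.
rewrite !big_nat_recr//=.
have /andP[rn0 rn1] := r01 n.
have := s0 n; have := P0 n.
set P := \prod_(_ <= _ < _) _ in IH *; set s := \sum_(_ <= _ < _) _ in IH *.
move=> P0n s0n.
apply: le_trans IH.
have : r n * (1 + (s + (1 - r n))) <= 1 + s by nra.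
move=> /(ler_wpM2l P0n); by rewrite mulrA.
Qed.

Lemma prod_antitone r l m n : (forall k, 0 <= r k <= 1) -> (m <= n)%N ->
  \prod_(l <= k < n) r k <= \prod_(l <= k < m) r k.
Proof.
move=> r01 mn.
have P0 i j : 0 <= \prod_(i <= k < j) r k.
  by rewrite prodr_ge0// => k _; case/andP: (r01 k).
have [lm|ml] := leqP l m.
  by rewrite (@big_cat_nat _ _ _ m l n)//= ler_piMr// prodr_ile1.
by rewrite [leRHS]big_geq ?prodr_ile1// ltnW.
Qed.

End RealProducts.

Section Hellinger.
Context (R : realType) (N : nat) (hN : (2 <= N)%N).
Context (lambda lambda' : 'rV[R]_N) (T T' : nat -> 'M[R]_N).
Context (mu mu' : probability (words hN) R).
Hypotheses (hmu : markov_measure mu lambda T) (hmu' : markov_measure mu' lambda' T').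
Implicit Types (x y : words hN) (f : words hN -> R).

Definition affinity k x : R :=
  \sum_(j < N) Num.sqrt (T' k (x k) j) * Num.sqrt (T k (x k) j).

Lemma affinity_gt0 k x : 0 < affinity k x.
Proof.
have [[_ _ _ T0 _] _] := hmu; have [[_ _ _ T0' _] _] := hmu'.
rewrite /affinity (bigD1 (x k))//= ltr_pwDl ?mulr_gt0 ?sqrtr_gt0//.
by apply: sumr_ge0 => j _; rewrite mulr_ge0.
Qed.

(** The inequality of arithmetic and geometric means in each term, both rows having sum 1. *)
Lemma affinity_le1 k x : affinity k x <= 1.
Proof.
have [[_ _ S T0 _] _] := hmu; have [[_ _ S' T0' _] _] := hmu'.
rewrite /affinity.
apply: (@le_trans _ _ (\sum_(j < N) (T' k (x k) j + T k (x k) j) / 2)).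
  apply: ler_sum => j _.
  have := sqr_sqrtr (ltW (T0 k (x k) j)); have := sqr_sqrtr (ltW (T0' k (x k) j)).
  set a := Num.sqrt _; set b := Num.sqrt _ => <- <-.
  have := sqr_ge0 (a - b); nra.
by rewrite -mulr_suml big_split/= S S'; lra.
Qed.

Lemma local_affinity n k : (k < n)%N -> local n (affinity k).
Proof. by move=> kn x y xy; rewrite /affinity xy. Qed.

End Hellinger.

Section ProductMartingale.
Context (R : realType) (N : nat) (hN : (2 <= N)%N).
Context (lambda : 'rV[R]_N) (T : nat -> 'M[R]_N).
Context (mu : probability (words hN) R).
Hypotheses (hmu : markov_measure mu lambda T).
Implicit Types (x y : words hN) (f : words hN -> R).
Context (phi : nat -> words hN -> R).
Hypotheses (lphi : forall k, local k.+2 (phi k)) (phi0 : forall k x, 0 <= phi k x)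
  (phi1 : forall k x, \sum_j T k (x k) j * phi k (set_letter k.+1 x j) = 1).

(** By [phi1] the last factor has conditional mean 1 given the earlier letters, so [integral_markov]
    removes the factors one at a time from the end. *)
Lemma integral_product_martingale f m n : (m <= n)%N -> local m.+1 f ->
  (forall x, 0 <= f x) ->
  (\int[mu]_x (f x * \prod_(m <= k < n) phi k x)%:E = \int[mu]_x (f x)%:E)%E.
Proof.
move=> mn lf f0; elim: n mn => [|n IH].
  rewrite leqn0 => /eqP ->; apply: eq_integral => x _.
  by rewrite big_geq// mulr1.
rewrite leq_eqVlt => /predU1P[->|mn].
  by apply: eq_integral => x _; rewrite big_geq// mulr1.
have lp i j : (j <= i)%N -> local i.+1 (fun x => \prod_(m <= k < j) phi k x).
  move=> ji; apply: local_prod => k kj.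
  apply: local_leq (@lphi k). exact: leq_trans kj ji.
rewrite (@integral_markov _ _ _ _ _ _ hmu n
   (fun x => f x * \prod_(m <= k < n.+1) phi k x)).
- rewrite -IH//; apply: eq_integral => x _; congr _%:E.
  have agr j : agree n.+1 (set_letter n.+1 x j) x.
    by move=> k kn; rewrite /set_letter ltn_eqF.
  transitivity (\sum_j (f x * \prod_(m <= k < n) phi k x) *
      (T n (x n) j * phi n (set_letter n.+1 x j))).
    apply: eq_bigr => j _; rewrite big_nat_recr//=.
    rewrite (lf _ _ (agree_leq mn (agr j))).
    by rewrite (lp _ _ (leqnn n) _ _ (agr j)); ring.
  by rewrite -mulr_sumr phi1 mulr1.
- move=> x y xy; congr (_ * _).
    by apply: lf; apply: agree_leq xy; rewrite ltnW.
  exact: lp xy.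
- by move=> x; rewrite mulr_ge0// prodr_ge0.
Qed.

End ProductMartingale.

Section NonnegativeSeries.
Context (R : realType) (u : nat -> R).
Hypothesis u0 : forall k, 0 <= u k.

Local Notation S := (\sum_(0 <= k <oo) (u k)%:E)%E.

Lemma nneseries_partial_gt (a : R) : (a%:E < S)%E ->
  exists n, a < \sum_(0 <= k < n) u k.
Proof.
move=> aS; apply/not_existsP => H; move: aS; apply/negP; rewrite -leNgt.
apply: lime_le; first by apply: is_cvg_nneseries => n _ _; rewrite lee_fin.
by apply: nearW => n; rewrite sumEFin lee_fin leNgt; apply/negP/H.
Qed.

Lemma nneseries_partial_le n : ((\sum_(0 <= k < n) u k)%:E <= S)%E.
Proof.
by rewrite -sumEFin; apply: nneseries_lim_ge => k _ _; rewrite lee_fin.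
Qed.

Lemma nneseries_pinfty_partial (a : R) : (S = +oo)%E ->
  exists n0, forall n, (n0 <= n)%N -> a <= \sum_(0 <= k < n) u k.
Proof.
move=> Soo; have [|n0 an0] := @nneseries_partial_gt a; first by rewrite Soo ltry.
exists n0 => n n0n; apply/ltW/(lt_le_trans an0).
by rewrite (@big_cat_nat _ _ _ n0 0%N n)//= lerDl sumr_ge0.
Qed.

Lemma nneseries_tail_small (e : R) : (S < +oo)%E -> 0 < e ->
  exists m0, forall m n, (m0 <= m)%N -> \sum_(m <= k < n) u k <= e.
Proof.
move=> Sfin e0.
have S0 : (0 <= S)%E by apply: nneseries_ge0 => k _ _; rewrite lee_fin.
have Sf : S \is a fin_num by rewrite ge0_fin_numE.
have [|m0 H] := @nneseries_partial_gt (fine S - e).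
  by rewrite -[X in (_ < X)%E]fineK// lte_fin ltrBlDr ltrDl.
exists m0 => m n m0m; have [nm|mn] := leqP n m; first by rewrite big_geq// ltW.
have := nneseries_partial_le n; rewrite -[X in (_ <= X)%E]fineK// lee_fin.
rewrite (@big_cat_nat _ _ _ m0 0%N n)//=; last by rewrite (leq_trans m0m)// ltnW.
rewrite (@big_cat_nat _ _ _ m m0 n)//=; last by rewrite ltnW.
have : 0 <= \sum_(m0 <= k < m) u k by rewrite sumr_ge0.
lra.
Qed.

End NonnegativeSeries.

(** * Behaviour of the likelihood ratio according to the Hellinger sum *)

Section HellingerCriterion.
Context (R : realType) (N : nat) (hN : (2 <= N)%N).
Context (lambda lambda' : 'rV[R]_N) (T T' : nat -> 'M[R]_N).
Context (mu mu' : probability (words hN) R).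
Hypotheses (hmu : markov_measure mu lambda T) (hmu' : markov_measure mu' lambda' T').
Implicit Types (x y : words hN) (f : words hN -> R).

Local Notation L := (likelihood (hN := hN) lambda lambda' T T').
Local Notation ratio := (step_ratio (hN := hN) T T').
Local Notation rho := (affinity (hN := hN) T T').

Let rho01 x k : 0 <= rho k x <= 1.
Proof. by rewrite (affinity_le1 hmu hmu') ltW// (affinity_gt0 hmu hmu'). Qed.

Let ratio_gt0 k x : 0 < ratio k x.
Proof. exact: (step_ratio_gt0 hmu hmu'). Qed.

Let hsum0 x k : 0 <= 1 - rho k x.
Proof. by rewrite subr_ge0; case/andP: (rho01 x k). Qed.

Lemma affinity_set_letter k x j : rho k (set_letter k.+1 x j) = rho k x.
Proof. by rewrite /affinity /set_letter ltn_eqF. Qed.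

Lemma step_ratio_set_letter k x j :
  ratio k (set_letter k.+1 x j) = T' k (x k) j / T k (x k) j.
Proof. by rewrite /step_ratio /set_letter eqxx ltn_eqF. Qed.

(* [M n], the square root of the likelihood ratio divided by the product of the
   affinities, is a positive [mu]-martingale, so it does not tend to infinity;
   where the sum diverges the product of the affinities tends to 0. *)
Lemma negligible_hellinger_pinfty :
  mu.-negligible [set x | hellinger_sum T T' x = +oo%E /\
    ~ forall a : R, 0 < a -> forall m, exists2 n, (m <= n)%N & L n x <= a].
Proof.
have [[l0 _ _ T0 _] _] := hmu; have [[l0' _ _ T0' _] _] := hmu'.
pose f x := Num.sqrt (lambda' 0 (x 0%N) / lambda 0 (x 0%N)).
pose phi k x := Num.sqrt (ratio k x) / rho k x.
pose M n x := f x * \prod_(0 <= k < n) phi k x.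
have lf : local 1 f by move=> x y xy; rewrite /f xy.
have f0 x : 0 <= f x by rewrite sqrtr_ge0.
have lphi k : local k.+2 (phi k).
  have lr : local k.+2 (ratio k) by apply: local_step_ratio.
  have la : local k.+2 (rho k) by apply: local_affinity.
  by move=> x y xy; rewrite /phi (lr _ _ xy) (la _ _ xy).
have phi0 k x : 0 <= phi k x by rewrite divr_ge0//; case/andP: (rho01 x k).
(* T times sqrt (T' / T) is sqrt T' times sqrt T, and these terms add up to the affinity in the
   denominator. *)
have phi1 k x : \sum_j T k (x k) j * phi k (set_letter k.+1 x j) = 1.
  rewrite -[RHS](@divff _ (rho k x)) ?gt_eqF ?(affinity_gt0 hmu hmu')//.
  rewrite [X in _ = X / _]/affinity mulr_suml; apply: eq_bigr => j _.
  rewrite /phi affinity_set_letter step_ratio_set_letter mulrA; congr (_ / _).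
  rewrite sqrtrM ?ltW// sqrtrV ?ltW//.
  rewrite -[X in X * (_ / _)](sqr_sqrtr (ltW (T0 k (x k) j))).
  by field; rewrite gt_eqF// sqrtr_gt0.
have [c c0 cE] : exists2 c : R, 0 <= c & (\int[mu]_x (f x)%:E = c%:E)%E.
  eexists; last exact: (integral_local hmu lf).
  by apply: sumr_ge0 => w _; rewrite mulr_ge0// ltW// (path_weight_gt0 hmu).
have M0 n x : 0 <= M n x by rewrite mulr_ge0// prodr_ge0.
have mM n : measurable_fun setT (M n).
  apply: (@local_measurable_fun _ _ _ _ n.+1) => x y xy; congr (_ * _).
    by apply: lf; apply: agree_leq xy.
  apply: (@local_prod _ _ _ n.+1 n phi) xy => k kn.
  exact: local_leq (@lphi k).
have MK n (K : R) : 0 < K -> (mu [set x | K <= M n x]%R <= (c / K)%:E)%E.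
  move=> K0; apply: le_measure_level => //.
  by rewrite (integral_product_martingale hmu lphi phi0 phi1 (leq0n n) lf f0) cE.
have ME n x : M n x * \prod_(0 <= k < n) rho k x = Num.sqrt (L n x).
  rewrite /M -mulrA -big_split/= /likelihood sqrtrM ?divr_ge0 ?ltW//.
  congr (_ * _); elim: n => [|n IH]; first by rewrite !big_geq// sqrtr1.
  rewrite !big_nat_recr//= IH [in RHS]mulrC sqrtrM ?ltW// [in RHS]mulrC.
  by rewrite /phi divfK// gt_eqF// (affinity_gt0 hmu hmu').
apply: negligible_small => e e0.
(* With this level Markov's inequality gives c / K at most e; the added 1 keeps K positive when c =
   0. *)
pose K := (c + 1) / e; have K0 : 0 < K by rewrite divr_gt0// ltr_pwDr.
have mE n : measurable [set x | K <= M n x].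
  rewrite (_ : [set _ | _] = setT `&` M n @^-1` `[K, +oo[%classic).
    exact: mM.
  by apply/seteqP; split => x /=; rewrite in_itv /= andbT; [|case].
exists (eventually_in (fun n => [set x | K <= M n x])); split.
- exact: measurable_eventually_in.
- move=> x [hx /existsNP[a /not_implyP[a0 /existsNP[m Hm]]]].
  have sa0 : 0 < Num.sqrt a by rewrite sqrtr_gt0.
  (* Beyond [n0] the product of the affinities is at most sqrt a / K, while [L n x] exceeds [a]
     beyond m; their quotient [M n x] is then at least K. *)
  have [n0 Hn0] := nneseries_pinfty_partial (hsum0 x) (K / Num.sqrt a) hx.
  exists (maxn m n0) => // n /=; rewrite geq_max => /andP[mn n0n].
  have aL : a < L n x by rewrite ltNge; apply/negP => La; apply: Hm; exists n.
  have P0 : 0 < \prod_(0 <= k < n) rho k x.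
    by apply: prodr_gt0 => k _; exact: (affinity_gt0 hmu hmu').
  rewrite -(ler_pM2r P0) ME; apply: (@le_trans _ _ (Num.sqrt a)); last first.
    by rewrite ler_wsqrtr// ltW.
  rewrite mulrC -ler_pdivlMr//; apply: (le_trans (prod_le_invD1sum _ (rho01 x))).
  have KS : 0 < K / Num.sqrt a by apply: divr_gt0.
  have S0 : 0 < 1 + \sum_(0 <= k < n) (1 - rho k x).
    by rewrite ltr_pwDl//; apply: sumr_ge0 => k _; exact: hsum0.
  rewrite -invf_div lef_pV2 ?posrE//.
  by apply: (le_trans (Hn0 n n0n)); rewrite lerDr.
- apply: eventually_in_le => // n; apply: (le_trans (MK n _ K0)).
  by rewrite lee_fin ler_pdivrMr// /K mulrC divfK ?gt_eqF// lerDl.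
Qed.

(* With [m] large, the product [D m n] of the [sqrt (T / T')] over [m <= k < n],
   stopped before the affinities multiply to less than [1 - eps], has second
   moment [1] and mean at least [1 - eps] under [mu'], so it is close to [1]. *)
Lemma negligible_hellinger_fin :
  mu'.-negligible [set x | (hellinger_sum T T' x < +oo)%E /\
    ~ exists a : R, forall m, exists2 n, (m <= n)%N & L n x <= a].
Proof.
have [[l0 _ S1 T0 _] _] := hmu; have [[l0' _ S1' T0' _] _] := hmu'.
apply: negligible_small => e e0.
(* e / 8 makes the final Markov bound (2 eps) / (1 / 4) at most e, and 1 / 2 keeps 1 - eps
   nonnegative. *)
pose eps : R := Num.min (e / 8) (1 / 2).
have eps0 : 0 < eps by rewrite lt_min !divr_gt0.
have eps2 : eps <= 1 / 2 by rewrite ge_min lexx orbT.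
have epse : eps <= e / 8 by rewrite ge_min lexx.
(* The stopping rule is predictable: the affinity at k depends on letter k only, so whether to use
   the factor k is decided before letter k + 1 is seen. This lets [phi2] and [phi3] treat [a m k] as
   a constant in the sum over j. *)
pose a m k x := 1 - eps <= \prod_(m <= l < k.+1) rho l x.
pose al m k x := if a m k x then Num.sqrt (ratio k x)^-1 else 1.
pose rh m k x := if a m k x then rho k x else 1.
pose D m n x := \prod_(m <= k < n) al m k x.
have la m k : local k.+1 (a m k).
  move=> x y xy; rewrite /a; congr (_ <= _).
  apply: (@local_prod _ _ _ k.+1 k.+1 rho) xy => l lk; exact: local_affinity.
have lal m k : local k.+2 (al m k).
  have lr : local k.+2 (ratio k) by apply: local_step_ratio.
  by move=> x y xy; rewrite /al (lr _ _ xy) (la _ _ x y) //; apply: agree_leq xy.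
have lrh m k : local k.+2 (rh m k).
  have lr : local k.+2 (rho k) by apply: local_affinity.
  by move=> x y xy; rewrite /rh (lr _ _ xy) (la _ _ x y) //; apply: agree_leq xy.
have al0 m k x : 0 <= al m k x by rewrite /al; case: ifP.
have rh0 m k x : 0 < rh m k x.
  by rewrite /rh; case: ifP => // _; exact: (affinity_gt0 hmu hmu').
have aset m k x j : a m k (set_letter k.+1 x j) = a m k x.
  by apply: la => i ik; rewrite /set_letter ltn_eqF.
have phi2 m k x :
    \sum_j T' k (x k) j * (al m k (set_letter k.+1 x j)) ^+ 2 = 1.
  case am: (a m k x); under eq_bigr do rewrite /al aset am; last first.
    by rewrite -mulr_suml S1' expr1n mulr1.
  rewrite -[RHS](S1 k (x k)); apply: eq_bigr => j _.
  rewrite sqr_sqrtr ?invr_ge0 ?ltW// step_ratio_set_letter invf_div.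
  by rewrite mulrC divfK// gt_eqF.
have phi3 m k x : \sum_j T' k (x k) j *
    (al m k (set_letter k.+1 x j) / rh m k (set_letter k.+1 x j)) = 1.
  case am: (a m k x);
    under eq_bigr do rewrite /al /rh aset affinity_set_letter am; last first.
    by under eq_bigr do rewrite divr1 mulr1; rewrite S1'.
  rewrite -[RHS](@divff _ (rho k x)) ?gt_eqF ?(affinity_gt0 hmu hmu')//.
  rewrite [X in _ = X / _]/affinity mulr_suml; apply: eq_bigr => j _.
  rewrite step_ratio_set_letter mulrA; congr (_ / _).
  rewrite invf_div sqrtrM ?ltW// sqrtrV ?ltW//.
  rewrite -[X in X * (_ / _)](sqr_sqrtr (ltW (T0' k (x k) j))).
  by field; rewrite gt_eqF// sqrtr_gt0.
have D0 m n x : 0 <= D m n x by apply: prodr_ge0.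
have prh m n x : 1 - eps <= \prod_(m <= k < n) rh m k x.
  have eps1 : 1 - eps <= 1 by rewrite gerBl ltW.
  elim: n => [|n IH]; first by rewrite big_geq.
  have [mn|nm] := leqP m n; last by rewrite big_geq.
  (* If [a m n] holds, so do all earlier [a m k], because the products of affinities decrease; the
     product of the [rh] is then the product of the affinities itself. *)
  rewrite big_nat_recr//= {2}/rh; case: ifP => an; last by rewrite mulr1.
  apply: (le_trans an); rewrite big_nat_recr//=.
  rewrite le_eqVlt; apply/orP; left; apply/eqP; congr (_ * _).
  apply: eq_big_nat => k /andP[mk kn]; rewrite /rh ifT//.
  by apply: (le_trans an); apply: prod_antitone => //; rewrite ltnS ltnW.
have lD m n : local n.+1 (D m n).
  by apply: (@local_prod _ _ _ n.+1 n (al m)) => k kn; exact: local_leq (@lal m k).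
have mD m n : measurable_fun setT (D m n) by exact: local_measurable_fun (@lD m n).
have mN m n : measurable_fun setT
    (fun x => \prod_(m <= k < n) (al m k x / rh m k x)).
  apply: (@local_measurable_fun _ _ _ _ n.+1).
  apply: (@local_prod _ _ _ n.+1 n (fun k x => al m k x / rh m k x)) => k kn.
  apply: (@local_leq _ _ _ k.+2) => // x y xy.
  by rewrite (lal _ _ _ _ xy) (lrh _ _ _ _ xy).
have N0 m n x : 0 <= \prod_(m <= k < n) (al m k x / rh m k x).
  by rewrite prodr_ge0// => k _; rewrite divr_ge0// ltW.
have int1 : (\int[mu']_x (1 : R)%:E = 1)%E.
  by rewrite integral_cst// mul1e; exact: probability_setT.
have intD2 m n : (m <= n)%N -> (\int[mu']_x (D m n x ^+ 2)%:E = 1)%E.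
  move=> mn.
  rewrite -[RHS]int1 -(@integral_product_martingale _ _ _ _ _ _ hmu'
    (fun k x => al m k x ^+ 2) _ _ _ (cst 1) m n)//.
  - by apply: eq_integral => x _; rewrite mul1r prodrXl.
  - by move=> k x y xy; rewrite (lal _ _ _ _ xy).
  - by move=> k x; rewrite sqr_ge0.
have intN m n : (m <= n)%N ->
    (\int[mu']_x (\prod_(m <= k < n) (al m k x / rh m k x))%:E = 1)%E.
  move=> mn.
  rewrite -[RHS]int1 -(@integral_product_martingale _ _ _ _ _ _ hmu'
    (fun k x => al m k x / rh m k x) _ _ _ (cst 1) m n)//.
  - by apply: eq_integral => x _; rewrite mul1r.
  - by move=> k x y xy; rewrite (lal _ _ _ _ xy) (lrh _ _ _ _ xy).
  - by move=> k x; rewrite divr_ge0// ltW.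
have intD m n : (m <= n)%N -> ((2 * (1 - eps))%:E <= \int[mu']_x (2 * D m n x)%:E)%E.
  move=> mn.
  have -> : ((2 * (1 - eps))%:E = \int[mu']_x
      (2 * (1 - eps) * \prod_(m <= k < n) (al m k x / rh m k x))%:E)%E.
    under eq_integral do rewrite EFinM.
    rewrite ge0_integralZl_EFin// ?intN ?mule1//.
    - by move=> x _; rewrite lee_fin.
    - exact/measurable_EFinP.
    - by rewrite mulr_ge0// subr_ge0; lra.
  apply: ge0_le_integral => //.
  - by move=> x _; rewrite lee_fin mulr_ge0// mulr_ge0// subr_ge0; lra.
  - by apply/measurable_EFinP/measurable_funM.
  - by apply/measurable_EFinP/measurable_funM.
  - move=> x _; rewrite lee_fin -mulrA ler_pM2l// mulrC.
    have -> : D m n x = \prod_(m <= k < n) (al m k x / rh m k x) *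
        \prod_(m <= k < n) rh m k x.
      by rewrite -big_split; apply: eq_bigr => k _ /=; rewrite divfK// gt_eqF.
    by rewrite ler_wpM2l.
(* The identity (1 - D)^2 + 2 D = 1 + D^2 is integrated in this form, with nonnegative terms only,
   so that additivity of the integral applies directly. *)
have int_near m n : (m <= n)%N ->
    (\int[mu']_x ((1 - D m n x) ^+ 2)%:E <= (2 * eps)%:E)%E.
  move=> mn.
  have : (\int[mu']_x ((1 - D m n x) ^+ 2)%:E + \int[mu']_x (2 * D m n x)%:E =
      2%:E)%E.
    rewrite -ge0_integralD//; last 4 first.
    - by move=> x _; rewrite lee_fin sqr_ge0.
    - by apply/measurable_EFinP/measurable_funX/measurable_funB.
    - by move=> x _; rewrite lee_fin mulr_ge0.
    - by apply/measurable_EFinP/measurable_funM.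
    transitivity (\int[mu']_x ((1 : R)%:E + (D m n x ^+ 2)%:E))%E.
      by apply: eq_integral => x _; rewrite -!EFinD; congr _%:E; ring.
    rewrite ge0_integralD//; last 2 first.
    - by move=> x _; rewrite lee_fin sqr_ge0.
    - by apply/measurable_EFinP/measurable_funX.
    by rewrite int1 intD2// -EFinD.
  move=> E2.
  rewrite (_ : 2 * eps = 2 - 2 * (1 - eps)); last by ring.
  rewrite EFinB leeBrDr// -E2 leeD2l//; exact: intD.
(* Without stopping, the square of [D m n x] is [L m x / L n x]. If L tends to infinity this falls
   below 1 / 4, so D < 1 / 2 and x lies in [E m n] for all large n. *)
pose E m n := [set x | (m <= n)%N /\ 1 / 4 <= (1 - D m n x) ^+ 2].
have mE m n : measurable (E m n).
  by apply: (@local_measurable _ _ n.+1) => x y xy; rewrite /E /= (lD _ _ _ _ xy).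
have Ele m n : (mu' (E m n) <= e%:E)%E.
  have [mn|nm] := leqP m n; last first.
    rewrite (_ : E m n = set0) ?measure0 ?lee_fin ?ltW//.
    by apply/seteqP; split => // x []; rewrite leqNgt nm.
  rewrite (_ : E m n = [set x | 1 / 4 <= (1 - D m n x) ^+ 2]); last first.
    by apply/seteqP; split => // x [].
  apply: (@le_trans _ _ (2 * eps / (1 / 4))%:E); last by rewrite lee_fin; lra.
  apply: le_measure_level => //.
  - by apply/measurable_funX/measurable_funB.
  - by move=> x; rewrite sqr_ge0.
  - exact: int_near.
exists (eventually_in (fun m => eventually_in (E m))); split.
- by apply: measurable_eventually_in => m; exact: measurable_eventually_in.
- move=> x [hx Hx].
  have [m0 Hm0] := nneseries_tail_small (hsum0 x) hx eps0.
  exists m0 => // m m0m.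
  have am k : a m k x.
    rewrite /a; apply: le_trans (prod_ge_1Bsum _ _ (rho01 x)).
    by rewrite lerD2l lerN2 Hm0.
  (* [Hx] says that L tends to infinity along x; it is used at the level [4 * L m x]. *)
  have [m1 Hm1] : exists m1, forall n, (m1 <= n)%N -> 4 * L m x < L n x.
    apply/not_existsP => H; apply: Hx; exists (4 * L m x) => k.
    have /existsNP[n /not_implyP[kn /negP]] := H k.
    by rewrite -leNgt; exists n.
  exists (maxn m m1) => // n /=; rewrite geq_max => /andP[mn m1n]; split => //.
  have DL : D m n x ^+ 2 * L n x = L m x.
    have alr : \prod_(m <= k < n) al m k x ^+ 2 * \prod_(m <= k < n) ratio k x = 1.
      rewrite -big_split/= big1// => k _.
      by rewrite /al am sqr_sqrtr ?invr_ge0 ?ltW// mulVf// gt_eqF.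
    rewrite /D -prodrXl /likelihood (@big_cat_nat _ _ _ m 0%N n)//=.
    by rewrite mulrCA [X in _ * X]mulrCA alr mulr1.
  have := Hm1 n m1n; have := likelihood_gt0 hmu hmu' m x.
  have := D0 m n x; rewrite -DL; set d := D m n x; set l := L n x => d0 lm dl.
  have l_gt0 : 0 < l by exact: (likelihood_gt0 hmu hmu').
  have d4 : d ^+ 2 < 1 / 4 by nra.
  have : d < 1 / 2 by nra.
  nra.
- apply: eventually_in_le => m; first exact: measurable_eventually_in.
  by apply: eventually_in_le => n; [exact: mE|exact: Ele].
Qed.

End HellingerCriterion.

(** * Criteria for equivalence and singularity *)

Section LimitSuperior.
Context (R : realType) (u : nat -> R).

Local Notation l := (limn_esup (fun n => (u n)%:E)).

Lemma limn_esup_lt (b : R) : (l < b%:E)%E ->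
  exists m, forall n, (m <= n)%N -> u n <= b.
Proof.
rewrite limn_esup_lim => lb.
have [m Hm] : exists m, (esups (fun n => (u n)%:E) m < b%:E)%E.
  apply/not_existsP => H; move: lb; apply/negP; rewrite -leNgt.
  apply: lime_ge; first exact: is_cvg_esups.
  by apply: nearW => n; rewrite leNgt; apply/negP.
exists m => n mn; rewrite -lee_fin; apply: le_trans (ltW Hm).
by apply: ereal_sup_ubound; exists n.
Qed.

Lemma lt_limn_esup (a : R) : (a%:E < l)%E ->
  forall m, exists2 n, (m <= n)%N & a <= u n.
Proof.
move=> al m; apply: contrapT => H; move: al; apply/negP; rewrite -leNgt.
rewrite limn_esup_lim.
apply: (@le_trans _ _ (esups (fun n => (u n)%:E) m)).
  apply: lime_le; first exact: is_cvg_esups.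
  by exists m => // n /= mn; exact: nonincreasing_esups.
apply: ge_ereal_sup => _ [n /= mn <-]; rewrite lee_fin leNgt; apply/negP => aun.
by apply: H; exists n => //; exact: ltW.
Qed.

End LimitSuperior.

Section LikelihoodLimit.
Context (R : realType) (N : nat) (hN : (2 <= N)%N).
Context (lambda lambda' : 'rV[R]_N) (T T' : nat -> 'M[R]_N).
Context (mu mu' : probability (words hN) R).
Hypotheses (hmu : markov_measure mu lambda T) (hmu' : markov_measure mu' lambda' T').
Implicit Types (x y : words hN).

Local Notation L := (likelihood (hN := hN) lambda lambda' T T').
Local Notation Z := (Z_infty (hN := hN) lambda T lambda' T').
Local Notation hsum := (hellinger_sum (hN := hN) T T').

Let ratio0 x := lambda' 0 (x 0%N) / lambda 0 (x 0%N).
Let lik x n := \prod_(0 <= k < n) step_ratio T T' k x.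

Let ratio0_gt0 x : 0 < ratio0 x.
Proof.
by have [[l0 _ _ _ _] _] := hmu; have [[l0' _ _ _ _] _] := hmu'; rewrite divr_gt0.
Qed.

Let ZE x : Z x = ((ratio0 x)%:E * limn_esup (fun n => (lik x n)%:E))%E.
Proof. by []. Qed.

Let limsup_ge0 x : (0 <= limn_esup (fun n => (lik x n)%:E))%E.
Proof.
rewrite limn_esup_lim; apply: lime_ge; first exact: is_cvg_esups.
apply: nearW => n; apply: le_ereal_sup_tmp.
exists (lik x n)%:E; first by exists n => /=.
by rewrite lee_fin prodr_ge0// => k _; rewrite ltW// (step_ratio_gt0 hmu hmu').
Qed.

Lemma Z_infty_ge0 x : (0 <= Z x)%E.
Proof. by rewrite ZE mule_ge0// lee_fin ltW. Qed.

Lemma Z_infty_lty x : (Z x < +oo)%E ->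
  exists a : R, forall m, exists2 n, (m <= n)%N & L n x <= a.
Proof.
rewrite ZE; have := limsup_ge0 x.
case E : (limn_esup _) => [b||]//; last first.
  by rewrite mulry gtr0_sg// mul1e.
move=> _ _; have [|m Hm] := @limn_esup_lt _ (lik x) (b + 1).
  by rewrite E lte_fin ltrDl.
exists (ratio0 x * (b + 1)) => k; exists (maxn m k); first exact: leq_maxr.
by apply: ler_wpM2l; [exact: ltW (ratio0_gt0 x)|exact/Hm/leq_maxl].
Qed.

Lemma Z_infty_gt0 x : (0 < Z x)%E ->
  exists2 a : R, 0 < a & forall m, exists2 n, (m <= n)%N & a <= L n x.
Proof.
rewrite ZE => Z0.
have l0 : (0 < limn_esup (fun n => (lik x n)%:E))%E.
  rewrite lt_neqAle limsup_ge0 andbT; apply/eqP => l0.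
  by move: Z0; rewrite -l0 mule0 ltxx.
have [a a0 al] : exists2 a : R, 0 < a & (a%:E < limn_esup (fun n => (lik x n)%:E))%E.
  move: l0; case: (limn_esup _) => [b| |]//.
    rewrite lte_fin => b0; exists (b / 2); rewrite ?divr_gt0// lte_fin; lra.
  by move=> _; exists 1; rewrite ?ltry.
exists (ratio0 x * a); first exact: mulr_gt0.
move=> m; have [n mn an] := lt_limn_esup al m; exists n => //.
apply: ler_wpM2l => //; exact: ltW (ratio0_gt0 x).
Qed.

Lemma Z_infty_pinfty x : Z x = +oo%E ->
  forall (a : R) m, exists2 n, (m <= n)%N & a <= L n x.
Proof.
rewrite ZE => Zoo a m.
have al : ((a / ratio0 x)%:E < limn_esup (fun n => (lik x n)%:E))%E.
  move: Zoo; case: (limn_esup _) => [b| |]//; first by rewrite ltry.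
  by rewrite mulrNy gtr0_sg// mul1e.
have [n mn an] := lt_limn_esup al m; exists n => //.
by rewrite /likelihood -/(ratio0 x) mulrC -ler_pdivrMr.
Qed.

Lemma Z_infty_eq0 x : Z x = 0%E ->
  forall a : R, 0 < a -> forall m, exists2 n, (m <= n)%N & L n x <= a.
Proof.
rewrite ZE => Z0 a a0 k.
have [|m Hm] := @limn_esup_lt _ (lik x) (a / ratio0 x).
  suff -> : limn_esup (fun n => (lik x n)%:E) = 0%E by rewrite lte_fin divr_gt0.
  by apply/eqP; move/eqP: Z0; rewrite mule_eq0 eqe gt_eqF.
exists (maxn m k); first exact: leq_maxr.
by rewrite /likelihood -/(ratio0 x) mulrC -ler_pdivlMr//; apply/Hm/leq_maxl.
Qed.

Lemma measurable_Z_infty : measurable_fun setT Z.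
Proof.
apply: emeasurable_funM.
  apply/measurable_EFinP; apply: (@local_measurable_fun _ _ _ _ 1) => x y xy.
  by rewrite xy.
apply: measurable_fun_limn_esup => n; apply/measurable_EFinP.
apply: (@local_measurable_fun _ _ _ _ n.+1) => x y xy.
apply: (@local_prod _ _ _ n.+1 n (step_ratio T T')) xy => k kn.
exact: local_step_ratio.
Qed.

Lemma measurable_hellinger_sum : measurable_fun setT hsum.
Proof.
apply: ge0_emeasurable_sum => [k x _ _|k _].
  by rewrite lee_fin subr_ge0; exact: (affinity_le1 hmu hmu').
apply/measurable_EFinP; apply: (@local_measurable_fun _ _ _ _ k.+1) => x y xy.
by rewrite xy.
Qed.

(** With [hellinger_sumC], this allows the criteria to be reused with the two measures exchanged. *)
Lemma likelihood_inv n x : likelihood lambda' lambda T' T n x = (L n x)^-1.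
Proof.
rewrite /likelihood invfM invf_div; congr (_ * _).
by rewrite -prodfV; apply: eq_bigr => k _; rewrite invf_div.
Qed.

Lemma hellinger_sumC x : hellinger_sum T' T x = hsum x.
Proof.
rewrite /hellinger_sum; apply: eq_eseriesr => k _.
by congr (1 - _)%:E; apply: eq_bigr => j _; rewrite mulrC.
Qed.

End LikelihoodLimit.

Section MeasurableLevelSets.
Context d (X : measurableType d) (R : realType) (f : X -> \bar R).
Hypothesis mf : measurable_fun setT f.

Lemma measurable_level_eq (c : \bar R) : measurable [set x | f x = c].
Proof.
rewrite (_ : [set _ | _] = setT `&` f @^-1` [set c]); last by rewrite setTI.
by apply: mf => //; exact: emeasurable_set1.
Qed.

Lemma measurable_level_lt (c : \bar R) : measurable [set x | (f x < c)%E].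
Proof. by rewrite -[X in measurable X]setTI; exact: emeasurable_fun_infty_o. Qed.

Lemma measurable_level_gt (c : \bar R) : measurable [set x | (c < f x)%E].
Proof. by rewrite -[X in measurable X]setTI; exact: emeasurable_fun_o_infty. Qed.

End MeasurableLevelSets.

Section ProbabilityOne.
Context d (X : measurableType d) (R : realType) (P : probability X R).

Lemma probability_eq1 (A : set X) : measurable A ->
  P A = 1%E <-> P.-negligible (~` A).
Proof.
move=> mA; rewrite (negligibleP _ (measurableC mA)).
have E : (P A + P (~` A) = 1)%E.
  rewrite -measureU//; last by rewrite setICr.
    by rewrite setUv; exact: probability_setT.
  exact: measurableC.
split=> PA.
  have := E; rewrite PA => /eqP; rewrite addeC eq_sym -sube_eq// ?subee//.
    by move/eqP.
  by rewrite fin_num_adde_defl.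
by rewrite -E PA adde0.
Qed.

End ProbabilityOne.

Section NullSetComparison.
Context (R : realType) (N : nat) (hN : (2 <= N)%N).
Context (lambda lambda' : 'rV[R]_N) (T T' : nat -> 'M[R]_N).
Context (mu mu' : probability (words hN) R).
Hypotheses (hmu : markov_measure mu lambda T) (hmu' : markov_measure mu' lambda' T').
Implicit Types (x y : words hN) (A : set (words hN)).

Local Notation L := (likelihood (hN := hN) lambda lambda' T T').
Local Notation Z := (Z_infty (hN := hN) lambda T lambda' T').
Local Notation hsum := (hellinger_sum (hN := hN) T T').

(** Common source of the domination results: a finite [Z_infty], or almost everywhere a finite
    Hellinger sum, keeps the likelihood ratio from tending to infinity. Off a mu'-null cover of the
    bad points, [null_likelihood_bounded] applies. *)
Lemma negligible_unbounded_dominated A : measurable A -> mu A = 0%E ->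
  mu'.-negligible (A `&` [set x | ~ exists a : R, forall m,
    exists2 n, (m <= n)%N & L n x <= a]) ->
  mu'.-negligible A.
Proof.
move=> mA A0 [B [mB B0 AB]].
have AB0 : mu' (A `\` B) = 0%E.
  apply: (null_likelihood_bounded hmu hmu'); first exact: measurableD.
    by apply: subset_measure0 A0; rewrite //; do ?[exact: measurableD|exact: subDsetl].
  by move=> x [Ax Bx]; apply: contrapT => H; apply: Bx; apply: AB.
apply: (@negligibleS _ _ _ _ ((A `\` B) `|` B)) => [x Ax|].
  by have [Bx|nBx] := pselect (B x); [right|left].
apply: negligibleU; last by exists B; split.
by apply/negligibleP => //; exact: measurableD.
Qed.

Lemma negligible_Z_infty_eq0 : mu'.-negligible [set x | Z x = 0%E].
Proof.
have mS : measurable [set x | Z x = 0%E].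
  by apply: measurable_level_eq; exact: measurable_Z_infty.
apply/negligibleP => //; apply: (null_likelihood_cvg0 hmu hmu') => // x Zx.
exact: (Z_infty_eq0 hmu hmu').
Qed.

(** A covers the points where the likelihood ratio does not come arbitrarily close to 0, which is
    mu-null by the martingale argument; at the remaining points liminf Z_n = 0, which is mu'-null.
    The same splitting serves equivalence and singularity. *)
Lemma hellinger_pinfty_split : exists A B,
  [/\ measurable A, mu A = 0%E, measurable B, mu' B = 0%E &
      [set x | hsum x = +oo%E] `<=` A `|` B].
Proof.
have [A [mA A0 HA]] := negligible_hellinger_pinfty hmu hmu'.
have mS : measurable [set x | hsum x = +oo%E].
  by apply: measurable_level_eq; exact: (measurable_hellinger_sum hmu hmu').
exists A, ([set x | hsum x = +oo%E] `\` A); split => //.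
- exact: measurableD.
- apply: (null_likelihood_cvg0 hmu hmu'); first exact: measurableD.
  by move=> x [hx nAx]; apply: contrapT => H; apply: nAx; apply: HA.
- by move=> x hx; have [Ax|nAx] := pselect (A x); [left|right].
Qed.

Lemma negligible_hellinger_fin_dominated A : measurable A -> mu A = 0%E ->
  mu'.-negligible (A `&` [set x | (hsum x < +oo)%E]).
Proof.
move=> mA A0.
have mS : measurable [set x | (hsum x < +oo)%E].
  by apply: measurable_level_lt; exact: (measurable_hellinger_sum hmu hmu').
apply: negligible_unbounded_dominated; first exact: measurableI.
  by apply: subset_measure0 A0; rewrite //; do ?[exact: measurableI|exact: subIsetl].
by apply: negligibleS (negligible_hellinger_fin hmu hmu') => x [[_ hx] ?].
Qed.

Lemma negligible_Z_lty_dominated A : measurable A -> mu A = 0%E ->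
  mu'.-negligible (A `&` [set x | (Z x < +oo)%E]).
Proof.
move=> mA A0.
have mS : measurable [set x | (Z x < +oo)%E].
  by apply: measurable_level_lt; exact: measurable_Z_infty.
apply: negligible_unbounded_dominated; first exact: measurableI.
  by apply: subset_measure0 A0; rewrite //; do ?[exact: measurableI|exact: subIsetl].
apply: (@negligibleS _ _ _ _ set0) => [x [[_ /= Zx] []]|]; last exact: negligible_set0.
exact: (Z_infty_lty hmu hmu').
Qed.

End NullSetComparison.

Section MeasureCriteria.
Context (R : realType) (N : nat) (hN : (2 <= N)%N).
Context (lambda lambda' : 'rV[R]_N) (T T' : nat -> 'M[R]_N).
Context (mu mu' : probability (words hN) R).
Hypotheses (hmu : markov_measure mu lambda T) (hmu' : markov_measure mu' lambda' T').
Implicit Types (x y : words hN) (A : set (words hN)).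

Local Notation Z := (Z_infty (hN := hN) lambda T lambda' T').
Local Notation hsum := (hellinger_sum (hN := hN) T T').

Let mZlty : measurable [set x | (Z x < +oo)%E].
Proof. by apply: measurable_level_lt; exact: measurable_Z_infty. Qed.

Let mZgt0 : measurable [set x | (0 < Z x)%E].
Proof. by apply: measurable_level_gt; exact: measurable_Z_infty. Qed.

Let mZeq (c : \bar R) : measurable [set x | Z x = c].
Proof. by apply: measurable_level_eq; exact: measurable_Z_infty. Qed.

Let nZgt0 : ~` [set x | (0 < Z x)%E] = [set x | Z x = 0%E].
Proof.
apply/seteqP; split => x /= => [/negP|->]; last by rewrite ltxx.
by rewrite -leNgt => Zx; apply/le_anti; rewrite Zx (Z_infty_ge0 hmu hmu').
Qed.

Let nZlty : ~` [set x | (Z x < +oo)%E] = [set x | Z x = +oo%E].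
Proof.
apply/seteqP; split => x /= => [/negP|->]; last by rewrite ltxx.
by rewrite -leNgt leye_eq => /eqP.
Qed.

Lemma negligible_Z_infty_pinfty : mu.-negligible [set x | Z x = +oo%E].
Proof.
apply/negligibleP => //; apply: (null_likelihood_cvg0 hmu' hmu) => // x Zx a a0 m.
have [n mn an] := Z_infty_pinfty hmu hmu' Zx a^-1 m; exists n => //.
rewrite likelihood_inv invf_ple// posrE ?invr_gt0//.
exact: likelihood_gt0 hmu hmu' n x.
Qed.

(** A positive limsup of Z_n means that 1 / Z_n stays bounded along infinitely many n, the condition
    that the argument needs after exchanging the measures. *)
Let negligible_Z_gt0 A : measurable A -> mu' A = 0%E ->
  mu.-negligible (A `&` [set x | (0 < Z x)%E]).
Proof.
move=> mA A0; apply: (negligible_unbounded_dominated hmu' hmu); first exact: measurableI.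
  by apply: subset_measure0 A0; rewrite //; do ?[exact: measurableI|exact: subIsetl].
apply: (@negligibleS _ _ _ _ set0) => [x [[_ /= Zx] []]|]; last exact: negligible_set0.
have [a a0 Ha] := Z_infty_gt0 hmu hmu' Zx.
exists a^-1 => m; have [n mn an] := Ha m; exists n => //.
rewrite likelihood_inv lef_pV2 ?posrE//.
exact: likelihood_gt0 hmu hmu' n x.
Qed.

Lemma measure_equivalent_Z : measure_equivalent mu mu' ->
  mu' [set x | (Z x < +oo)%E] = 1%E /\ mu [set x | (0 < Z x)%E] = 1%E.
Proof.
move=> [/null_content_dominatesP dom /null_content_dominatesP dom'].
rewrite !probability_eq1// nZgt0 nZlty; split; apply/negligibleP => //.
  by apply: dom' => //; apply/negligibleP => //; exact: negligible_Z_infty_pinfty.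
by apply: dom => //; apply/negligibleP => //; exact: (negligible_Z_infty_eq0 hmu hmu').
Qed.

Lemma Z_measure_equivalent : mu' [set x | (Z x < +oo)%E] = 1%E ->
  mu [set x | (0 < Z x)%E] = 1%E -> measure_equivalent mu mu'.
Proof.
rewrite !probability_eq1// => Zlty Zgt0.
split; apply/null_content_dominatesP => A mA A0; apply/negligibleP => //.
  apply: negligibleS (negligibleU (negligible_Z_gt0 mA A0) Zgt0) => x Ax.
  by have [?|?] := pselect (0 < Z x)%E; [left|right].
apply: negligibleS (negligibleU (negligible_Z_lty_dominated hmu hmu' mA A0) Zlty) => x Ax.
by have [?|?] := pselect (Z x < +oo)%E; [left|right].
Qed.

Lemma measure_equivalent_hellinger : measure_equivalent mu mu' ->
  {ae mu, forall x, (hsum x < +oo)%E} /\ {ae mu', forall x, (hsum x < +oo)%E}.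
Proof.
move=> [/null_content_dominatesP dom /null_content_dominatesP dom'].
have [A [B [mA A0 mB B0 AB]]] := hellinger_pinfty_split hmu hmu'.
have sub : ~` [set x | (hsum x < +oo)%E] `<=` A `|` B.
  by move=> x /negP; rewrite -leNgt leye_eq => /eqP /AB.
split; (apply: (negligibleS sub); apply: negligibleU; apply/negligibleP => //).
  exact: dom.
exact: dom'.
Qed.

Lemma hellinger_measure_equivalent : {ae mu, forall x, (hsum x < +oo)%E} ->
  {ae mu', forall x, (hsum x < +oo)%E} -> measure_equivalent mu mu'.
Proof.
move=> H H'; split; apply/null_content_dominatesP => A mA A0; apply/negligibleP => //.
  apply: negligibleS (negligibleU
    (negligible_hellinger_fin_dominated hmu' hmu mA A0) H) => x Ax.
  by have [?|?] := pselect (hsum x < +oo)%E; [left; rewrite /= hellinger_sumC|right].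
apply: negligibleS (negligibleU
  (negligible_hellinger_fin_dominated hmu hmu' mA A0) H') => x Ax.
by have [?|?] := pselect (hsum x < +oo)%E; [left|right].
Qed.

Lemma mutually_singular_Z : mutually_singular mu mu' ->
  mu' [set x | Z x = +oo%E] = 1%E.
Proof.
move=> [A [mA A0 A'0]]; rewrite probability_eq1//.
have nA : mu'.-negligible (~` A) by apply/negligibleP => //; exact: measurableC.
apply: negligibleS (negligibleU (negligible_Z_lty_dominated hmu hmu' mA A0) nA) => x Zx.
have [Ax|nAx] := pselect (A x); [left|by right]; split => //=.
by rewrite ltey; apply/eqP.
Qed.

(** The set where Z is infinite is always mu-null and the set where Z is 0 is always mu'-null, so
    each alternative provides a separating set. *)
Lemma Z_mutually_singular :
  mu' [set x | Z x = +oo%E] = 1%E \/ mu [set x | Z x = 0%E] = 1%E ->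
  mutually_singular mu mu'.
Proof.
rewrite !probability_eq1// => -[H|H].
  exists [set x | Z x = +oo%E]; split => //.
    by apply/negligibleP => //; exact: negligible_Z_infty_pinfty.
  by apply/negligibleP => //; exact: measurableC.
exists (~` [set x | Z x = 0%E]); split; first exact: measurableC.
  by apply/negligibleP => //; exact: measurableC.
by rewrite setCK; apply/negligibleP => //; exact: (negligible_Z_infty_eq0 hmu hmu').
Qed.

Lemma mutually_singular_hellinger : mutually_singular mu mu' ->
  {ae mu', forall x, hsum x = +oo%E}.
Proof.
move=> [A [mA A0 A'0]].
have nA : mu'.-negligible (~` A) by apply/negligibleP => //; exact: measurableC.
apply: negligibleS (negligibleU
  (negligible_hellinger_fin_dominated hmu hmu' mA A0) nA) => x hx.
have [Ax|nAx] := pselect (A x); [left|by right]; split => //=.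
by rewrite ltey; apply/eqP.
Qed.

Lemma hellinger_mutually_singular : {ae mu', forall x, hsum x = +oo%E} ->
  mutually_singular mu mu'.
Proof.
move=> H; have [A [B [mA A0 mB B0 AB]]] := hellinger_pinfty_split hmu hmu'.
exists A; split => //; apply/negligibleP; first exact: measurableC.
have nB : mu'.-negligible B by apply/negligibleP.
apply: negligibleS (negligibleU H nB) => x nAx.
have [hx|nhx] := pselect (hsum x = +oo%E); last by left.
by have [//|Bx] := AB x hx; right.
Qed.

End MeasureCriteria.

(** * Quasi-stationary data *)

Section ImageMeasure.
Context d d' (X : measurableType d) (Y : measurableType d') (R : realType).
Context (nu : {measure set X -> \bar R}) (mu : {measure set Y -> \bar R}).
Context (s : X -> Y) (ms : measurable_fun setT s).

Lemma ge0_integral_image (g : Y -> \bar R) :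
  (forall A, measurable A -> nu (s @^-1` A) = mu A) ->
  (forall y, 0 <= g y)%E -> measurable_fun setT g ->
  (\int[nu]_x g (s x) = \int[mu]_y g y)%E.
Proof.
move=> numu g0 mg.
pose s' : {mfun X >-> Y} := HB.pack s (isMeasurableFun.Build _ _ _ _ _ ms).
have := @ge0_integral_pushforward _ _ _ _ _ s ms nu setT g measurableT mg.
rewrite preimage_setT => <-//.
apply: (@eq_measure_integral _ _ _ _ mu (pushforward nu s')) => A mA _.
exact: numu.
Qed.
End ImageMeasure.

Section EqualityOnLocalSets.
Context (R : realType) (N : nat) (hN : (2 <= N)%N).
Context (m1 m2 : {finite_measure set (words hN) -> \bar R}).

(** A approximated for the sum of the measures, as in [le_likelihood_io]. Used in both directions,
    it says that a finite measure is determined by its values on local sets. *)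
Lemma le_measure_local :
  (forall n (B : set (words hN)), local n B -> (m1 B <= m2 B)%E) ->
  forall A, measurable A -> (m1 A <= m2 A)%E.
Proof.
move=> m12 A mA; apply/lee_addgt0Pr => e e0.
pose kappa : {finite_measure set (words hN) -> \bar R} := measure_add m1 m2.
have [_ /(_ (e / 2))] := measurable_approximable kappa mA.
rewrite divr_gt0// => /(_ isT)[n [B [lB]]].
rewrite [kappa _]measure_addE => kE.
have mB := local_measurable lB.
have mS := measurable_symdiff mA mB.
have m1S : (m1 (symdiff A B) < (e / 2)%:E)%E by apply: le_lt_trans kE; exact: leeDl.
have m2S : (m2 (symdiff A B) < (e / 2)%:E)%E by apply: le_lt_trans kE; exact: leeDr.
apply: (@le_trans _ _ (m1 (B `|` symdiff A B))).
  apply: le_measure; rewrite ?inE//; first exact: measurableU.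
  by move=> x Ax; have [Bx|nBx] := pselect (B x); [left|right; left].
apply: le_trans; first exact: measureU2.
apply: (@le_trans _ _ (m2 (A `|` symdiff A B) + (e / 2)%:E)%E).
  apply: leeD; last exact: ltW.
  apply: (le_trans (m12 _ _ lB)); apply: le_measure; rewrite ?inE//.
    exact: measurableU.
  by move=> x Bx; have [Ax|nAx] := pselect (A x); [left|right; right].
rewrite [X in (_ <= _ + X%:E)%E]splitr EFinD addeA leeD2r//.
by apply: le_trans; first (exact: measureU2); rewrite leeD2l// ltW.
Qed.

End EqualityOnLocalSets.

Section QuasiStationary.
Context (R : realType) (N : nat) (hN : (2 <= N)%N).
Context (lambda : 'rV[R]_N) (T : nat -> 'M[R]_N) (mu : probability (words hN) R).
Hypotheses (hmu : markov_measure mu lambda T) (hT : quasi_stationary hN T).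
Implicit Types (x y : words hN) (f : words hN -> R).

Local Notation r := (matrix_ratio (hN := hN) T).

Let i0 : 'I_N := Ordinal (ltnW hN).

(* The words [xe] and [xo] realize the largest deviation of the ratios at even,
   resp. odd, positions, so summability along these two words is uniform. *)
Lemma quasi_stationary_uniform : exists b1 b2 : nat -> R,
  [/\ forall k, 0 <= b1 k, forall k, 0 <= b2 k,
      (\sum_(0 <= k <oo) (b1 k)%:E < +oo)%E, (\sum_(0 <= k <oo) (b2 k)%:E < +oo)%E &
      forall k x, `|r k x - 1| <= b1 k + b2 k].
Proof.
pose g k (p : 'I_N * 'I_N) := `|T k p.1 p.2 / T k.+1 p.1 p.2 - 1|.
pose p k := [arg max_(q > (i0, i0)) g k q]%O.
have pmax k q : g k q <= g k (p k).
  by rewrite /p; case: arg_maxP => // q' _ /(_ q isT).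
pose xe : words hN := fun k => if odd k then (p k.-1).2 else (p k).1.
pose xo : words hN := fun k => if odd k then (p k).1 else (p k.-1).2.
exists (fun k => `|r k xe - 1|), (fun k => `|r k xo - 1|); split => //.
move=> k x.
apply: (le_trans (pmax k (x k, x k.+1))).
have [ko|ke] := boolP (odd k).
  apply: (@le_trans _ _ `|r k xo - 1|); last by rewrite lerDr.
  by rewrite /matrix_ratio /xo /= ko.
apply: (@le_trans _ _ `|r k xe - 1|); last by rewrite lerDl.
by rewrite /matrix_ratio /xe /= ke (negbTE ke).
Qed.

Lemma quasi_stationary_summable : exists b : nat -> R, [/\ forall k, 0 <= b k,
  forall k x, `|r k x - 1| <= b k,
  exists B, forall n, \sum_(0 <= k < n) b k <= B &
  forall e, 0 < e -> exists m0, forall n, \sum_(m0 <= k < n) b k <= e].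
Proof.
have [b1 [b2 [b10 b20 s1 s2 bE]]] := quasi_stationary_uniform.
have fin (b : nat -> R) : (forall k, 0 <= b k) -> (\sum_(0 <= k <oo) (b k)%:E < +oo)%E ->
    exists B, forall n, \sum_(0 <= k < n) b k <= B.
  move=> b0 s; exists (fine (\sum_(0 <= k <oo) (b k)%:E)) => n.
  rewrite -lee_fin fineK; first exact: nneseries_partial_le.
  by rewrite ge0_fin_numE// nneseries_ge0// => k _ _; rewrite lee_fin.
have [B1 HB1] := fin _ b10 s1; have [B2 HB2] := fin _ b20 s2.
exists (fun k => b1 k + b2 k); split => //.
- by move=> k; rewrite addr_ge0.
- by exists (B1 + B2) => n; rewrite big_split lerD.
- move=> e e0; have e20 : 0 < e / 2 by rewrite divr_gt0.
  have [m1 H1] := nneseries_tail_small b10 s1 e20.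
  have [m2 H2] := nneseries_tail_small b20 s2 e20.
  exists (maxn m1 m2) => n; rewrite [e]splitr big_split lerD//.
    by apply: H1; rewrite leq_maxl.
  by apply: H2; rewrite leq_maxr.
Qed.

Lemma matrix_ratio_gt0 k x : 0 < r k x.
Proof. by have [[_ _ _ T0 _] _] := hmu; rewrite divr_gt0. Qed.

Definition partial_product m x := \prod_(0 <= k < m) r k x.

Lemma partial_product_gt0 m x : 0 < partial_product m x.
Proof. by apply: prodr_gt0 => k _; exact: matrix_ratio_gt0. Qed.

Lemma partial_product_le : exists2 K : R, 0 <= K &
  forall m x, partial_product m x <= K.
Proof.
have [b [b0 bE [B HB] _]] := quasi_stationary_summable.
exists (expR B); first exact: expR_ge0.
move=> m x; apply: (@le_trans _ _ (\prod_(0 <= k < m) expR (b k))).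
  apply: ler_prod => k _; rewrite ltW ?matrix_ratio_gt0//=.
  apply: le_trans (expR_ge1Dx _); rewrite -lerBlDl.
  exact: le_trans (ler_norm _) (bE k x).
by rewrite -expR_sum ler_expR.
Qed.

(** The partial products are partial sums of a series whose increments are bounded by K b_k, so the
    series converges absolutely. *)
Lemma cvg_partial_product x : cvgn (fun m => partial_product m x).
Proof.
have [K K0 HK] := partial_product_le.
have [b [b0 bE [B HB] _]] := quasi_stationary_summable.
pose u k := partial_product k.+1 x - partial_product k x.
have -> : (fun m => partial_product m x) = (fun m => 1 + series u m).
  apply/funext => m; rewrite /series /= telescope_sumr//.
  by rewrite [X in _ - X]/partial_product big_geq// addrC subrK.
apply: is_cvgD; first exact: is_cvg_cst.
apply: normed_cvg; apply: nondecreasing_is_cvgn.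
  by apply: nondecreasing_series => k _ _; exact: normr_ge0.
exists (K * B) => _ [n _ <-]; rewrite /series /=.
apply: (@le_trans _ _ (\sum_(0 <= k < n) K * b k)).
  apply: ler_sum => k _.
  rewrite /u /partial_product big_nat_recr//= -/(partial_product k x).
  rewrite -[X in _ - X]mulr1 -mulrBr normrM ler_pM//.
  by rewrite ger0_norm// ltW// partial_product_gt0.
by rewrite -mulr_sumr ler_wpM2l.
Qed.

(** Past an index where the tail of the b_k is at most 1 / 2, every further partial product of the
    ratios is at least 1 / 2 by [prod_ge_1Bsum]. *)
Lemma ratio_product_gt0 x : 0 < ratio_product T x.
Proof.
have [b [b0 bE _ /(_ (1 / 2))]] := quasi_stationary_summable.
rewrite divr_gt0// => /(_ isT)[m0 Hm0].
apply: (@lt_le_trans _ _ (partial_product m0 x * (1 / 2))).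
  by rewrite mulr_gt0 ?partial_product_gt0// divr_gt0.
apply: limr_ge; first exact: cvg_partial_product.
exists m0 => // n /= m0n.
rewrite (@big_cat_nat _ _ _ m0 0%N n)//= ler_pM2l ?partial_product_gt0//.
(* Truncated at 0 since [b k] may exceed 1 and [prod_ge_1Bsum] asks for factors in [0, 1]. *)
pose q k := Num.max 0 (1 - b k).
have q01 k : 0 <= q k <= 1 by rewrite le_max lexx ge_max ler01/= gerBl.
apply: (@le_trans _ _ (\prod_(m0 <= k < n) q k)); last first.
  apply: ler_prod => k _; have /andP[-> _] := q01 k.
  rewrite ge_max ltW ?matrix_ratio_gt0//= lerBlDl -lerBlDr.
  by apply: le_trans (bE k x); rewrite -normrN opprB ler_norm.
apply: le_trans (prod_ge_1Bsum _ _ q01).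
have : \sum_(m0 <= k < n) (1 - q k) <= 1 / 2.
  apply: le_trans (Hm0 n); apply: ler_sum => k _.
  by rewrite lerBlDl -lerBlDr le_max lexx orbT.
lra.
Qed.

Lemma cvg_ratio_product x : (fun m => partial_product m x) @ \oo --> ratio_product T x.
Proof. exact: cvg_partial_product. Qed.

Lemma measurable_ratio_product : measurable_fun setT (ratio_product (hN := hN) T).
Proof.
apply: (measurable_fun_cvg (h := partial_product)).
  move=> m; apply: (@local_measurable_fun _ _ _ _ m.+1) => x y.
  by apply: (@local_prod _ _ _ m.+1 m r) => k km; exact: (@local_letter _ _ _ _ _
    (fun i j => T k i j / T k.+1 i j)).
by move=> x _; exact: cvg_ratio_product.
Qed.

Definition weight0 x := lambda 0 (x 1%N) / (lambda 0 (x 0%N) * T 0%N (x 0%N) (x 1%N)).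

Lemma weight0_gt0 x : 0 < weight0 x.
Proof. by have [[l0 _ _ T0 _] _] := hmu; rewrite divr_gt0// mulr_gt0. Qed.

Lemma rep_weight_ge0 j x : 0 <= rep_weight lambda T j x.
Proof. by rewrite mulr_ge0. Qed.

Lemma rep_weight_gt0 j x : (0 < rep_weight lambda T j x) = (x 0%N == j).
Proof.
rewrite /rep_weight; case: eqP => _; last by rewrite mul0r ltxx.
by rewrite mul1r sqrtr_gt0 mulr_gt0 ?weight0_gt0 ?ratio_product_gt0.
Qed.

Lemma sqr_rep_weight j x : rep_weight lambda T j x ^+ 2 =
  (x 0%N == j)%:R * (weight0 x * ratio_product T (Defs.shift x)).
Proof.
rewrite exprMn sqr_sqrtr; last by rewrite mulr_ge0 ?ltW ?weight0_gt0 ?ratio_product_gt0.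
by congr (_ * _); case: (_ == _); rewrite ?expr1n ?expr0n.
Qed.

Lemma measurable_rep_weight j : measurable_fun setT (rep_weight (hN := hN) lambda T j).
Proof.
apply: measurable_funM.
  by apply: (@local_measurable_fun _ _ _ _ 1) => x y xy; rewrite xy.
apply: (measurableT_comp (f := @Num.sqrt R)) => //.
  by apply: continuous_measurable_fun; exact: sqrt_continuous.
apply: measurable_funM.
  by apply: (@local_measurable_fun _ _ _ _ 2) => x y xy; rewrite !xy.
exact: (measurableT_comp measurable_ratio_product (@measurable_shift N hN)).
Qed.

(** Exact already at finite stages: [weight0] exchanges the initial weight and first transition of
    the word jz for the initial weight of z, and the partial product turns each T^(k+1) along z into
    T^(k). The path weight of jz becomes that of z. *)
Lemma integral_weight_partial j m f : local m.+1 f -> (forall x, 0 <= f x) ->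
  (\int[mu]_x ((x 0%N == j)%:R * (weight0 x * partial_product m (Defs.shift x)) *
     f (Defs.shift x))%:E = \int[mu]_x (f x)%:E)%E.
Proof.
move=> lf f0.
have [[l0 _ _ T0 _] _] := hmu.
have lp : local m.+1 (partial_product m).
  by apply: (@local_prod _ _ _ m.+1 m r) => k km; exact: (@local_letter _ _ _ _ _
    (fun i j => T k i j / T k.+1 i j)).
have sh n x y : agree n.+1 x y -> agree n (Defs.shift x) (Defs.shift y).
  by move=> xy k kn; apply: xy.
pose F x := (x 0%N == j)%:R * (weight0 x * partial_product m (Defs.shift x)) *
  f (Defs.shift x).
have lF : local m.+2 F.
  move=> x y xy; rewrite /F /weight0 (lp _ _ (sh _ _ _ xy)) (lf _ _ (sh _ _ _ xy)).
  by rewrite !xy.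
have F0 x : 0 <= F x.
  rewrite /F; apply: mulr_ge0 => //; apply: mulr_ge0; first exact: ler0n.
  by apply: mulr_ge0; apply: ltW; [exact: weight0_gt0|exact: partial_product_gt0].
rewrite (integral_local hmu lF F0) (integral_local hmu lf f0); congr _%:E.
rewrite (sum_tuple_cons _ (fun w => path_weight lambda T m.+1 (word_of hN w) *
  F (word_of hN w))).
rewrite (bigD1 j)//= [X in _ + X]big1 ?addr0; last first.
  move=> i ij; apply: big1 => w _.
  by rewrite /F (_ : (word_of hN (i :: w) 0%N == j) = false) ?mul0r ?mulr0//; apply/negbTE.
apply: eq_bigr => w _.
have wS : Defs.shift (word_of hN (j :: w)) = word_of hN w by [].
have w0 : word_of hN (j :: w) 0%N = j by [].
have w1 : word_of hN (j :: w) 1%N = word_of hN w 0%N by [].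
rewrite /F wS w0 eqxx mul1r mulrA; congr (_ * _).
rewrite /weight0 w0 w1 /path_weight w0 big_nat_recl// w0 w1.
set z := word_of hN w.
have -> : \prod_(0 <= i < m) T i.+1 (word_of hN (j :: w) i.+1) (word_of hN (j :: w) i.+2) =
    \prod_(0 <= i < m) T i.+1 (z i) (z i.+1) by [].
have TP : \prod_(0 <= i < m) T i.+1 (z i) (z i.+1) * partial_product m z =
    \prod_(0 <= i < m) T i (z i) (z i.+1).
  rewrite /partial_product -big_split /=; apply: eq_bigr => k _.
  by rewrite /matrix_ratio mulrC divfK// gt_eqF.
rewrite -TP.
have := T0 0%N j (z 0%N); have := l0 j.
set a := lambda 0 j; set t := T 0%N _ _; set P := \prod_(_ <= _ < _) _.
move=> a0 t0; rewrite [P * _]mulrC; field.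
by rewrite !gt_eqF.
Qed.

End QuasiStationary.

(** * The squared weight is the derivative of the measure under the shift *)

Section ChangeOfVariables.
Context (R : realType) (N : nat) (hN : (2 <= N)%N).
Context (lambda : 'rV[R]_N) (T : nat -> 'M[R]_N) (mu : probability (words hN) R).
Hypotheses (hmu : markov_measure mu lambda T) (hT : quasi_stationary hN T).
Context (j : 'I_N).
Implicit Types (x y : words hN) (f : words hN -> R).

Local Notation w := (rep_weight (hN := hN) lambda T j).

Let w2_ge0 x : 0 <= w x ^+ 2. Proof. exact: sqr_ge0. Qed.

Let mw2 : measurable_fun setT (fun x => w x ^+ 2).
Proof. by apply: measurable_funX; exact: (measurable_rep_weight hmu hT). Qed.

Let weight0_le : exists2 C : R, 0 <= C & forall x, weight0 (hN := hN) lambda T x <= C.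
Proof.
have [[l0 _ _ T0 _] _] := hmu.
have W0 (p : 'I_N * 'I_N) : 0 <= lambda 0 p.2 / (lambda 0 p.1 * T 0%N p.1 p.2).
  by rewrite divr_ge0 ?mulr_ge0 ?ltW.
exists (\sum_(p : 'I_N * 'I_N) lambda 0 p.2 / (lambda 0 p.1 * T 0%N p.1 p.2)).
  by apply: sumr_ge0 => p _; exact: W0.
move=> x; rewrite (bigD1 (x 0%N, x 1%N))//= lerDl; apply: sumr_ge0 => p _; exact: W0.
Qed.

(** Dominated convergence in [integral_weight_partial]: the integrals equal [mu B] from m = n on,
    and C K bounds the integrands. *)
Let integral_rep_weight_local n (B : set (words hN)) : local n B ->
  (\int[mu]_x (w x ^+ 2 * \1_B (Defs.shift x))%:E = mu B)%E.
Proof.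
move=> lB.
have mB := local_measurable lB.
have l1B : local n (\1_B : _ -> R).
  move=> x y /lB xy; rewrite !indicE.
  by have -> : (x \in B) = (y \in B) by exact: (congr1 asbool xy).
have [C C0 HC] := weight0_le; have [K K0 HK] := partial_product_le hmu hT.
pose f_ m x := ((x 0%N == j)%:R * (weight0 lambda T x *
  partial_product T m (Defs.shift x)) * \1_B (Defs.shift x))%:E.
have m1B : measurable_fun setT (fun x : words hN => \1_B (Defs.shift x) : R).
  apply: (@measurableT_comp _ _ _ _ _ _ (\1_B : words hN -> R)).
    exact: measurable_indic.
  exact: measurable_shift.
have lp m : local m.+1 (partial_product (hN := hN) T m).
  by apply: (@local_prod _ _ _ m.+1 m (matrix_ratio T)) => k km;
    exact: (@local_letter _ _ _ _ _ (fun i l => T k i l / T k.+1 i l)).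
have bound0 m x : 0 <= (x 0%N == j)%:R * (weight0 lambda T x *
    partial_product T m (Defs.shift x)).
  by rewrite mulr_ge0// mulr_ge0// ltW ?(weight0_gt0 hmu)// (partial_product_gt0 hmu).
have mf_ m : measurable_fun setT (f_ m).
  apply/measurable_EFinP/measurable_funM => //.
  apply: (@local_measurable_fun _ _ _ _ m.+2) => x y xy.
  rewrite /weight0 (lp m (Defs.shift x) (Defs.shift y)); last by move=> k kn; apply: xy.
  by rewrite !xy.
have mf : measurable_fun setT (fun x => (w x ^+ 2 * \1_B (Defs.shift x))%:E).
  by apply/measurable_EFinP/measurable_funM.
have ff : {ae mu, forall x, setT x ->
    f_ ^~ x @ \oo --> (w x ^+ 2 * \1_B (Defs.shift x))%:E}.
  apply: nearW => x _; apply: cvg_EFin; first by apply: nearW.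
  rewrite (sqr_rep_weight hmu hT); apply: cvgMl; apply: cvgMr; apply: cvgMr.
  exact: (cvg_ratio_product hmu hT).
have ig : mu.-integrable setT (cst (C * K)%:E).
  exact: finite_measure_integrable_cst.
have fg : {ae mu, forall x m, setT x -> (`|f_ m x| <= cst (C * K)%:E x)%E}.
  apply: nearW => x m _ /=; rewrite lee_fin ger0_norm; last by rewrite mulr_ge0.
  have w0 : 0 <= weight0 lambda T x by rewrite ltW ?(weight0_gt0 hmu).
  have p0 : 0 <= partial_product T m (Defs.shift x).
    by rewrite ltW ?(partial_product_gt0 hmu).
  have i1 : \1_B (Defs.shift x) <= 1 :> R by rewrite indicE; case: (_ \in _).
  have e1 : (x 0%N == j)%:R <= 1 :> R by case: (_ == _).
  rewrite -[leRHS]mulr1; apply: ler_pM => //.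
  rewrite -[leRHS]mul1r; apply: ler_pM => //; first exact: mulr_ge0.
  exact: ler_pM.
have [_ _ cv] := dominated_convergence measurableT mf_ mf ff ig fg.
apply: (cvg_unique _ cv); first exact: ereal_hausdorff.
apply: cvg_near_cst; exists n => // m /= nm.
rewrite (integral_weight_partial hmu j (m := m) (f := \1_B))//.
  by rewrite integral_indic// setIT.
by apply: local_leq l1B; exact: leqW.
Qed.

Lemma integral_rep_weight (g : words hN -> \bar R) : (forall x, 0 <= g x)%E ->
  measurable_fun setT g ->
  (\int[mu]_x ((w x ^+ 2)%:E * g (Defs.shift x)) = \int[mu]_x g x)%E.
Proof.
move=> g0 mg.
have fi : (\int[mu]_x (w x ^+ 2)%:E < +oo)%E.
  have := @integral_rep_weight_local 0 setT (fun _ _ _ => erefl).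
  under eq_integral do rewrite indicT mulr1.
  by move=> ->; rewrite probability_setT ltry.
pose nu := density w2_ge0 mw2 fi.
have ms := @measurable_shift N hN.
have nuE A : measurable A -> nu (@Defs.shift N hN @^-1` A) = mu A.
  pose s' : {mfun words hN >-> words hN} :=
    HB.pack (@Defs.shift N hN) (isMeasurableFun.Build _ _ _ _ _ ms).
  have fin : fin_num_fun (pushforward nu s').
    move=> D mD; rewrite /pushforward fin_num_measure// -[X in measurable X]setTI.
    exact: (@measurable_shift N hN).
  pose m0 : {finite_measure set (words hN) -> \bar R} :=
    HB.pack (pushforward nu s') (Measure_isFinite.Build _ _ _ (pushforward nu s') fin).
  pose m1 : {finite_measure set (words hN) -> \bar R} := m0 ms ms ms ms.
  have loc n B : local n B -> m1 B = mu B.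
    move=> lB; rewrite -(integral_rep_weight_local lB).
    transitivity (\int[mu]_(x in @Defs.shift N hN @^-1` B) (w x ^+ 2)%:E)%E; first by [].
    rewrite [LHS]integral_mkcond; apply: eq_integral => x _; rewrite /patch indicE.
    rewrite -[x \in _]/(Defs.shift x \in (B : set (words hN))).
    by case: (_ \in _); rewrite ?mulr1 ?mulr0.
  move=> mA; apply/le_anti/andP; split.
    apply: (@le_measure_local _ _ _ m1 mu) => // n B lB.
    by rewrite (loc n B lB).
  apply: (@le_measure_local _ _ _ mu m1) => // n B lB.
  by rewrite (loc n B lB).
rewrite -(ge0_integral_image ms nuE g0 mg).
rewrite (ge0_integral_density _ _ _ (g := fun x => g (Defs.shift x)))//.
  by apply: eq_integral => x _; rewrite muleC.
exact: measurableT_comp.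
Qed.

End ChangeOfVariables.

(** * Weighted composition operators *)

Lemma ae_and d (X : measurableType d) (R : realType) (mu : {measure set X -> \bar R})
    (P Q : X -> Prop) :
  {ae mu, forall x, P x} -> {ae mu, forall x, Q x} -> {ae mu, forall x, P x /\ Q x}.
Proof. by move=> aP aQ; apply: filterS2 aP aQ. Qed.

Section SquareNorm.
Context d (X : measurableType d) (R : realType) (mu : {measure set X -> \bar R}).
Local Notation Re := (@complex.Re R).
Local Notation Im := (@complex.Im R).
Implicit Types (u v : L2 mu) (f g : X -> R[i]).

Definition sqmod (z : R[i]) : R := Re z ^+ 2 + Im z ^+ 2.

Lemma sqmod_ge0 z : 0 <= sqmod z.
Proof. by rewrite addr_ge0// sqr_ge0. Qed.

Lemma sqmodZ (a : R) z : sqmod (a%:C%C * z) = a ^+ 2 * sqmod z.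
Proof. by rewrite /sqmod; case: z => x y /=; ring. Qed.

Lemma sqintP f : f \in sqint mu <-> [/\ measurable_fun setT (Re \o f),
  measurable_fun setT (Im \o f) & (\int[mu]_x (sqmod (f x))%:E < +oo)%E].
Proof.
have LfunP2 (h : X -> R) : h \in Lfun mu 2%:E <-> measurable_fun setT h /\
    (\int[mu]_x (h x ^+ 2)%:E < +oo)%E.
  split=> [hL|[mh hi]].
    have /integrableP[_] := Lfun2_integrable_sqr hL.
    under eq_integral do rewrite /= ger0_norm ?sqr_ge0//.
    by move=> ?; split => //; move: hL; rewrite inE => /andP[]; rewrite inE.
  rewrite inE; apply/andP; split; rewrite inE//=.
  rewrite /finite_norm unlock poweR_lty//.
  by under eq_integral do rewrite /= powR_mulrn// real_normK ?num_real//.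
have mE (h : X -> R) : measurable_fun setT h -> measurable_fun setT (fun x => (h x ^+ 2)%:E).
  by move=> mh; apply/measurable_EFinP; exact: measurable_funX.
have sum : measurable_fun setT (Re \o f) -> measurable_fun setT (Im \o f) ->
    (\int[mu]_x (sqmod (f x))%:E =
     \int[mu]_x ((Re \o f) x ^+ 2)%:E + \int[mu]_x ((Im \o f) x ^+ 2)%:E)%E.
  move=> mr mi; rewrite -ge0_integralD//.
  - by move=> x _; rewrite lee_fin sqr_ge0.
  - exact: mE.
  - by move=> x _; rewrite lee_fin sqr_ge0.
  - exact: mE.
have ge0 (h : X -> R) : (0 <= \int[mu]_x (h x ^+ 2)%:E)%E.
  by apply: integral_ge0 => x _; rewrite lee_fin sqr_ge0.
rewrite inE; split=> [/andP[/LfunP2[mr ir] /LfunP2[mi ii]]|[mr mi]].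
  by split => //; rewrite sum// lte_add_pinfty.
rewrite sum// => H; apply/andP; split; apply/LfunP2; split => //.
  by apply: le_lt_trans H; rewrite leeDl.
by apply: le_lt_trans H; rewrite leeDr.
Qed.

Lemma L2_fun_sqint u : L2_fun u \in sqint mu.
Proof. exact: valP (repr u). Qed.

Lemma measurable_sqmod u : measurable_fun setT (fun x => (sqmod (L2_fun u x))%:E).
Proof.
have [mr mi _] := proj1 (sqintP _) (L2_fun_sqint u).
by apply/measurable_EFinP/measurable_funD; exact: measurable_funX.
Qed.

(** Kept as an extended real so that norm estimates are inequalities between integrals of
    nonnegative functions. *)
Definition sqnorm u : \bar R := (\int[mu]_x (sqmod (L2_fun u x))%:E)%E.

Lemma sqnorm_ge0 u : (0 <= sqnorm u)%E.
Proof. by apply: integral_ge0 => x _; rewrite lee_fin sqmod_ge0. Qed.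

Lemma sqnorm_fin u : sqnorm u \is a fin_num.
Proof.
by rewrite ge0_fin_numE ?sqnorm_ge0//; have [] := proj1 (sqintP _) (L2_fun_sqint u).
Qed.

Lemma L2_dot_sqnorm u : L2_dot u u = (fine (sqnorm u))%:C%C.
Proof.
rewrite /L2_dot /Cintegral; congr Complex.
  apply: eq_Rintegral => x _; rewrite /sqmod.
  by case: (L2_fun u x) => ? ? /=; ring.
rewrite (@eq_Rintegral _ _ _ mu setT (cst 0)) ?Rintegral_cst ?mul0r// => x _.
by case: (L2_fun u x) => ? ? /=; ring.
Qed.

Lemma L2_ext u v : {ae mu, forall x, L2_fun u x = L2_fun v x} -> u = v.
Proof. by move/L2_eqP. Qed.

Lemma ae_sqnorm u f : {ae mu, forall x, L2_fun u x = f x} ->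
  measurable_fun setT (Re \o f) -> measurable_fun setT (Im \o f) ->
  sqnorm u = (\int[mu]_x (sqmod (f x))%:E)%E.
Proof.
move=> uf mr mi; apply: ae_eq_integral => //.
- exact: measurable_sqmod.
- by apply/measurable_EFinP/measurable_funD; exact: measurable_funX.
- by apply: filterS uf => x /= ->.
Qed.

Lemma L2_funD u v : {ae mu, forall x, L2_fun (u + v) x = L2_fun u x + L2_fun v x}.
Proof.
apply: filterS (L2_fun_pi (repr u + repr v)) => x.
by rewrite L2_piD !reprK.
Qed.

Lemma L2_funZ a u : {ae mu, forall x, L2_fun (a *: u) x = a * L2_fun u x}.
Proof.
apply: filterS (L2_fun_pi (a *: repr u)) => x.
by rewrite -L2scaleE reprK.
Qed.

Lemma L2_fun0 : {ae mu, forall x, L2_fun (0 : L2 mu) x = 0}.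
Proof.
apply: filterS (L2_funZ 0 (0 : L2 mu)) => x.
by rewrite scale0r mul0r.
Qed.

Lemma sqnorm_eq0 u : sqnorm u = 0%E -> u = 0.
Proof.
move=> u0; apply/eqP; apply: contraT => un0.
by have := L2_dot_gt0 un0; rewrite L2_dot_sqnorm u0 ltxx.
Qed.

End SquareNorm.

Section WeightedComposition.
Context d d' (X : measurableType d) (Y : measurableType d') (R : realType).
Context (mu : {measure set X -> \bar R}) (nu : {measure set Y -> \bar R}).
Local Notation Re := (@complex.Re R).
Local Notation Im := (@complex.Im R).
Context (w : Y -> R) (s : Y -> X) (mw : measurable_fun setT w) (ms : measurable_fun setT s).
Implicit Types (u v : L2 mu) (f g : X -> R[i]).

(** One construction for the operators S_j, their adjoints, the multiplications by indicators and
    the intertwiner. Hypothesis [ws] says that the image under [s] of the measure with density w^2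
    is at most mu. *)
Definition wcomp u : L2 nu :=
  L2_class nu (fun y => (w y)%:C%C * L2_fun u (s y)).

Hypothesis ws : forall g : X -> \bar R, (forall x, 0 <= g x)%E -> measurable_fun setT g ->
  (\int[nu]_y ((w y ^+ 2)%:E * g (s y)) <= \int[mu]_x g x)%E.

Lemma wcomp_measurable u :
  measurable_fun setT (Re \o (fun y => (w y)%:C%C * L2_fun u (s y))) /\
  measurable_fun setT (Im \o (fun y => (w y)%:C%C * L2_fun u (s y))).
Proof.
have [mr mi _] := proj1 (sqintP _ _) (L2_fun_sqint u).
split.
- rewrite (_ : _ \o _ = (fun y => w y * (Re \o L2_fun u) (s y))).
    by apply: measurable_funM => //; exact: measurableT_comp.
  by apply/funext => y /=; case: (L2_fun u (s y)) => a b /=; ring.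
- rewrite (_ : _ \o _ = (fun y => w y * (Im \o L2_fun u) (s y))).
    by apply: measurable_funM => //; exact: measurableT_comp.
  by apply/funext => y /=; case: (L2_fun u (s y)) => a b /=; ring.
Qed.

Lemma wcomp_integral u :
  (\int[nu]_y (sqmod ((w y)%:C%C * L2_fun u (s y)))%:E =
   \int[nu]_y ((w y ^+ 2)%:E * (sqmod (L2_fun u (s y)))%:E))%E.
Proof. by apply: eq_integral => y _; rewrite sqmodZ EFinM. Qed.

Lemma wcomp_sqint u : (fun y => (w y)%:C%C * L2_fun u (s y)) \in sqint nu.
Proof.
have [mr mi] := wcomp_measurable u.
apply/sqintP; split => //; rewrite wcomp_integral.
apply: le_lt_trans (ws (g := fun x => (sqmod (L2_fun u x))%:E) _ _) _ => [x||].
- by rewrite lee_fin sqmod_ge0.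
- exact: measurable_sqmod.
- by rewrite ltey_eq sqnorm_fin.
Qed.

Lemma wcomp_ae u : {ae nu, forall y, L2_fun (wcomp u) y = (w y)%:C%C * L2_fun u (s y)}.
Proof. exact/L2_classK/wcomp_sqint. Qed.

(** By [ws] a mu-null set pulls back to a nu-null set, apart from points where w vanishes. This
    makes [wcomp] independent of representatives: where w is 0 the value of u does not matter. *)
Lemma ae_wcomp (P : X -> Prop) : {ae mu, forall x, P x} ->
  {ae nu, forall y, w y = 0 \/ P (s y)}.
Proof.
move=> [B [mB B0 PB]].
have m1 : measurable_fun setT (fun x : X => (\1_B x)%:E : \bar R).
  by apply/measurable_EFinP; exact: measurable_indic.
have I0 : (\int[nu]_y ((w y ^+ 2)%:E * (\1_B (s y))%:E) = 0)%E.
  apply/eqP; rewrite eq_le; apply/andP; split.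
    apply: le_trans (ws _ m1) _; first by move=> x; rewrite lee_fin.
    by rewrite integral_indic// setIT B0.
  by apply: integral_ge0 => y _; rewrite mule_ge0 ?lee_fin ?sqr_ge0.
have mf : measurable_fun setT (fun y => ((w y ^+ 2)%:E * (\1_B (s y))%:E)%E).
  apply: emeasurable_funM; first by apply/measurable_EFinP; exact: measurable_funX.
  exact: (measurableT_comp m1).
have : (\int[nu]_y `|(w y ^+ 2)%:E * (\1_B (s y))%:E| = 0)%E.
  rewrite -I0; apply: eq_integral => y _.
  by rewrite gee0_abs// mule_ge0 ?lee_fin ?sqr_ge0.
move=> /(ae_eq_integral_abs nu measurableT mf).
apply: filterS => y /(_ I) /= [/eqP].
rewrite mulf_eq0 expf_eq0 /= => /orP[/eqP ->|]; first by left.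
rewrite indicE; case: (boolP (s y \in B)) => [|nB _]; first by rewrite oner_eq0.
right; apply: contrapT => nP; move/negP: nB; apply; rewrite inE; exact: PB.
Qed.

Lemma wcomp_linear : linear wcomp.
Proof.
move=> a u v; apply: L2_ext.
have H0 := ae_wcomp (ae_and (L2_funD (a *: u) v) (L2_funZ a u)).
have H1 := ae_and (wcomp_ae (a *: u + v)) (L2_funD (a *: wcomp u) (wcomp v)).
have H2 := ae_and (ae_and (wcomp_ae u) (wcomp_ae v)) (L2_funZ a (wcomp u)).
apply: filterS (ae_and H0 (ae_and H1 H2)) => y [H [[-> ->] [[Hu Hv] ->]]].
rewrite Hu Hv; case: H => [->|[-> ->]]; first by rewrite !mul0r mulr0 addr0.
by rewrite mulrDr mulrCA.
Qed.

Lemma sqnorm_wcomp_le u : (sqnorm (wcomp u) <= sqnorm u)%E.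
Proof.
have [mr mi] := wcomp_measurable u.
rewrite (ae_sqnorm (wcomp_ae u) mr mi) wcomp_integral.
apply: ws => [x|]; first by rewrite lee_fin sqmod_ge0.
exact: measurable_sqmod.
Qed.

Definition wcomp_linear_fun : {linear L2 mu -> L2 nu} :=
  HB.pack wcomp (GRing.isLinear.Build _ _ _ _ wcomp wcomp_linear).

Hypothesis wsE : forall g : X -> \bar R, (forall x, 0 <= g x)%E -> measurable_fun setT g ->
  (\int[nu]_y ((w y ^+ 2)%:E * g (s y)) = \int[mu]_x g x)%E.

Lemma wcomp_dot u v : L2_dot (wcomp u) (wcomp v) = L2_dot u v.
Proof.
(* [wsE] concerns nonnegative functions, so h is split into its positive and negative parts. *)
have RI (h : X -> R) : measurable_fun setT h ->
    (\int[nu]_y (w y ^+ 2 * h (s y)) = \int[mu]_x h x)%R.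
  move=> mh; rewrite /Rintegral; congr fine.
  have mE : measurable_fun setT (fun x => (h x)%:E) by exact/measurable_EFinP.
  rewrite integralE [RHS]integralE; congr (_ - _)%E.
    rewrite -wsE//; last exact: measurable_funepos.
    apply: eq_integral => y _.
    by rewrite !funeposE -[0%E]/(0%:E) -!EFin_max -EFinM maxr_pMr ?sqr_ge0// mulr0.
  rewrite -wsE//; last exact: measurable_funeneg.
  apply: eq_integral => y _.
  by rewrite !funenegE -[0%E]/(0%:E) -!EFinN -!EFin_max -EFinM maxr_pMr ?sqr_ge0// mulr0 mulrN.
have [mur mui _] := proj1 (sqintP _ _) (L2_fun_sqint u).
have [mvr mvi _] := proj1 (sqintP _ _) (L2_fun_sqint v).
have [Cr Ci] := Cintegrable_mul (repr (wcomp u)) (repr (wcomp v)).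
have ae : {ae nu, forall y, L2_fun (wcomp u) y * (L2_fun (wcomp v) y)^* =
    (w y ^+ 2)%:C%C * (L2_fun u (s y) * (L2_fun v (s y))^*)}.
  apply: filterS2 (wcomp_ae u) (wcomp_ae v) => y -> ->.
  by case: (L2_fun u (s y)) (L2_fun v (s y)) => a b [c e]; apply/eqP;
    rewrite eq_complex /=; apply/andP; split; apply/eqP; ring.
have mRe : measurable_fun setT (fun x => Re (L2_fun u x * (L2_fun v x)^*)).
  rewrite (_ : (fun x => _) = (fun x => (Re \o L2_fun u) x * (Re \o L2_fun v) x +
      (Im \o L2_fun u) x * (Im \o L2_fun v) x)).
    by apply: measurable_funD; exact: measurable_funM.
  by apply/funext => x /=; case: (L2_fun u x) (L2_fun v x) => ? ? [? ?] /=; ring.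
have mIm : measurable_fun setT (fun x => Im (L2_fun u x * (L2_fun v x)^*)).
  rewrite (_ : (fun x => _) = (fun x => (Im \o L2_fun u) x * (Re \o L2_fun v) x -
      (Re \o L2_fun u) x * (Im \o L2_fun v) x)).
    by apply: measurable_funB; exact: measurable_funM.
  by apply/funext => x /=; case: (L2_fun u x) (L2_fun v x) => ? ? [? ?] /=; ring.
have mw2 (h : X -> R) : measurable_fun setT h ->
    measurable_fun setT (fun y => (w y ^+ 2 * h (s y))%:E).
  move=> mh; apply/measurable_EFinP/measurable_funM; first exact: measurable_funX.
  exact: measurableT_comp.
rewrite /L2_dot /Cintegral; congr Complex.
  rewrite -(RI _ mRe) /Rintegral; congr fine; apply: ae_eq_integral => //.
  - exact: measurable_int Cr.
  - exact: mw2 mRe.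
  - apply: filterS ae => y E _; rewrite /= E; congr _%:E.
    by case: (_ * _^*) => a b /=; ring.
rewrite -(RI _ mIm) /Rintegral; congr fine; apply: ae_eq_integral => //.
- exact: measurable_int Ci.
- exact: mw2 mIm.
- apply: filterS ae => y E _; rewrite /= E; congr _%:E.
  by case: (_ * _^*) => a b /=; ring.
Qed.

End WeightedComposition.

(** * Multiplication by indicators of measurable sets *)

Section Restriction.
Context d (X : measurableType d) (R : realType) (mu : {finite_measure set X -> \bar R}).
Implicit Types (u v : L2 mu) (A B : set X).

Lemma indicator_weight A : measurable A ->
  forall g : X -> \bar R, (forall x, 0 <= g x)%E -> measurable_fun setT g ->
  (\int[mu]_x ((\1_A x ^+ 2 : R)%:E * g x) <= \int[mu]_x g x)%E.
Proof.
move=> mA g g0 mg; apply: ge0_le_integral => //.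
- by move=> x _; rewrite mule_ge0// lee_fin sqr_ge0.
- apply: emeasurable_funM => //; apply/measurable_EFinP.
  by apply: measurable_funX; exact: measurable_indic.
- move=> x _; rewrite indicE; case: (_ \in _); first by rewrite expr1n mul1e.
  by rewrite expr0n/= mul0e.
Qed.

Definition restriction A : L2 mu -> L2 mu := wcomp mu (\1_A : X -> R) id.

Lemma restriction_ae A u : measurable A ->
  {ae mu, forall x, L2_fun (restriction A u) x = (\1_A x)%:C%C * L2_fun u x}.
Proof.
move=> mA; apply: (@wcomp_ae _ _ _ _ _ mu mu (\1_A : X -> R) id) => //.
exact: indicator_weight.
Qed.

(** The parallelogram bound, pointwise: 2 |a|^2 + 2 |b|^2 - |a - b|^2 = |a + b|^2. *)
Lemma sqnormB_le u v : (sqnorm (u - v)%R <= 2%:E * sqnorm u + 2%:E * sqnorm v)%E.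
Proof.
have mu' w := measurable_sqmod (w : L2 mu).
rewrite -!ge0_integralZl_EFin//; do ?by move=> x _; rewrite lee_fin sqmod_ge0.
rewrite -ge0_integralD//; do ?by move=> x _; rewrite -EFinM lee_fin mulr_ge0 ?sqmod_ge0.
- apply: ae_ge0_le_integral => //.
  + by move=> x _; rewrite lee_fin sqmod_ge0.
  + by move=> x _; rewrite -!EFinM -EFinD lee_fin addr_ge0// mulr_ge0 ?sqmod_ge0.
  + by apply: emeasurable_funD; exact: measurable_funeM.
  + apply: filterS (ae_and (L2_funD u (- v)) (L2_funZ (-1) v)) => x [-> H] _.
    rewrite -scaleN1r H; case: (L2_fun u x) (L2_fun v x) => a b [c e].
    rewrite -!EFinM -EFinD lee_fin /sqmod /=.
    have := sqr_ge0 (a + c); have := sqr_ge0 (b + e); nra.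
- exact: measurable_funeM.
- exact: measurable_funeM.
Qed.

Let sqmod_fun_ge0 u x : 0 <= sqmod (L2_fun u x). Proof. exact: sqmod_ge0. Qed.

Let measurable_sqmod_fun u : measurable_fun setT (fun x => sqmod (L2_fun u x)).
Proof. exact/measurable_EFinP/measurable_sqmod. Qed.

Let sqmod_fun_lty u : (\int[mu]_x (sqmod (L2_fun u x))%:E < +oo)%E.
Proof. by rewrite ltey_eq (sqnorm_fin u). Qed.

Definition sqmod_density u : {finite_measure set X -> \bar R} :=
  density (sqmod_fun_ge0 u) (measurable_sqmod_fun u) (sqmod_fun_lty u).

(** Turns closeness of two restrictions of u into closeness of the sets for the finite measure with
    density |u|^2, to which cylinder approximation applies. *)
Lemma sqnorm_restrictionB A B u : measurable A -> measurable B ->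
  sqnorm (restriction A u - restriction B u) = sqmod_density u (symdiff A B).
Proof.
move=> mA mB.
transitivity (\int[mu]_(x in symdiff A B) (sqmod (L2_fun u x))%:E)%E; last by [].
rewrite [RHS]integral_mkcond; apply: ae_eq_integral => //.
- exact: measurable_sqmod.
- apply/(measurable_restrictT _ _).1 => //; first by apply: measurableU; exact: measurableD.
  exact/measurable_funTS/measurable_sqmod.
- have H := ae_and (restriction_ae u mA) (restriction_ae u mB).
  have H' := ae_and (L2_funD (restriction A u) (- restriction B u))
    (L2_funZ (-1) (restriction B u)).
  apply: filterS (ae_and H H') => x [[HA HB] [-> HN]] _.
  rewrite -scaleN1r HN HA HB /patch !indicE.
  have [Ax|nAx] := boolP (x \in A); have [Bx|nBx] := boolP (x \in B).
  + rewrite memNset; last by move=> [[_]|[_]]; apply; exact: set_mem.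
    by rewrite !mul1r mulN1r subrr /sqmod /= expr0n addr0.
  + rewrite mem_set; last by left; split; [exact: set_mem|by move=> /mem_set; apply/negP].
    by rewrite mul1r mul0r mulr0 addr0.
  + rewrite mem_set; last by right; split; [exact: set_mem|by move=> /mem_set; apply/negP].
    rewrite mul1r mul0r add0r mulN1r; congr _%:E.
    by rewrite /sqmod; case: (L2_fun u x) => a b /=; ring.
  + rewrite memNset; last by move=> [[/mem_set Ax]|[/mem_set Bx]];
      [rewrite Ax in nAx|rewrite Bx in nBx].
    by rewrite !mul0r mulr0 addr0 /sqmod /= expr0n addr0.
Qed.

Lemma restriction_setT u : restriction setT u = u.
Proof.
apply: L2_ext; apply: filterS (restriction_ae u measurableT) => x ->.
by rewrite indicT mul1r.
Qed.

Lemma restriction_null A : measurable A -> mu A = 0%E -> forall u, restriction A u = 0.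
Proof.
move=> mA A0 u; apply: L2_ext.
have nA : {ae mu, forall x, ~ A x}.
  by exists A; split => // x /= /contrapT.
apply: filterS (ae_and (ae_and nA (restriction_ae u mA)) (L2_fun0 mu)).
move=> x [[Ax ->] ->].
by rewrite indicE memNset// mul0r.
Qed.

End Restriction.

(** * The representations and their intertwiners *)

Lemma L2_fun_sum d (X : measurableType d) (R : realType) (mu : {measure set X -> \bar R})
    (I : Type) (s : seq I) (v : I -> L2 mu) :
  {ae mu, forall x, L2_fun (\sum_(i <- s) v i) x = \sum_(i <- s) L2_fun (v i) x}.
Proof.
elim: s => [|i s IH].
  by apply: filterS (L2_fun0 mu) => x; rewrite !big_nil.
apply: filterS (ae_and IH (L2_funD (v i) (\sum_(j <- s) v j))) => x [H H'].
by rewrite !big_cons H' H.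
Qed.

Lemma ae_forall_fin d (X : measurableType d) (R : realType) (mu : {measure set X -> \bar R})
    (I : finType) (P : I -> X -> Prop) :
  (forall i, {ae mu, forall x, P i x}) -> {ae mu, forall x, forall i, P i x}.
Proof.
move=> aP.
suff : {ae mu, forall x, forall i, i \in enum I -> P i x}.
  by apply: filterS => x H i; apply: H; rewrite mem_enum.
elim: (enum I) => [|i s IH]; first by apply: nearW.
apply: filterS (ae_and (aP i) IH) => x [Pi H] k.
by rewrite inE => /predU1P[->|/H].
Qed.

Section MarkovOperators.
Context (R : realType) (N : nat) (hN : (2 <= N)%N).
Context (lambda : 'rV[R]_N) (T : nat -> 'M[R]_N) (mu : probability (words hN) R).
Hypotheses (hmu : markov_measure mu lambda T) (hT : quasi_stationary hN T).
Implicit Types (x y : words hN) (i j : 'I_N) (u v : L2 mu) (A : set (words hN)).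

Local Notation w := (rep_weight (hN := hN) lambda T).
Local Notation S := (markov_rep (mu := mu) lambda T).
Local Notation sigma := (@Defs.shift N hN).

Let mw j : measurable_fun setT (w j).
Proof. exact: (measurable_rep_weight hmu hT). Qed.

Let msigma : measurable_fun setT sigma. Proof. exact: measurable_shift. Qed.

Lemma rep_weightE j (g : words hN -> \bar R) : (forall x, 0 <= g x)%E ->
  measurable_fun setT g ->
  (\int[mu]_x ((w j x ^+ 2)%:E * g (sigma x)) = \int[mu]_x g x)%E.
Proof. by move=> g0 mg; exact: (integral_rep_weight hmu hT). Qed.

Let rep_weight_le j (g : words hN -> \bar R) : (forall x, 0 <= g x)%E ->
  measurable_fun setT g ->
  (\int[mu]_x ((w j x ^+ 2)%:E * g (sigma x)) <= \int[mu]_x g x)%E.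
Proof. by move=> g0 mg; rewrite rep_weightE. Qed.

(* [markov_rep] is convertible to a weighted composition operator. *)
Lemma rep_ae j u : {ae mu, forall x, L2_fun (S j u) x = (w j x)%:C%C * L2_fun u (sigma x)}.
Proof. exact: (wcomp_ae (mw j) msigma (@rep_weight_le j)). Qed.

Lemma ae_rep j (P : words hN -> Prop) : {ae mu, forall x, P x} ->
  {ae mu, forall x, w j x = 0 \/ P (sigma x)}.
Proof. exact: (ae_wcomp (mw j) msigma (@rep_weight_le j)). Qed.

Lemma rep_dot j u v : L2_dot (S j u) (S j v) = L2_dot u v.
Proof. exact: (wcomp_dot (mw j) msigma (@rep_weight_le j) (@rep_weightE j)). Qed.

Definition coweight j x : R := (w j (word_cons j x))^-1.

(** The adjoint of S_j, by [adjoint_rep]: composition with an inverse branch of the shift, with the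
    reciprocal weight. *)
Definition corep j : L2 mu -> L2 mu := wcomp mu (coweight j) (word_cons j).

Let mcons j : measurable_fun setT (@word_cons N hN j).
Proof. exact: measurable_word_cons. Qed.

Let mcoweight j : measurable_fun setT (coweight j).
Proof.
rewrite (_ : coweight j = (fun x => (w j (word_cons j x)) `^ (-1))).
  apply: (measurableT_comp (measurable_powR (-1) (R := R))).
  exact: (measurableT_comp (mw j) (mcons j)).
by apply/funext => x; rewrite powR_inv1// rep_weight_ge0.
Qed.

Lemma coweight_gt0 j x : 0 < coweight j x.
Proof. by rewrite invr_gt0 (rep_weight_gt0 hmu hT). Qed.

Lemma rep_weight_neq j x : x 0%N != j -> w j x = 0.
Proof. by move=> /negbTE xj; rewrite /rep_weight xj mul0r. Qed.

(** Written as an integral over shifted words by [rep_weightE], the left side has the two weights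
    cancelling on the cylinder of j, leaving the integral of g over that cylinder. *)
Let coweight_le j (g : words hN -> \bar R) : (forall x, 0 <= g x)%E ->
  measurable_fun setT g ->
  (\int[mu]_x ((coweight j x ^+ 2)%:E * g (word_cons j x)) <= \int[mu]_x g x)%E.
Proof.
move=> g0 mg.
have mG : measurable_fun setT (fun x => (coweight j x ^+ 2)%:E * g (word_cons j x))%E.
  apply: emeasurable_funM; last exact: measurableT_comp.
  by apply/measurable_EFinP; exact: measurable_funX.
rewrite -(rep_weightE j _ mG); last by move=> x; rewrite mule_ge0 ?lee_fin ?sqr_ge0.
apply: ge0_le_integral => //.
- by move=> x _; rewrite !mule_ge0 ?lee_fin ?sqr_ge0.
- apply: emeasurable_funM; last exact: (measurableT_comp mG msigma).
  by apply/measurable_EFinP; exact: measurable_funX.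
move=> x _; have [xj|xj] := eqVneq (x 0%N) j; last first.
  by rewrite rep_weight_neq// expr0n/= mul0e.
rewrite /coweight -[in word_cons j _]xj cons_shift muleA -EFinM -exprMn divff.
  by rewrite expr1n mul1e.
by rewrite gt_eqF// (rep_weight_gt0 hmu hT) xj.
Qed.

Lemma corep_ae j u : {ae mu, forall x,
  L2_fun (corep j u) x = (coweight j x)%:C%C * L2_fun u (word_cons j x)}.
Proof. exact: (wcomp_ae (@mcoweight j) (@mcons j) (@coweight_le j)). Qed.

Lemma ae_corep j (P : words hN -> Prop) : {ae mu, forall x, P x} ->
  {ae mu, forall x, P (word_cons j x)}.
Proof.
move=> /(ae_wcomp (@mcoweight j) (@mcons j) (@coweight_le j)).
by apply: filterS => x [/eqP|//]; rewrite gt_eqF// coweight_gt0.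
Qed.

Lemma corep_linear j : linear (corep j).
Proof. exact: (wcomp_linear (@mcoweight j) (@mcons j) (@coweight_le j)). Qed.

Definition first_letter j : set (words hN) := [set x | x 0%N = j].

Lemma measurable_first_letter j : measurable (first_letter j).
Proof.
by apply: (@local_measurable _ _ 1) => x y xy; rewrite /first_letter /= xy.
Qed.

(** With [corep_rep] and [sum_rep_corep], these are the Cuntz relations for [S] and [corep]. *)
Lemma rep_corep j u : S j (corep j u) = restriction (first_letter j) u.
Proof.
apply: L2_ext.
have H := ae_and (rep_ae j (corep j u)) (ae_rep j (corep_ae j u)).
apply: filterS (ae_and H (restriction_ae u (measurable_first_letter j))).
move=> x [[-> H1] ->]; rewrite indicE.
have [xj|xj] := eqVneq (x 0%N) j; last first.
  by rewrite rep_weight_neq// memNset ?mul0r// => /eqP; rewrite (negbTE xj).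
have w0 : w j x != 0 by rewrite gt_eqF// (rep_weight_gt0 hmu hT) xj.
case: H1 => [/eqP|->]; first by rewrite (negbTE w0).
rewrite mem_set// mul1r /coweight -[in word_cons j _]xj cons_shift mulrA.
by rewrite -rmorphM divff// mul1r.
Qed.

Lemma corep_rep i j u : corep i (S j u) = if i == j then u else 0.
Proof.
apply: L2_ext.
apply: filterS (ae_and (ae_and (corep_ae i (S j u)) (ae_corep i (rep_ae j u))) (L2_fun0 mu)).
move=> x [[-> ->] H0]; case: eqVneq => [<-|ij].
  rewrite mulrA -rmorphM mulVf ?mul1r//.
  by rewrite gt_eqF// (rep_weight_gt0 hmu hT).
by rewrite rep_weight_neq// mul0r mulr0 H0.
Qed.

Lemma sum_rep_corep u : \sum_j S j (corep j u) = u.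
Proof.
apply: L2_ext.
have H : {ae mu, forall x, forall j, L2_fun (restriction (first_letter j) u) x =
    (\1_(first_letter j) x)%:C%C * L2_fun u x}.
  by apply: ae_forall_fin => j; exact: restriction_ae (measurable_first_letter j).
have H' : {ae mu, forall x, L2_fun (\sum_j restriction (first_letter j) u) x =
    \sum_j L2_fun (restriction (first_letter j) u) x}.
  exact: L2_fun_sum.
apply: filterS (ae_and H H') => x [Hj].
under eq_bigr do rewrite -rep_corep.
move=> ->; under eq_bigr do rewrite Hj.
rewrite -mulr_suml (bigD1 (x 0%N))//= big1 ?addr0; last first.
  by move=> j jx; rewrite indicE memNset// => xj; rewrite xj eqxx in jx.
by rewrite indicE mem_set// mul1r.
Qed.

Lemma restriction_rep A i j v : measurable A ->
  restriction (first_letter i `&` (sigma @^-1` A)) (S j v) =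
  if i == j then S j (restriction A v) else 0.
Proof.
move=> mA; apply: L2_ext.
have mA' : measurable (first_letter i `&` (sigma @^-1` A)).
  apply: measurableI; first exact: measurable_first_letter.
  by rewrite -[X in measurable X]setTI; exact: msigma.
have H := ae_and (restriction_ae (S j v) mA') (rep_ae j v).
have H' := ae_and (rep_ae j (restriction A v)) (ae_rep j (restriction_ae v mA)).
apply: filterS (ae_and (ae_and H H') (L2_fun0 mu)).
move=> x [[[-> ->] [E1 E2]] H0].
have [ij|ij] := eqVneq i j; last first.
  rewrite H0 indicE; have [xi|xi] := eqVneq (x 0%N) i.
    by rewrite rep_weight_neq ?xi// mul0r mulr0.
  by rewrite memNset ?mul0r// => -[/eqP]; rewrite (negbTE xi).
rewrite E1; have [xi|xi] := eqVneq (x 0%N) i; last first.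
  by rewrite rep_weight_neq ?mul0r ?mulr0// -ij.
case: E2 => [->|->]; first by rewrite !mul0r mulr0.
rewrite mulrCA; congr (_ * (_ * _)).
rewrite !indicE; congr (_%:R%:C%C); congr nat_of_bool.
by apply/idP/idP => [/set_mem[_ sA]|/set_mem sA]; apply: mem_set.
Qed.

(** S_j is isometric and vanishes off its cylinder, so pairing S_j u with v only sees the
    restriction of v, which is [S j (corep j v)]. Since [adjoint] is a choice, uniqueness is also
    needed; it follows from definiteness of the inner product. *)
Lemma adjoint_rep j : adjoint (L2_inner mu) (S j) = corep j.
Proof.
have adj u v : L2_dot (S j u) v = L2_dot u (corep j v).
  rewrite -[RHS](rep_dot j) rep_corep; apply: ae_Cintegral.
  - exact: Cintegrable_mul.
  - exact: Cintegrable_mul.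
  - apply: filterS (ae_and (rep_ae j u) (restriction_ae v (measurable_first_letter j))).
    move=> x [-> ->]; rewrite indicE; have [xj|xj] := eqVneq (x 0%N) j.
      by rewrite mem_set// mul1r.
    by rewrite rep_weight_neq// !mul0r.
apply: xget_unique => // B HB; apply/funext => v.
apply/eqP; rewrite -subr_eq0; apply: contraT => /(@L2_dot_gt0 _ _ _ mu).
rewrite -[L2_dot _ _]/(L2_inner mu _ _) linearBr /=.
have E (y : L2 mu) : L2_inner mu y (corep j v) = L2_inner mu (S j y) v by rewrite -[LHS]adj.
by rewrite -HB E subrr ltxx.
Qed.

End MarkovOperators.

Section MoreRestriction.
Context d (X : measurableType d) (R : realType) (mu : probability X R).
Implicit Types (u v : L2 mu) (A B : set X).

Lemma restriction_sum A (I : Type) (s : seq I) (v : I -> L2 mu) : measurable A ->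
  restriction A (\sum_(i <- s) v i) = \sum_(i <- s) restriction A (v i).
Proof.
move=> mA.
have m1 : measurable_fun setT (\1_A : X -> R) by exact: measurable_indic.
have mid : measurable_fun setT (@id X) by exact: measurable_id.
pose L := wcomp_linear_fun m1 mid (indicator_weight mu mA).
exact: (linear_sum L).
Qed.

Lemma restriction_comp A B u : measurable A -> measurable B ->
  restriction A (restriction B u) = restriction (A `&` B) u.
Proof.
move=> mA mB; apply: L2_ext.
have H := ae_and (restriction_ae (restriction B u) mA) (restriction_ae u mB).
have H' := restriction_ae u (measurableI _ _ mA mB).
apply: filterS (ae_and H H') => x [[-> ->] ->].
by rewrite indicI rmorphM mulrA.
Qed.

Lemma restriction_full A u : measurable A -> mu (~` A) = 0%E -> restriction A u = u.
Proof.
move=> mA A0; apply: L2_ext.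
have nA : {ae mu, forall x, A x}.
  by exists (~` A); split => //; exact: measurableC.
apply: filterS (ae_and nA (restriction_ae u mA)) => x [Ax ->].
by rewrite indicE mem_set// mul1r.
Qed.

Definition one_L2 : L2 mu := L2_class mu (fun=> 1).

Lemma one_L2_ae : {ae mu, forall x, L2_fun one_L2 x = 1}.
Proof.
apply: L2_classK; apply/sqintP; split; try exact: measurable_cst.
rewrite /sqmod /= expr1n expr0n addr0 integral_cst// mul1e.
by rewrite -ge0_fin_numE// fin_num_measure.
Qed.

(** Detects null sets through operators: equality of L^2 classes is turned back into a statement
    about mu. *)
Lemma restriction_one_null A : measurable A -> restriction A one_L2 = 0 -> mu A = 0%E.
Proof.
move=> mA A0; apply/negligibleP => //.
have : {ae mu, forall x, ~ A x}.
  apply: filterS (ae_and (ae_and one_L2_ae (restriction_ae one_L2 mA)) (L2_fun0 mu)).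
  move=> x [[E1 E2] E3] Ax; move: E2; rewrite A0 E3 E1 indicE mem_set// mul1r.
  by move/eqP; rewrite eq_sym oner_eq0.
by move=> [Z [mZ Z0 sub]]; exists Z; split => // x Ax; apply: sub => /= nA; exact: nA.
Qed.

End MoreRestriction.

Section RestrictionCons.
Context (R : realType) (N : nat) (hN : (2 <= N)%N).
Context (lambda : 'rV[R]_N) (T : nat -> 'M[R]_N) (mu : probability (words hN) R).
Hypotheses (hmu : markov_measure mu lambda T) (hT : quasi_stationary hN T).

(** Prefixing a letter to a set conjugates its projection by S_j. Iterated, this builds all cylinder
    projections from the representation. *)
Lemma restriction_cons j (A : set (words hN)) (u : L2 mu) : measurable A ->
  restriction (first_letter j `&` (@Defs.shift N hN @^-1` A)) u =
  markov_rep lambda T j (restriction A (corep lambda T j u)).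
Proof.
move=> mA.
have mA' : measurable (first_letter j `&` (@Defs.shift N hN @^-1` A)).
  apply: measurableI; first exact: measurable_first_letter.
  by rewrite -[X in measurable X]setTI; exact: measurable_shift.
rewrite -[in LHS](sum_rep_corep hmu hT u) restriction_sum//.
rewrite (bigD1 j)//= (restriction_rep hmu hT)// eqxx big1 ?addr0// => i ij.
by rewrite (restriction_rep hmu hT)// eq_sym (negbTE ij).
Qed.

End RestrictionCons.

(** * Intertwiners commute with multiplication by indicators *)

Section Intertwiners.
Context (R : realType) (N : nat) (hN : (2 <= N)%N).
Context (lambda lambda' : 'rV[R]_N) (T T' : nat -> 'M[R]_N).
Context (mu mu' : probability (words hN) R).
Hypotheses (hmu : markov_measure mu lambda T) (hmu' : markov_measure mu' lambda' T').
Hypotheses (hT : quasi_stationary hN T) (hT' : quasi_stationary hN T').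
Implicit Types (x y : words hN) (i j : 'I_N) (u v : L2 mu) (A : set (words hN)).

Local Notation S := (markov_rep (mu := mu) lambda T).
Local Notation S' := (markov_rep (mu := mu') lambda' T').
Local Notation B := (corep lambda T).
Local Notation B' := (corep lambda' T').
Local Notation sigma := (@Defs.shift N hN).

Context (W : {linear L2 mu -> L2 mu'}).
Hypothesis WS : forall i, W \o S i = S' i \o W.

(** Expanding u as the sum of the S_i S_i^* u, W u becomes the sum of the S'_i W S_i^* u, and the
    adjoint of S'_j keeps only the term i = j. *)
Lemma intertwine_corep j u : W (B j u) = B' j (W u).
Proof.
have WS' i v : W (S i v) = S' i (W v) by exact: (congr1 (@^~ v) (WS i)).
rewrite -[in RHS](sum_rep_corep hmu hT u) linear_sum.
pose L : {linear L2 mu' -> L2 mu'} := HB.pack (B' j)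
  (GRing.isLinear.Build _ _ _ _ (B' j) (corep_linear hmu' hT' j)).
rewrite -[RHS]/(L _) linear_sum (bigD1 j)//= WS' (corep_rep hmu' hT') eqxx.
by rewrite big1 ?addr0// => i ij; rewrite WS' (corep_rep hmu' hT') eq_sym (negbTE ij).
Qed.

(** Induction on the number of letters: splitting A by its first letter leaves sets [Aj j] with one
    letter less, which [restriction_cons] relates to A. *)
Lemma intertwine_restriction_local n A u : local n A ->
  W (restriction A u) = restriction A (W u).
Proof.
have WS' i v : W (S i v) = S' i (W v) by exact: (congr1 (@^~ v) (WS i)).
elim: n A u => [|n IH] A u lA.
  have [->|/set0P[x0 Ax0]] := eqVneq A set0.
    by rewrite !restriction_null ?measure0// linear0.
  suff -> : A = setT by rewrite !restriction_setT.
  by apply/seteqP; split => // x _; rewrite (lA x x0).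
have mA := local_measurable lA.
pose Aj j : set (words hN) := [set x | A (word_cons j x)].
have lAj j : local n (Aj j).
  by move=> x y xy; rewrite /Aj /= (lA _ (word_cons j y))// => -[|k] //= /xy.
have AE j : A `&` first_letter j = first_letter j `&` (sigma @^-1` Aj j).
  apply/seteqP; split => x.
    by move=> [Ax xj]; split => //; rewrite /Aj /= -xj cons_shift.
  by move=> [xj]; rewrite /Aj /= -[in word_cons j _]xj cons_shift.
have m1 j : measurable (first_letter (hN := hN) j) by exact: measurable_first_letter.
have mAj j : measurable (Aj j) by exact: local_measurable (lAj j).
rewrite -[in LHS](sum_rep_corep hmu hT u) -[in RHS](sum_rep_corep hmu' hT' (W u)).
rewrite !restriction_sum// linear_sum; apply: eq_bigr => j _.
rewrite (rep_corep hmu hT) (rep_corep hmu' hT') !restriction_comp// AE.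
rewrite (restriction_cons hmu hT)// WS' IH// intertwine_corep.
by rewrite (restriction_cons hmu' hT').
Qed.

Context (K : R) (K0 : 0 <= K).
Hypothesis WK : forall u, (sqnorm (W u) <= K%:E * sqnorm u)%E.

Lemma intertwine_restriction A u : measurable A ->
  W (restriction A u) = restriction A (W u).
Proof.
move=> mA; apply/eqP; rewrite -subr_eq0; apply/eqP/sqnorm_eq0/eqP.
rewrite eq_le sqnorm_ge0 andbT; apply/lee_addgt0Pr => e e0; rewrite add0e.
(* C must be close to A for the densities |u|^2 and |W u|^2 at once. [sqnormB_le] doubles both
   errors and W multiplies the first by K, hence the tolerance e / (2 K + 2). *)
pose kappa : {finite_measure set (words hN) -> \bar R} :=
  measure_add (sqmod_density u) (sqmod_density (W u)).
have K1 : 0 < 2 * K + 2 by rewrite ltr_pwDr// mulr_ge0.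
have [_ /(_ (e / (2 * K + 2)))] := measurable_approximable kappa mA.
rewrite divr_gt0// => /(_ isT)[n [C [lC]]].
rewrite [kappa _]measure_addE.
set e' := e / _ => kE.
have mC := local_measurable lC.
have E1 : W (restriction A u) - restriction A (W u) =
    W (restriction A u - restriction C u) -
    (restriction A (W u) - restriction C (W u)).
  by rewrite linearB /= (intertwine_restriction_local u lC) opprB addrA subrK.
rewrite E1; apply: le_trans (sqnormB_le _ _) _.
have d1 : (sqmod_density u (symdiff A C) <= e'%:E)%E.
  by apply: le_trans (ltW kE); exact: leeDl.
have d2 : (sqmod_density (W u) (symdiff A C) <= e'%:E)%E.
  by apply: le_trans (ltW kE); exact: leeDr.
apply: (@le_trans _ _ (2%:E * (K%:E * e'%:E) + 2%:E * e'%:E)%E).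
  apply: leeD; apply: lee_wpmul2l => //.
    apply: (le_trans (WK _)); apply: lee_wpmul2l; first by rewrite lee_fin.
    by rewrite sqnorm_restrictionB.
  by rewrite sqnorm_restrictionB.
rewrite -!EFinM -EFinD lee_fin mulrA -mulrDl /e' mulrC divfK// gt_eqF//.
Qed.

End Intertwiners.

Section HilbertNorm.
Context d (X : measurableType d) (R : realType) (mu : {measure set X -> \bar R}).

Lemma sqr_hnorm (u : L2 mu) : hnorm (L2_inner mu) u ^+ 2 = (fine (sqnorm u))%:C%C.
Proof. by rewrite sqrtCK -L2_dot_sqnorm. Qed.

Lemma hnorm_ge0 (u : L2 mu) : 0 <= hnorm (L2_inner mu) u.
Proof.
rewrite sqrtC_ge0 -[L2_inner mu u u]/(L2_dot u u) L2_dot_sqnorm lecR fine_ge0//.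
exact: sqnorm_ge0.
Qed.

Lemma sqnorm0 : sqnorm (0 : L2 mu) = 0%E.
Proof.
rewrite (@ae_sqnorm _ _ _ mu 0 (fun=> 0) (L2_fun0 mu)); try exact: measurable_cst.
by rewrite integral0_eq// => x _; rewrite /sqmod /= expr0n addr0.
Qed.

End HilbertNorm.

Section BoundedOperators.
Context d d' (X : measurableType d) (Y : measurableType d') (R : realType).
Context (mu : {measure set X -> \bar R}) (nu : {measure set Y -> \bar R}).

Lemma bounded_operator_sqnorm (W : {linear L2 mu -> L2 nu}) :
  bounded_operator (L2_inner mu) (L2_inner nu) W ->
  exists2 K : R, 0 <= K & forall u, (sqnorm (W u) <= K%:E * sqnorm u)%E.
Proof.
(* The bound M is a complex number; squaring and taking real parts gives a real constant, and the
   absolute value makes it nonnegative. *)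
move=> [M HM]; exists `|complex.Re (M ^+ 2)| => // u.
have : hnorm (L2_inner nu) (W u) ^+ 2 <= (M * hnorm (L2_inner mu) u) ^+ 2.
  apply: lerXn2r; rewrite ?nnegrE; [exact: hnorm_ge0| |exact: HM].
  exact: le_trans (hnorm_ge0 _) (HM u).
rewrite exprMn !sqr_hnorm -(fineK (sqnorm_fin (W u))) -(fineK (sqnorm_fin u)).
rewrite -EFinM lee_fin lecE; case: (M ^+ 2) => a b /andP[_] /=.
rewrite mulr0 subr0 => /le_trans; apply.
by rewrite ler_wpM2r ?ler_norm// fine_ge0// sqnorm_ge0.
Qed.

Lemma sqnorm_bounded_operator (W : {linear L2 mu -> L2 nu}) :
  (forall u, (sqnorm (W u) <= sqnorm u)%E) ->
  bounded_operator (L2_inner mu) (L2_inner nu) W.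
Proof.
move=> H; exists 1 => u; rewrite mul1r /hnorm.
rewrite -[L2_inner mu u u]/(L2_dot u u) -[L2_inner nu (W u) (W u)]/(L2_dot _ _).
by rewrite !L2_dot_sqnorm ler_sqrtC ?qualifE/= lecR ?fine_le ?fine_ge0 ?sqnorm_fin ?sqnorm_ge0.
Qed.

Lemma isometry_sqnorm (W : {linear L2 mu -> L2 nu}) :
  (forall u v, L2_inner nu (W u) (W v) = L2_inner mu u v) ->
  forall u, sqnorm (W u) = sqnorm u.
Proof.
move=> H u; have : L2_dot (W u) (W u) = L2_dot u u by exact: H.
rewrite !L2_dot_sqnorm => /(congr1 (@complex.Re R)) /= E.
by rewrite -(fineK (sqnorm_fin (W u))) E fineK// sqnorm_fin.
Qed.

End BoundedOperators.

(** * From intertwiners to measures *)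

Section NecessaryConditions.
Context (R : realType) (N : nat) (hN : (2 <= N)%N).
Context (lambda lambda' : 'rV[R]_N) (T T' : nat -> 'M[R]_N).
Context (mu mu' : probability (words hN) R).
Hypotheses (hmu : markov_measure mu lambda T) (hmu' : markov_measure mu' lambda' T').
Hypotheses (hT : quasi_stationary hN T) (hT' : quasi_stationary hN T').

Local Notation S := (markov_rep (mu := mu) lambda T).
Local Notation S' := (markov_rep (mu := mu') lambda' T').

(** W carries the indicator of a mu'-null set to 0, and W is injective, so the set is mu-null. For
    the other direction, surjectivity writes the constant 1 of L^2(mu') as W u. *)
Lemma equivalent_representations_measure :
  equivalent_representations (L2_inner mu) (L2_inner mu') S S' ->
  measure_equivalent mu mu'.
Proof.
move=> [W [[Wdot Wsurj] WS]].
have WE := isometry_sqnorm Wdot.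
have WK u : (sqnorm (W u) <= 1%:E * sqnorm u)%E by rewrite WE mul1e.
have WR := intertwine_restriction hmu hmu' hT hT' WS ler01 WK.
split; apply/null_content_dominatesP => A mA A0.
  apply: restriction_one_null => //; apply: sqnorm_eq0.
  by rewrite -WE WR// restriction_null// sqnorm0.
have [u uE] := Wsurj (one_L2 mu').
apply: restriction_one_null => //.
by rewrite -uE -WR// restriction_null// linear0.
Qed.

Lemma mutually_singular_disjoint : mutually_singular mu mu' ->
  disjoint_representations (L2_inner mu) (L2_inner mu') S S'.
Proof.
move=> [A [mA A0 A'0]] W Wb WS _ u.
have [K K0 WK] := bounded_operator_sqnorm Wb.
have WR := intertwine_restriction hmu hmu' hT hT' WS K0 WK.
by rewrite -(restriction_full (W u) mA A'0) -WR// restriction_null// linear0.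
Qed.

End NecessaryConditions.

(** * Intertwiners from densities *)

Section RealDensity.
Context d (X : measurableType d) (R : realType).
Context (nu m : {finite_measure set X -> \bar R}) (num : nu `<< m).

Definition rn_density x : R := fine (Radon_Nikodym_SigmaFinite.f nu m x).

Local Notation h := rn_density.

Lemma rn_densityE x : (h x)%:E = Radon_Nikodym_SigmaFinite.f nu m x.
Proof. by rewrite fineK// Radon_Nikodym_SigmaFinite.f_fin_num. Qed.

Lemma rn_density_ge0 x : 0 <= h x.
Proof. by rewrite -lee_fin rn_densityE Radon_Nikodym_SigmaFinite.f_ge0. Qed.

Lemma measurable_rn_density : measurable_fun setT h.
Proof.
apply/measurable_EFinP.
rewrite (_ : EFin \o h = Radon_Nikodym_SigmaFinite.f nu m).
  exact: measurable_int (Radon_Nikodym_SigmaFinite.f_integrable num).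
by apply/funext => x; exact: rn_densityE.
Qed.

Lemma integral_rn_density (g : X -> \bar R) : (forall x, 0 <= g x)%E ->
  measurable_fun setT g -> (\int[m]_x (g x * (h x)%:E) = \int[nu]_x g x)%E.
Proof.
move=> g0 mg; rewrite -(Radon_Nikodym_SigmaFinite.change_of_variables num)//.
by apply: eq_integral => x _; rewrite rn_densityE.
Qed.

Lemma rn_density_gt0_ae : {ae nu, forall x, 0 < h x}.
Proof.
have mS : measurable [set x | (h x)%:E = 0%E].
  by apply: measurable_level_eq; apply/measurable_EFinP; exact: measurable_rn_density.
exists [set x | (h x)%:E = 0%E]; split => //.
  have m1 : measurable_fun setT (fun x => (\1_[set x | (h x)%:E = 0%E] x)%:E : \bar R).
    by apply/measurable_EFinP; exact: measurable_indic.
  rewrite -[LHS]/(nu [set x | (h x)%:E = 0%E]).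
  have <- : (\int[nu]_x (\1_[set x | (h x)%:E = 0%E] x)%:E = nu [set x | (h x)%:E = 0%E])%E.
    by rewrite integral_indic// setIT.
  rewrite -integral_rn_density//; apply: integral0_eq => x _.
  rewrite indicE; case: (boolP (x \in _)) => [/set_mem ->|_]; by rewrite ?mule0 ?mul0e.
move=> x /= /negP; rewrite -leNgt => hx; congr _%:E; apply/le_anti.
by rewrite hx rn_density_ge0.
Qed.

End RealDensity.

Section DensityRatio.
Context d (X : measurableType d) (R : realType).
Context (mu mu' m : {finite_measure set X -> \bar R}).
Context (mum : mu `<< m) (mum' : mu' `<< m).

(* The junk value [y / 0 = 0] makes the ratio vanish where [mu'] has density 0. *)
Definition sqrt_ratio x : R := Num.sqrt (rn_density mu m x / rn_density mu' m x).

Lemma measurable_sqrt_ratio : measurable_fun setT sqrt_ratio.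
Proof.
apply: (measurableT_comp (f := @Num.sqrt R)).
  by apply: continuous_measurable_fun; exact: sqrt_continuous.
apply: measurable_funM; first exact: measurable_rn_density.
rewrite (_ : (fun x => _) = (fun x => (rn_density mu' m x) `^ (-1))).
  apply: (measurableT_comp (measurable_powR (-1) (R := R))).
  exact: measurable_rn_density.
by apply/funext => x; rewrite powR_inv1// rn_density_ge0.
Qed.

Let measurable_sqr_ratio (g : X -> \bar R) : measurable_fun setT g ->
  measurable_fun setT (fun x => (sqrt_ratio x ^+ 2)%:E * g x)%E.
Proof.
move=> mg; apply: emeasurable_funM => //; apply/measurable_EFinP.
by apply: measurable_funX; exact: measurable_sqrt_ratio.
Qed.

Let sqr_ratio x : sqrt_ratio x ^+ 2 = rn_density mu m x / rn_density mu' m x.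
Proof. by rewrite sqr_sqrtr// divr_ge0 ?rn_density_ge0. Qed.

Let measurable_density_support :
  measurable_fun setT (fun x => (if rn_density mu' m x == 0 then 0 else 1 : R)).
Proof.
rewrite (_ : (fun x => _) = \1_(~` [set x | (rn_density mu' m x)%:E = 0%E])).
  apply/measurable_indic/measurableC/measurable_level_eq/measurable_EFinP.
  exact: measurable_rn_density.
apply/funext => x; rewrite indicE in_setC.
case: eqP => [E|/eqP E]; first by rewrite mem_set//= E.
by rewrite memNset// => -[/eqP]; rewrite (negbTE E).
Qed.

Let null_dominates_ae_gt0 : mu `<< mu' -> {ae mu, forall x, 0 < rn_density mu' m x}.
Proof.
move=> /null_content_dominatesP dom; have [A [mA A0 HA]] := rn_density_gt0_ae mum'.
by exists A; split => //; exact: dom.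
Qed.

(** Weighting mu' by h / h' gives mu restricted to the set where h' > 0. Hence a contraction in
    general, and an isometry when mu is dominated by mu'. *)
Let integral_ratio (g : X -> \bar R) : (forall x, 0 <= g x)%E -> measurable_fun setT g ->
  (\int[mu']_x ((sqrt_ratio x ^+ 2)%:E * g x) =
   \int[mu]_x (g x * (if rn_density mu' m x == 0 then 0 else 1)%:E))%E.
Proof.
move=> g0 mg.
have mI := measurable_density_support.
rewrite -(integral_rn_density mum') ?(integral_rn_density mum)//; last 2 first.
- by move=> x; rewrite mule_ge0// lee_fin sqr_ge0.
- exact: measurable_sqr_ratio.
rewrite -(integral_rn_density mum); last 2 first.
- by move=> x; rewrite mule_ge0// lee_fin; case: ifP.
- by apply: emeasurable_funM => //; exact/measurable_EFinP.
apply: eq_integral => x _; rewrite sqr_ratio muleAC -EFinM muleC -muleA -EFinM.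
congr (_ * _%:E)%E; case: eqP => [->|/eqP h0]; first by rewrite mulr0 mul0r.
by rewrite divfK// mul1r.
Qed.

Lemma sqrt_ratio_le (g : X -> \bar R) : (forall x, 0 <= g x)%E -> measurable_fun setT g ->
  (\int[mu']_x ((sqrt_ratio x ^+ 2)%:E * g x) <= \int[mu]_x g x)%E.
Proof.
move=> g0 mg; rewrite integral_ratio//; apply: ge0_le_integral => //.
- by move=> x _; rewrite mule_ge0// lee_fin; case: ifP.
- by apply: emeasurable_funM => //; exact/measurable_EFinP/measurable_density_support.
- by move=> x _; case: ifP => _; rewrite ?mule0 ?mule1.
Qed.

Lemma sqrt_ratio_eq (g : X -> \bar R) : mu `<< mu' -> (forall x, 0 <= g x)%E ->
  measurable_fun setT g ->
  (\int[mu']_x ((sqrt_ratio x ^+ 2)%:E * g x) = \int[mu]_x g x)%E.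
Proof.
move=> dom g0 mg; rewrite integral_ratio//; apply: ae_eq_integral => //.
  by apply: emeasurable_funM => //; exact/measurable_EFinP/measurable_density_support.
have := null_dominates_ae_gt0 dom.
by apply: filterS => x h0 _; rewrite gt_eqF// mule1.
Qed.

Lemma sqrt_ratio_gt0 x : 0 < rn_density mu m x -> 0 < rn_density mu' m x ->
  0 < sqrt_ratio x.
Proof. by move=> h0 h0'; rewrite sqrtr_gt0 divr_gt0. Qed.

End DensityRatio.

Lemma real_complexM (R : realType) (a b : R) : (a * b)%:C%C = a%:C%C * b%:C%C.
Proof. exact: rmorphM. Qed.

Section DensityCocycle.
Context (R : realType) (N : nat) (hN : (2 <= N)%N).
Context (lambda : 'rV[R]_N) (T : nat -> 'M[R]_N) (mu : probability (words hN) R).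
Hypotheses (hmu : markov_measure mu lambda T) (hT : quasi_stationary hN T).
Context (m : {finite_measure set (words hN) -> \bar R}) (mum : mu `<< m).
Context (j : 'I_N) (G : words hN -> R).
Hypotheses (mG : measurable_fun setT G) (G0 : forall x, 0 <= G x)
  (Gj : forall x, x 0%N != j -> G x = 0).
Hypothesis intG : forall F : words hN -> \bar R, (forall x, 0 <= F x)%E ->
  measurable_fun setT F ->
  (\int[m]_x (F (Defs.shift x) * (G x)%:E) = \int[m]_x F x)%E.

Local Notation w := (rep_weight (hN := hN) lambda T j).
Local Notation h := (rn_density mu m).

(* Both sides are densities of [A |-> mu (sigma (A `&` first_letter j))]. *)
Lemma density_cocycle :
  {ae m, forall x, w x ^+ 2 * h x = h (Defs.shift x) * G x}.
Proof.
have mw : measurable_fun setT w by exact: (measurable_rep_weight hmu hT).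
have mh : measurable_fun setT h by exact: measurable_rn_density.
have ms := @measurable_shift N hN.
have h0 x : 0 <= h x by exact: rn_density_ge0.
have mw2 : measurable_fun setT (fun x => (w x ^+ 2)%:E).
  by apply/measurable_EFinP; exact: measurable_funX.
have mf : measurable_fun setT (fun x => (w x ^+ 2 * h x)%:E).
  by apply/measurable_EFinP/measurable_funM => //; exact: measurable_funX.
have mg : measurable_fun setT (fun x => (h (Defs.shift x) * G x)%:E).
  by apply/measurable_EFinP/measurable_funM => //; exact: measurableT_comp.
have fi : m.-integrable setT (fun x => (w x ^+ 2 * h x)%:E).
  apply/integrableP; split => //.
  under eq_integral do rewrite gee0_abs ?lee_fin ?mulr_ge0 ?sqr_ge0// EFinM.
  rewrite (integral_rn_density mum)//; last by move=> x; rewrite lee_fin sqr_ge0.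
  have := rep_weightE hmu hT j (g := cst 1%E) (fun _ => lee01) (measurable_cst _).
  under eq_integral do rewrite /= mule1.
  by move=> ->; rewrite integral_cst// mul1e -ge0_fin_numE// fin_num_measure.
suff H : ae_eq m setT (fun x => (w x ^+ 2 * h x)%:E)
    (fun x => (h (Defs.shift x) * G x)%:E).
  by apply: filterS H => x /(_ I) [].
apply: integral_ae_eq => // A _ mA.
(* Both candidate densities vanish off the cylinder of j, and on it the indicator of A at x is F at
   the shift of x; so integrals over A become integrals against a function of the shifted word. *)
pose F (y : words hN) : \bar R := (\1_A (word_cons j y))%:E.
have F0 y : (0 <= F y)%E by rewrite lee_fin.
have mF : measurable_fun setT F.
  apply/measurable_EFinP; apply: (@measurableT_comp _ _ _ _ _ _ (\1_A : words hN -> R)).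
    exact: measurable_indic.
  exact: measurable_word_cons.
have restr (p : words hN -> R) : (forall x, x 0%N != j -> p x = 0) ->
    (\int[m]_(x in A) (p x)%:E = \int[m]_x (F (Defs.shift x) * (p x)%:E))%E.
  move=> pj; rewrite integral_mkcond; apply: eq_integral => x _.
  rewrite /patch /F indicE; have [xj|xj] := eqVneq (x 0%N) j.
    by rewrite -xj cons_shift; case: (_ \in _); rewrite ?mul1e ?mul0e.
  by rewrite pj// mule0; case: ifP.
rewrite restr; last by move=> x /rep_weight_neq ->; rewrite expr0n mul0r.
rewrite restr; last by move=> x /Gj ->; rewrite mulr0.
transitivity (\int[m]_x ((F (Defs.shift x) * (w x ^+ 2)%:E) * (h x)%:E))%E.
  by apply: eq_integral => x _; rewrite EFinM muleA.
rewrite (integral_rn_density mum); last 2 first.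
- by move=> x; rewrite mule_ge0// lee_fin sqr_ge0.
- by apply: emeasurable_funM => //; exact: (measurableT_comp mF ms).
transitivity (\int[mu]_x F x)%E.
  by rewrite -(rep_weightE hmu hT j F0 mF); apply: eq_integral => x _; rewrite muleC.
rewrite -(integral_rn_density mum)// -[LHS]intG.
- by apply: eq_integral => x _; rewrite EFinM muleA.
- by move=> x; rewrite mule_ge0// lee_fin.
- by apply: emeasurable_funM => //; exact/measurable_EFinP.
Qed.

End DensityCocycle.

(** * The multiplication operator by the square root of the density ratio *)

Section SqrtRatioIntertwiner.
Context (R : realType) (N : nat) (hN : (2 <= N)%N).
Context (lambda lambda' : 'rV[R]_N) (T T' : nat -> 'M[R]_N).
Context (mu mu' : probability (words hN) R).
Hypotheses (hmu : markov_measure mu lambda T) (hmu' : markov_measure mu' lambda' T').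
Hypotheses (hT : quasi_stationary hN T) (hT' : quasi_stationary hN T').

Let m : {finite_measure set (words hN) -> \bar R} := measure_add mu mu'.

Let mum : mu `<< m.
Proof.
apply/null_content_dominatesP => A mA mA0.
have : (mu A + mu' A = 0)%E := etrans (esym (measure_addE mu mu' A)) mA0.
by move=> /eqP; rewrite padde_eq0// => /andP[/eqP].
Qed.

Let mum' : mu' `<< m.
Proof.
apply/null_content_dominatesP => A mA mA0.
have : (mu A + mu' A = 0)%E := etrans (esym (measure_addE mu mu' A)) mA0.
by move=> /eqP; rewrite padde_eq0// => /andP[_ /eqP].
Qed.

Local Notation w := (rep_weight (hN := hN) lambda T).
Local Notation w' := (rep_weight (hN := hN) lambda' T').
Local Notation h := (rn_density mu m).
Local Notation h' := (rn_density mu' m).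
Local Notation S := (markov_rep (mu := mu) lambda T).
Local Notation S' := (markov_rep (mu := mu') lambda' T').

(** The derivative of m o sigma with respect to m on the cylinder of j. It is the same for mu and
    mu', so it cancels in h / h'. *)
Let G j x := w j x ^+ 2 * h x + w' j x ^+ 2 * h' x.

Let mG j : measurable_fun setT (G j).
Proof.
have mw : measurable_fun setT (w j) by exact: (measurable_rep_weight hmu hT).
have mw' : measurable_fun setT (w' j) by exact: (measurable_rep_weight hmu' hT').
apply: measurable_funD; apply: measurable_funM.
- exact: measurable_funX.
- exact: measurable_rn_density.
- exact: measurable_funX.
- exact: measurable_rn_density.
Qed.

Let G0 j x : 0 <= G j x.
Proof. by rewrite addr_ge0// mulr_ge0 ?sqr_ge0// rn_density_ge0. Qed.

Let Gj j x : x 0%N != j -> G j x = 0.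
Proof. by move=> xj; rewrite /G !rep_weight_neq// expr0n !mul0r addr0. Qed.

Let intG j (F : words hN -> \bar R) : (forall x, 0 <= F x)%E ->
  measurable_fun setT F ->
  (\int[m]_x (F (Defs.shift x) * (G j x)%:E) = \int[m]_x F x)%E.
Proof.
move=> F0 mF.
have mw : measurable_fun setT (w j) by exact: (measurable_rep_weight hmu hT).
have mw' : measurable_fun setT (w' j) by exact: (measurable_rep_weight hmu' hT').
have ms := @measurable_shift N hN.
have mFs : measurable_fun setT (fun x => F (Defs.shift x)).
  exact: (measurableT_comp mF ms).
have mp (v : words hN -> R) : measurable_fun setT v ->
    measurable_fun setT (fun x => (v x ^+ 2)%:E * F (Defs.shift x))%E.
  move=> mv; apply: emeasurable_funM => //.
  by apply/measurable_EFinP; exact: measurable_funX.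
transitivity (\int[m]_x (((w j x ^+ 2)%:E * F (Defs.shift x)) * (h x)%:E +
    ((w' j x ^+ 2)%:E * F (Defs.shift x)) * (h' x)%:E))%E.
  apply: eq_integral => x _.
  rewrite /G EFinD ge0_muleDr ?lee_fin ?mulr_ge0 ?sqr_ge0 ?rn_density_ge0//.
  by congr (_ + _)%E; rewrite EFinM muleA [in LHS](muleC (F _)).
rewrite ge0_integralD//; last 4 first.
- by move=> x _; rewrite !mule_ge0// lee_fin ?sqr_ge0// rn_density_ge0.
- by apply: emeasurable_funM; [exact: mp|apply/measurable_EFinP; exact: measurable_rn_density].
- by move=> x _; rewrite !mule_ge0// lee_fin ?sqr_ge0// rn_density_ge0.
- by apply: emeasurable_funM; [exact: mp|apply/measurable_EFinP; exact: measurable_rn_density].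
rewrite (integral_rn_density mum); last 2 first.
- by move=> x; rewrite mule_ge0// lee_fin sqr_ge0.
- exact: mp.
rewrite (integral_rn_density mum'); last 2 first.
- by move=> x; rewrite mule_ge0// lee_fin sqr_ge0.
- exact: mp.
rewrite (rep_weightE hmu hT)// (rep_weightE hmu' hT')//.
by rewrite ge0_integral_measure_add.
Qed.

Let cocycle j : {ae m, forall x, w j x ^+ 2 * h x = h (Defs.shift x) * G j x}.
Proof. exact: (density_cocycle hmu hT mum (mG j) (@Gj j) (intG j)). Qed.

Let cocycle' j : {ae m, forall x, w' j x ^+ 2 * h' x = h' (Defs.shift x) * G j x}.
Proof. exact: (density_cocycle hmu' hT' mum' (mG j) (@Gj j) (intG j)). Qed.

Local Notation omega := (sqrt_ratio mu mu' m).

Let omega_cocycle j :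
  {ae mu', forall x, omega x * w j x = w' j x * omega (Defs.shift x)}.
Proof.
have aem (P : words hN -> Prop) : {ae m, forall x, P x} -> {ae mu', forall x, P x}.
  move=> [A [mA A0 PA]]; exists A; split => //.
  exact: (proj1 (null_content_dominatesP _ _) mum').
apply: filterS (ae_and (aem _ (ae_and (cocycle j) (cocycle' j))) (rn_density_gt0_ae mum')).
move=> x [[E E'] h'x].
have [xj|xj] := eqVneq (x 0%N) j; last by rewrite !rep_weight_neq// mulr0 mul0r.
have wx : 0 < w j x by rewrite (rep_weight_gt0 hmu hT) xj.
have wx' : 0 < w' j x by rewrite (rep_weight_gt0 hmu' hT') xj.
(* The second cocycle identity makes both factors positive where h' x > 0; this allows dividing by
   [G j x] to express both shifted densities. *)
have hG : 0 < h' (Defs.shift x) * G j x by rewrite -E' mulr_gt0// exprn_gt0.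
have Gx : 0 < G j x.
  rewrite lt_neqAle G0 andbT; apply/eqP => G0'.
  by move: hG; rewrite -G0' mulr0 ltxx.
have hsx : 0 < h' (Defs.shift x) by rewrite -(pmulr_lgt0 _ Gx).
have hx : 0 <= h x by exact: rn_density_ge0.
rewrite /sqrt_ratio.
have -> : h (Defs.shift x) = w j x ^+ 2 * h x / G j x by rewrite E mulfK// gt_eqF.
have -> : h' (Defs.shift x) = w' j x ^+ 2 * h' x / G j x by rewrite E' mulfK// gt_eqF.
have -> : w j x ^+ 2 * h x / G j x / (w' j x ^+ 2 * h' x / G j x) =
    (w j x / w' j x) ^+ 2 * (h x / h' x).
  by field; rewrite !gt_eqF.
rewrite [in RHS]sqrtrM ?sqr_ge0// sqrtr_sqr ger0_norm ?divr_ge0 ?ltW//.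
move: wx wx'; move: (w j x) (w' j x) (Num.sqrt _) => a b c _ b0.
by field; rewrite gt_eqF.
Qed.

Let momega : measurable_fun setT omega. Proof. exact: measurable_sqrt_ratio. Qed.

Let mid : measurable_fun setT (@id (words hN)). Proof. exact: measurable_id. Qed.

Let W : {linear L2 mu -> L2 mu'} :=
  wcomp_linear_fun momega mid (sqrt_ratio_le mum mum').

Let W_ae u : {ae mu', forall x, L2_fun (W u) x = (omega x)%:C%C * L2_fun u x}.
Proof. exact: (wcomp_ae momega mid (sqrt_ratio_le mum mum')). Qed.

Let ae_W (P : words hN -> Prop) : {ae mu, forall x, P x} ->
  {ae mu', forall x, omega x = 0 \/ P x}.
Proof. exact: (ae_wcomp momega mid (sqrt_ratio_le mum mum')). Qed.

Let WS i : W \o S i = S' i \o W.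
Proof.
apply/funext => u; apply: L2_ext.
have H1 := ae_and (W_ae (S i u)) (ae_W (rep_ae hmu hT i u)).
have H2 := ae_and (rep_ae hmu' hT' i (W u)) (ae_rep hmu' hT' i (W_ae u)).
apply: filterS (ae_and (ae_and H1 H2) (omega_cocycle i)) => x [[[E1 E2] [E3 E4]] E].
rewrite [LHS]E1 [RHS]E3.
(* Where the identity for a representative may fail, the weight in front is 0, so both sides vanish;
   elsewhere the claim is [omega_cocycle]. *)
transitivity ((omega x * w i x)%:C%C * L2_fun u (Defs.shift x)).
  by case: E2 => [->|->]; [rewrite !(mul0r, rmorph0)|rewrite real_complexM mulrA].
rewrite E; case: E4 => [->|->]; last by rewrite real_complexM mulrA.
by rewrite !(mul0r, rmorph0).
Qed.

Lemma measure_equivalent_representations : measure_equivalent mu mu' ->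
  equivalent_representations (L2_inner mu) (L2_inner mu') S S'.
Proof.
move=> [dom dom']; exists W; split; last exact: WS.
split.
  have eq g := @sqrt_ratio_eq _ _ _ mu mu' m mum mum' g dom.
  exact: (wcomp_dot momega mid (sqrt_ratio_le mum mum') eq).
move=> v.
have momega' : measurable_fun setT (sqrt_ratio mu' mu m).
  exact: measurable_sqrt_ratio.
(* A preimage of v: multiplication by the reciprocal ratio, which inverts omega where both densities
   are positive, that is mu'-almost everywhere. *)
pose u : L2 mu := wcomp mu (sqrt_ratio mu' mu m) id v.
have uE := wcomp_ae momega' mid (sqrt_ratio_le mum' mum) v.
exists u; apply: L2_ext.
have hgt0 : {ae mu', forall x, 0 < h x}.
  have [A [mA A0 HA]] := rn_density_gt0_ae mum.
  by exists A; split => //; exact: (proj1 (null_content_dominatesP _ _) dom').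
apply: filterS (ae_and (ae_and (W_ae u) (ae_W uE))
  (ae_and hgt0 (rn_density_gt0_ae mum'))) => x [[-> E] [hx hx']].
have o0 : 0 < omega x by exact: sqrt_ratio_gt0.
case: E => [E|->]; first by rewrite E ltxx in o0.
rewrite mulrA -real_complexM /sqrt_ratio -sqrtrM ?divr_ge0 ?ltW//.
have -> : h x / h' x * (h' x / h x) = 1 by field; rewrite !gt_eqF.
by rewrite sqrtr1 mul1r.
Qed.

Lemma disjoint_mutually_singular :
  disjoint_representations (L2_inner mu) (L2_inner mu') S S' ->
  mutually_singular mu mu'.
Proof.
move=> disj.
(* W is a bounded intertwiner, hence 0; on the constant 1 this says that omega, and with it h,
   vanishes mu'-almost everywhere. The set where h = 0 then separates the measures. *)
have W0 : W (one_L2 mu) = 0.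
  apply: disj; last 2 first.
  - exact: WS.
  - move=> i; rewrite (adjoint_rep hmu hT) (adjoint_rep hmu' hT').
    by apply/funext => u; exact: (intertwine_corep hmu hmu' hT hT' WS).
  apply: sqnorm_bounded_operator => u.
  exact: (sqnorm_wcomp_le momega mid (sqrt_ratio_le mum mum')).
have mS : measurable [set x | (h x)%:E = 0%E].
  by apply: measurable_level_eq; apply/measurable_EFinP; exact: measurable_rn_density.
have [B [mB B0 HB]] := rn_density_gt0_ae mum.
exists [set x | (h x)%:E = 0%E]; split => //.
  apply: subset_measure0 B0 => // x /= [E]; apply: HB => /=.
  by rewrite E ltxx.
apply/negligibleP; first exact: measurableC.
suff : {ae mu', forall x, h x = 0}.
  by move=> [C [mC C0 HC]]; exists C; split => // x hx; apply: HC => E; apply: hx;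
    rewrite /= E.
have H := ae_and (W_ae (one_L2 mu)) (ae_W (one_L2_ae mu)).
apply: filterS (ae_and (ae_and H (L2_fun0 mu')) (rn_density_gt0_ae mum')).
move=> x [[[E1 E2] E3] hx'].
have o0 : omega x = 0.
  case: E2 => // E2; move: E1; rewrite W0 E3 E2 mulr1 => /(congr1 (@complex.Re R)) /=.
  by move=> <-.
apply/eqP; apply: contraT => hx.
have hx0 : 0 < h x by rewrite lt_neqAle eq_sym hx rn_density_ge0.
by have := sqrt_ratio_gt0 hx0 hx'; rewrite o0 ltxx.
Qed.

End SqrtRatioIntertwiner.

Theorem proposition4p2 (R : realType) (N : nat) (hN : (2 <= N)%N)
    (lambda lambda' : 'rV[R]_N) (T T' : nat -> 'M[R]_N)
    (mu mu' : probability (words hN) R)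
    (hmu : markov_measure mu lambda T) (hmu' : markov_measure mu' lambda' T')
    (hT : quasi_stationary hN T) (hT' : quasi_stationary hN T') :
  let S := markov_rep (mu := mu) lambda T in
  let S' := markov_rep (mu := mu') lambda' T' in
  let Z : words hN -> \bar R := Z_infty lambda T lambda' T' in
  let hsum : words hN -> \bar R := hellinger_sum T T' in
  [<-> equivalent_representations (L2_inner mu) (L2_inner mu') S S';
       measure_equivalent mu mu';
       mu' [set x | (Z x < +oo)%E] = 1%E /\ mu [set x | (0 < Z x)%E] = 1%E;
       {ae mu, forall x, (hsum x < +oo)%E} /\
       {ae mu', forall x, (hsum x < +oo)%E}] /\
  [<-> disjoint_representations (L2_inner mu) (L2_inner mu') S S';
       mutually_singular mu mu';
       mu' [set x | Z x = +oo%E] = 1%E \/ mu [set x | Z x = 0%E] = 1%E;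
       {ae mu', forall x, hsum x = +oo%E}].
Proof.
move=> S S' Z hsum.
have eqv := measure_equivalent_representations hmu hmu' hT hT'.
split; tfae.
- exact: (equivalent_representations_measure hmu hmu' hT hT').
- exact: (measure_equivalent_Z hmu hmu').
- by move=> [H H']; apply/(measure_equivalent_hellinger hmu hmu')/(Z_measure_equivalent hmu hmu').
- by move=> [H H']; apply/eqv/(hellinger_measure_equivalent hmu hmu').
- exact: (disjoint_mutually_singular hmu hmu' hT hT').
- by move=> /(mutually_singular_Z hmu hmu'); left.
- by move=> /(Z_mutually_singular hmu hmu')/(mutually_singular_hellinger hmu hmu').
- by move=> /(hellinger_mutually_singular hmu hmu')/(mutually_singular_disjoint hmu hmu' hT hT').
Qed.
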